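(* Consider the nonoverlapping two-level additive Schwarz method, i.e. the local spaces are $V_i^h=\{v\in V^h: v=0 \text{ in } \Omega\setminus\overline{\Omega_i}\}$, $1\le i\le N$, and the coarse space is $V_0$. Let $$\lambda=\eta\Big(\max_{\partial K_{mk},\, m>k}\ \max_{e\subset \partial K_{mk}}W_e\Big)\,\gamma(1)\,\frac{H}{h}+\max\big(\gamma(\alpha),\ \eta\,\beta(\alpha)\big),$$ where $\partial K_{mk}$ ranges over the coarse edges shared by two coarse elements and $e$ over the fine edges contained in $\partial K_{mk}$. Then there is a constant $C$ independent of $h$, $H$ and $\alpha$ such that for every $u\in V^h$ there exist $u_0\in V_0$ and $u_i\in V_i^h$, $1\le i\le N$, with $u=\sum_{i=0}^N u_i$ and $$\sum_{i=0}^N a_i(u_i,u_i)\le C\,\lambda\, a_h(u,u).$$ Consequently $\kappa(T)\lesssim\lambda$, where $\kappa(T)$ is the condition number of the additive Schwarz operator $T$.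
   Context: **Domain, meshes, coefficient.** $\Omega\subset\mathbb{R}^2$ is a polygonal domain. $\mathcal{T}_h$ is a quasi-uniform fine triangulation of $\Omega$ (elements $\tau$, mesh size $h$). $\mathcal{T}_H=\{K\}$ is a quasi-uniform coarse triangulation with mesh size $H$; the edges of coarse elements are aligned with edges of fine elements. The coefficient $\alpha\in L^\infty(\Omega)$ is piecewise constant on $\mathcal{T}_h$ (possibly with jumps across elements) and $\alpha(x)\ge\alpha_0>0$, with $\alpha_0$ a fixed constant. $\partial K_{mk}=\partial K_m\cap\partial K_k$ is the open edge shared by the coarse elements $K_m,K_k$. $h_e$ is the length of the fine edge $e$. $A\lesssim B$ means $A\le CB$ with $C>0$ depending only on the shape regularity of the meshes ($\alpha_0$ is regarded as fixed; the subdomain partition is regarded as part of the regular mesh family, so that the number of subdomains adjacent to any subdomain is bounded). **Weights, jumps.** For an interior fine edge $e$ shared by $\tau_+^e,\tau_-^e$ with coefficients $\alpha_\pm^e$ and unit outward normals $\mathbf n_\pm^e$: $w_+^e=\alpha_-^e/(\alpha_+^e+\alpha_-^e)$, $w_-^e=\alpha_+^e/(\alpha_+^e+\alpha_-^e)$, $W_e=w_+^e\alpha_+^e+w_-^e\alpha_-^e=2\alpha_+^e\alpha_-^e/(\alpha_+^e+\alpha_-^e)$, $[v]=v_+^e\mathbf n_+^e+v_-^e\mathbf n_-^e$, $\{v\}_w^e=w_+^ev_+^e+w_-^ev_-^e$. For a boundary fine edge $e\subset\partial\Omega$: $w_e=1$, $W_e=\alpha_e$ (coefficient of the adjacent element),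 $[v]=v_e\mathbf n_e$, $\{v\}_w^e=w_ev_e$. **Discrete space and form.** $V^h=\{v: v|_\tau\in P_1(\tau)\ \forall\tau\in\mathcal{T}_h\}$ (no interelement continuity), and for $u,v\in V^h$ $$a_h(u,v)=\sum_\tau\int_\tau\alpha\nabla u\cdot\nabla v\,dx-\sum_{e}\int_e\{\alpha\nabla u\}_w^e\cdot[v]\,ds-\sum_e\int_e\{\alpha\nabla v\}_w^e\cdot[u]\,ds+\eta\sum_e\frac{W_e}{h_e}\int_e[u]\cdot[v]\,ds,$$ the sums over $e$ running over all interior and boundary fine edges. The penalty parameter satisfies $\eta>\eta_0$, where $\eta_0>0$ is a sufficiently large constant such that $a_h(u,u)\ge C(\eta)\|u\|_{1,h,\alpha,\Omega}^2$ for all $u\in V^h$ and all $\eta>\eta_0$, with $C(\eta)>0$ independent of the jumps of $\alpha$; here $\|u\|_{1,h,\alpha,\Omega}^2=\sum_\tau\int_\tau\alpha|\nabla u|^2dx+\sum_{e}\frac{W_e}{h_e}\int_e|[u]|^2ds$ (all interior and boundary fine edges). **Coarse space.** For each $K\in\mathcal{T}_H$ let $\mathcal{N}^H(K)$ be its vertices. For $x_p\in\mathcal{N}^H(K)$, boundary data $\psi_{p,\partial K}$ on $\partial K$ are given that are continuous, piecewise linear w.r.t. $\mathcal{T}_h|_{\partial K}$, and satisfy $\psi_{p,\partial K}(x_{p'})=\delta_{p,p'}$ for $x_{p'}\in\mathcal{N}^H(K)$, $0\le\psi_{p,\partial K}\le1$, $\sum_{x_p\in\mathcal{N}^H(K)}\psi_{p,\partial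 K}=1$ on $\partial K$, and $\psi_{p,\partial K}=0$ on the edge of $K$ opposite $x_p$. Let $S^h(K)$ be the continuous piecewise linear functions on $K$ w.r.t. $\mathcal{T}_h$ and $S_0^h(K)=S^h(K)\cap H_0^1(K)$. The multiscale basis function $\phi_{p,K}\in S^h(K)$ is the discrete harmonic extension: $\phi_{p,K}|_{\partial K}=\psi_{p,\partial K}$ and $\int_K\alpha\nabla\phi_{p,K}\cdot\nabla v_h\,dx=0$ for all $v_h\in S_0^h(K)$; it is extended by zero outside $K$. $V_0=\mathrm{span}\{\phi_{p,K}: x_p\in\mathcal{N}^H(K),K\in\mathcal{T}_H\}\subset V^h$ (functions may be discontinuous across coarse edges). **Subdomains and Schwarz operator.** $\Omega$ is partitioned into nonoverlapping open subdomains $\Omega_1,\dots,\Omega_N$, $\overline\Omega=\bigcup_i\overline{\Omega_i}$, aligned with $\mathcal{T}_h$ and $\mathcal{T}_H$. $a_0$ and $a_i$ are the restrictions of $a_h$ to $V_0\times V_0$ and $V_i^h\times V_i^h$. $T_0:V^h\to V_0$ is defined by $a_0(T_0u,v)=a_h(u,v)$ for all $v\in V_0$, and $T_i:V^h\to V_i^h$ by $a_i(T_iu,v)=a_h(u,v)$ for all $v\in V_i^h$. $T=T_0+T_1+\dots+T_N$, and $\kappa(T)$ is its condition number with respect to the inner product $a_h$ (ratio of largest to smallest eigenvalue). **Indicators.** $\gamma(\alpha)=\max_{K\in\mathcal{T}_H}\max_{x_p\in\mathcal{N}^H(K)}\int_K\alpha|\nabla\phi_{p,K}|^2dx$, and $\gamma(1)=\max_{K}\max_{x_p}\int_K|\nabla\phi_{p,K}|^2dx$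 (same basis functions). $\beta(\alpha)=\max(\beta^I(\alpha),\beta^B(\alpha))$ with $$\beta^I(\alpha)=\max_{\partial K_{mk}\subset\Omega,\,m>k}\ \max_{x_p\in\mathcal{N}^H(K_m)\cap\overline{\partial K_{mk}}}\ \sum_{e\subset\partial K_{mk}}\int_e\frac{W_e}{h_e}|\phi_{p,K_m}-\phi_{p,K_k}|^2ds,$$ and $\beta^B(\alpha)$ is the maximum, over coarse edges $F\subset\partial\Omega$ (edge of $K_m$) and endpoints $x_p$ of $F$, of $\sum_{e\subset F}\int_e\frac{W_e}{h_e}|\phi_{p,K_m}|^2ds$ (sums over fine edges $e$). *)

(* Defs.v *)
From HB Require Import structures.
From mathcomp Require Import all_boot all_order all_algebra.
From mathcomp Require Import all_classical all_reals all_analysis.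

Set Implicit Arguments.
Unset Strict Implicit.
Unset Printing Implicit Defensive.

Import Order.TTheory GRing.Theory Num.Theory.
Import numFieldNormedType.Exports.

Local Open Scope classical_set_scope.
Local Open Scope ring_scope.

Notation plane R := (R * R)%type (only parsing).

Definition dot (R : realType) (x y : plane R) : R := x.1 * y.1 + x.2 * y.2.

(* The library norm on [R * R] is the max norm, so the Euclidean one is
   defined separately. *)
Definition enorm (R : realType) (x : plane R) : R := Num.sqrt (dot x x).

Definition scalep (R : realType) (c : R) (x : plane R) : plane R :=
  (c * x.1, c * x.2).

Definition leb2 (R : realType) :=
  ((@lebesgue_measure R) \x (@lebesgue_measure R))%E.

(* Convex hull of the vertices of [t] whose index lies in [A]; it is empty
   when [A] is. *)
Definition face (R : realType) (t : 'I_3 -> plane R) (A : {set 'I_3}) :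
    set (plane R) :=
  [set x | exists l : 'I_3 -> R,
     [/\ forall i, 0 <= l i, forall i, i \notin A -> l i = 0,
         \sum_i l i = 1 & x = \sum_i scalep (l i) (t i)]].

Definition segment (R : realType) (p q : plane R) (t : R) : plane R :=
  scalep (1 - t) p + scalep t q.

Record mesh (R : realType) := Mesh {
  nelt : nat;
  vert : 'I_nelt -> 'I_3 -> plane R }.

(* [(K, k)] is the side of the element [K] opposite to its vertex [k]. *)
Notation side m := ('I_(nelt m) * 'I_3)%type.

(* [(s, Some s')] is an interior edge, seen as the side [s] of one element and
   the side [s'] of another one; [(s, None)] is a boundary edge. *)
Notation edge m := (side m * option (side m))%type.

Section Mesh.
Variables (R : realType) (m : mesh R).
Implicit Types (K : 'I_(nelt m)) (s : side m) (e : edge m).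

Definition elt K : set (plane R) := face (vert K) [set: 'I_3]%SET.
Definition side_set s : set (plane R) := face (vert s.1) [set~ s.2]%SET.
Definition elt_boundary K : set (plane R) := \bigcup_k side_set (K, k).

(* The indices are added in ['I_3] = Z/3. *)
Definition side_a s : plane R := vert s.1 (s.2 + 1).
Definition side_b s : plane R := vert s.1 (s.2 + 2).

Definition side_len s : R := enorm (side_b s - side_a s).

Definition same_side s s' : bool :=
  ((side_a s == side_a s') && (side_b s == side_b s')) ||
  ((side_a s == side_b s') && (side_b s == side_a s')).

(* Ordering the two elements lists every interior edge once. *)
Definition is_edge e : bool :=
  if e.2 is Some s' then (e.1.1 < s'.1)%N && same_side e.1 s'
  else [forall s', (s'.1 != e.1.1) ==> ~~ same_side e.1 s'].

Definition edge_set e : set (plane R) := side_set e.1.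
Definition edge_len e : R := side_len e.1.

Definition edge_int e (f : plane R -> R) : R :=
  edge_len e * \int[lebesgue_measure]_(t in `[0, 1])
                 f (segment (side_a e.1) (side_b e.1) t).

Definition normal s : plane R :=
  let d := ((side_b s).2 - (side_a s).2, (side_a s).1 - (side_b s).1) in
  scalep (- Num.sg (dot d (vert s.1 s.2 - side_a s)) / enorm d) d.

Definition diam K : R := \big[Num.max/0]_(k < 3) side_len (K, k).
Definition mesh_size : R := \big[Num.max/0]_K diam K.

(* Every element contains a disc of radius comparable to the mesh size; this
   contains shape regularity. *)
Definition quasi_uniform (sigma : R) : Prop :=
  forall K, exists c : plane R,
    [set x | enorm (x - c) <= mesh_size / sigma] `<=` elt K.

Definition nondegenerate : Prop :=
  forall K, let p := vert K 1 - vert K 0 in let q := vert K 2 - vert K 0 in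
    p.1 * q.2 - p.2 * q.1 != 0.

Definition conforming : Prop :=
  forall K K', K != K' ->
  exists A B : {set 'I_3}, [/\ A != [set: 'I_3]%SET,
    elt K `&` elt K' = face (vert K) A & elt K `&` elt K' = face (vert K') B].

Definition triangulation (Omega : set (plane R)) : Prop :=
  [/\ nondegenerate, conforming & closure Omega = \bigcup_K elt K].

Definition aligned_with (D : set (plane R)) : Prop :=
  closure D = \bigcup_(K in [set K | elt K `<=` closure D]) elt K.

End Mesh.

(* Slits are excluded: the domain is the interior of its closure. *)
Definition polygonal_domain (R : realType) (Omega : set (plane R)) : Prop :=
  [/\ open Omega, connected Omega, Omega !=set0, interior (closure Omega) = Omega
    & (exists r : R, forall x, Omega x -> enorm x <= r) /\
      exists S : seq (plane R * plane R),
        closure Omega `\` Omega =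
        \bigcup_(pq in [set` S]) [set segment pq.1 pq.2 t | t in `[0, 1]]].

Definition refines (R : realType) (Th TH : mesh R) : Prop :=
  (forall tau : 'I_(nelt Th), exists K : 'I_(nelt TH), elt tau `<=` elt K) /\
  (forall S : side TH, side_set S =
     \bigcup_(s in [set s : side Th | side_set s `<=` side_set S]) side_set s).

(* A function that is affine on each element: the row of index [tau] holds the
   coefficients of c0 + c1 x1 + c2 x2 on the element [tau]. *)
Notation dgspace R m := ('M[R]_(nelt m, 3)).

Section Discrete.
Variables (R : realType) (m : mesh R).
Implicit Types (u v : dgspace R m) (tau : 'I_(nelt m)) (e : edge m).
Implicit Types (al : 'I_(nelt m) -> R) (D : set (plane R)).

Definition ev u tau (x : plane R) : R := u tau 0 + u tau 1 * x.1 + u tau 2 * x.2.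
Definition grad u tau : plane R := (u tau 1, u tau 2).

(* [wplus a b] is the weight on the side where the coefficient is [a]. *)
Definition wplus (a b : R) : R := b / (a + b).

Definition edge_weight al e : R :=
  if e.2 is Some s' then
    let ap := al e.1.1 in let am := al s'.1 in
    wplus ap am * ap + wplus am ap * am
  else al e.1.1.

Definition jump u e (x : plane R) : plane R :=
  if e.2 is Some s' then
    scalep (ev u e.1.1 x) (normal e.1) + scalep (ev u s'.1 x) (normal s')
  else scalep (ev u e.1.1 x) (normal e.1).

(* The weighted average of the flux, constant on each edge. *)
Definition avg_flux al u e : plane R :=
  if e.2 is Some s' then
    let ap := al e.1.1 in let am := al s'.1 in
    scalep (wplus ap am) (scalep ap (grad u e.1.1)) +
    scalep (wplus am ap) (scalep am (grad u s'.1))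
  else scalep (al e.1.1) (grad u e.1.1).

Definition elt_energy al u v tau : R :=
  \int[@leb2 R]_(x in elt tau) (al tau * dot (grad u tau) (grad v tau)).

Definition energy_on D al u v : R :=
  \sum_(tau | `[< elt tau `<=` D >]) elt_energy al u v tau.

Definition jump_form al u v : R :=
  \sum_(e | is_edge e) edge_weight al e / edge_len e *
    edge_int e (fun x => dot (jump u e x) (jump v e x)).

Definition flux_form al u v : R :=
  \sum_(e | is_edge e) edge_int e (fun x => dot (avg_flux al u e) (jump v e x)).

Definition a_h al (eta : R) u v : R :=
  \sum_tau elt_energy al u v tau - flux_form al u v - flux_form al v u
  + eta * jump_form al u v.

Definition dgnorm2 al u : R :=
  \sum_tau elt_energy al u u tau + jump_form al u u.

Definition coercive al (eta c : R) : Prop :=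
  forall u, c * dgnorm2 al u <= a_h al eta u u.

(* Continuous piecewise linear functions on [D], extended by zero. *)
Definition Sh D u : Prop :=
  (forall tau, ~ elt tau `<=` D -> row tau u = 0) /\
  (forall tau tau' x, elt tau `<=` D -> elt tau' `<=` D ->
     elt tau x -> elt tau' x -> ev u tau x = ev u tau' x).

Definition Vloc (Omega D : set (plane R)) u : Prop :=
  forall tau x, elt tau x -> (Omega `\` closure D) x -> ev u tau x = 0.

End Discrete.

Section Coarse.
Variables (R : realType) (Th TH : mesh R).
Implicit Types (K : 'I_(nelt TH)) (p : 'I_3) (al : 'I_(nelt Th) -> R).
Implicit Types (phi : 'I_(nelt TH) -> 'I_3 -> dgspace R Th).

Definition S0h K (u : dgspace R Th) : Prop :=
  Sh (elt K) u /\
  forall tau x, elt tau `<=` elt K -> elt tau x -> elt_boundary K x ->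
    ev u tau x = 0.

Definition boundary_data K (psi : 'I_3 -> plane R -> R) : Prop :=
  [/\ forall p, {within elt_boundary K, continuous (psi p)},
      forall p (s : side Th), side_set s `<=` elt_boundary K ->
        forall t, 0 <= t <= 1 ->
        psi p (segment (side_a s) (side_b s) t) =
        (1 - t) * psi p (side_a s) + t * psi p (side_b s),
      forall p p', psi p (vert K p') = (p == p')%:R,
      forall p x, elt_boundary K x -> 0 <= psi p x <= 1
    & (forall x, elt_boundary K x -> \sum_p psi p x = 1) /\
      (forall p x, side_set (K, p) x -> psi p x = 0)].

Definition multiscale_basis al (psi : 'I_(nelt TH) -> 'I_3 -> plane R -> R) phi :=
  forall K p,
  [/\ Sh (elt K) (phi K p),
      forall tau x, elt tau `<=` elt K -> elt tau x -> elt_boundary K x ->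
        ev (phi K p) tau x = psi K p x
    & forall v, S0h K v -> energy_on (elt K) al (phi K p) v = 0].

Definition V0 phi : {vspace (dgspace R Th)} :=
  <<[seq phi s.1 s.2 | s : side TH]>>%VS.

Definition gamma al phi : R :=
  \big[Num.max/0]_K \big[Num.max/0]_(p < 3)
    energy_on (elt K) al (phi K p) (phi K p).

(* The element adjacent to the fine edge [e] that lies in [K]; it selects the
   trace from inside [K] of functions supported in [K]. *)
Definition elt_in K (e : edge Th) : 'I_(nelt Th) :=
  if e.2 is Some s' then
    if `[< elt e.1.1 `<=` elt K >] then e.1.1 else s'.1
  else e.1.1.

Definition trace_in K (u : dgspace R Th) (e : edge Th) (x : plane R) : R :=
  ev u (elt_in K e) x.

Definition fine_edge_of (E : edge TH) (e : edge Th) : bool :=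
  is_edge e && `[< edge_set e `<=` edge_set E >].

(* [p] and [p'] are the local indices in the two coarse elements of the same
   endpoint of the shared coarse edge. *)
Definition betaI al phi : R :=
  \big[Num.max/0]_(S : side TH * side TH | is_edge (S.1, Some S.2))
  \big[Num.max/0]_(p : 'I_3 * 'I_3 | (p.1 != S.1.2) &&
                                     (vert S.1.1 p.1 == vert S.2.1 p.2))
  \sum_(e | fine_edge_of (S.1, Some S.2) e)
    edge_int e (fun x => edge_weight al e / edge_len e *
      `|trace_in S.1.1 (phi S.1.1 p.1) e x
        - trace_in S.2.1 (phi S.2.1 p.2) e x| ^+ 2).

Definition betaB al phi : R :=
  \big[Num.max/0]_(S : side TH | is_edge (S, None))
  \big[Num.max/0]_(p < 3 | p != S.2)
  \sum_(e | fine_edge_of (S, None) e)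
    edge_int e (fun x => edge_weight al e / edge_len e *
      `|trace_in S.1 (phi S.1 p) e x| ^+ 2).

Definition beta al phi : R := Num.max (betaI al phi) (betaB al phi).

Definition max_coarse_weight al : R :=
  \big[Num.max/0]_(S : side TH * side TH | is_edge (S.1, Some S.2))
  \big[Num.max/0]_(e | fine_edge_of (S.1, Some S.2) e) edge_weight al e.

Definition lambda al (eta : R) phi : R :=
  eta * max_coarse_weight al * gamma (fun=> 1) phi *
    (mesh_size TH / mesh_size Th)
  + Num.max (gamma al phi) (eta * beta al phi).

End Coarse.

Section Schwarz.
Variables (R : realType) (Th TH : mesh R).

Definition subdomain_partition (Omega : set (plane R)) (N : nat)
    (Om : 'I_N -> set (plane R)) : Prop :=
  [/\ forall i, open (Om i) /\ Om i !=set0,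
      forall i j, i != j -> Om i `&` Om j = set0,
      closure Omega = \bigcup_i closure (Om i)
    & forall i, aligned_with Th (Om i) /\ aligned_with TH (Om i)].

Definition adjacent (D D' : set (plane R)) : Prop :=
  exists s s' : side Th, is_edge (s, Some s') /\
    ((elt s.1 `<=` closure D /\ elt s'.1 `<=` closure D') \/
     (elt s.1 `<=` closure D' /\ elt s'.1 `<=` closure D)).

Definition bounded_adjacency (N : nat) (Om : 'I_N -> set (plane R)) (M : nat) :=
  forall i, (#|[set j : 'I_N | (j != i) && `[< adjacent (Om i) (Om j) >]]%SET|
             <= M)%N.

Definition galerkin_projection (V : vectType R) (a : V -> V -> R) (W : V -> Prop)
    (T : 'End(V)) : Prop :=
  forall u, W (T u) /\ forall v, W v -> a (T u) v = a u v.

Definition condition_number (V : vectType R) (T : 'End(V)) (kappa : R) : Prop :=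
  exists lmin lmax : R,
  [/\ passmx.leigenvalue T lmin, passmx.leigenvalue T lmax,
      forall mu, passmx.leigenvalue T mu -> lmin <= mu <= lmax,
      0 < lmin & kappa = lmax / lmin].

End Schwarz.

(* Main.v *)
Require Import Defs.
From HB Require Import structures.
From mathcomp Require Import all_boot all_order all_algebra.
From mathcomp Require Import all_classical all_reals all_analysis.
From mathcomp Require Import measurable_realfun ring lra.
From mathcomp Require complex polyrcf.

Set Implicit Arguments.
Unset Strict Implicit.
Unset Printing Implicit Defensive.
Import Order.TTheory GRing.Theory Num.Theory.
Import numFieldNormedType.Exports.
Local Open Scope classical_set_scope.
Local Open Scope ring_scope.

(* The coarse component [u0] of [u] is constant on every coarse element: the
   multiscale basis functions of [K] sum to the indicator of [K], so these
   functions belong to [V0]. The constant on [K] is the value of [u] at a point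
   of [K], or [0] if [K] has a side on the domain boundary, and [u - u0] is cut
   along the subdomains.

   The splitting creates jumps only across coarse edges, and these are bounded
   by the trace of [u - u0] on the boundary of [K]. A line in [K] avoiding the
   fine vertices crosses O(H/h) fine elements, each contributing its oscillation
   and one jump of [u]. Averaging over parallel lines yields lines carrying a
   fraction h/H of the total, and joining every fine side on the boundary of [K]
   to such a line gives a broken Poincare and trace inequality with the factor
   H/h of [lambda]. Each basis function vanishes on one side of [K] while their
   sum is [1], so the same inequality bounds [gamma 1] below by a positive
   constant; hence [lambda] dominates both [1] and [eta * W * H / h].

   The stable splitting bounds the smallest eigenvalue of [T] from below, and
   the largest one is at most [M + 2] because a subdomain space is
   [a_h]-orthogonal to all but at most [M] of the other ones. *)

(** * Triangles and conforming meshes *)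

(** The constants of [u0] have no gradient, and cutting along whole elements splits the elementwise
    energy exactly, so only jumps have to be estimated. On coarse edges the weight is replaced by
    its maximum and the trace of [u - u0] is measured without the coefficient; the norm controls
    such unweighted quantities at the price [1 / alpha0]. The maximum runs over interior coarse
    edges only, which is why the constant must be exactly 0 on coarse elements with a side on the
    domain boundary: there the boundary trace of [u], itself a penalised jump, controls [u]. Since
    functions are discontinuous and constants may depend only on [sigma], [alpha0], [eta0], [c] and
    [M], the Poincare inequality is obtained by explicit counting along lines. The counting takes
    place in coarse barycentric coordinates, where quasi-uniformity becomes a spacing of order
    [h / H] between fine centres. No constant depends on [eta]: coercivity controls jumps without
    this factor, and the penalty is read off the form itself. *)

Lemma ord3P (k : 'I_3) : [\/ k = 0, k = 1 | k = 2].
Proof.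
case: k => [[|[|[|//]]] hk]; [apply: Or31|apply: Or32|apply: Or33];
  exact: val_inj.
Qed.

Lemma ord3E : (((0 : 'I_3) + 1 = 1)%R * ((0 : 'I_3) + 2 = 2)%R *
  ((1 : 'I_3) + 1 = 2)%R * ((1 : 'I_3) + 2 = 0)%R *
  ((2 : 'I_3) + 1 = 0)%R * ((2 : 'I_3) + 2 = 1)%R)%type.
Proof. by repeat split; apply: val_inj. Qed.

Lemma sum3 (V : nmodType) (F : 'I_3 -> V) : \sum_i F i = F 0 + F 1 + F 2.
Proof.
rewrite !big_ord_recl big_ord0 addr0 addrA.
by congr (_ + F _ + F _); apply: val_inj.
Qed.

Lemma sum3k (V : nmodType) (F : 'I_3 -> V) k :
  \sum_i F i = F k + F (k + 1) + F (k + 2).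
Proof.
rewrite sum3; case: (ord3P k) => ->; rewrite ?ord3E //.
- by rewrite -addrA addrC.
- by rewrite addrC addrA.
Qed.

Lemma ord3k (k i : 'I_3) : [\/ i = k, i = k + 1 | i = k + 2].
Proof.
have : [|| i == k, i == k + 1 | i == k + 2].
  by case: (ord3P k) => ->; case: (ord3P i) => ->.
by case/or3P => /eqP ->; [apply: Or31|apply: Or32|apply: Or33].
Qed.

Lemma ord3_neq1 (k : 'I_3) : k + 1 != k.
Proof. by case: (ord3P k) => ->. Qed.
Lemma ord3_neq2 (k : 'I_3) : k + 2 != k.
Proof. by case: (ord3P k) => ->. Qed.
Lemma ord3F (k : 'I_3) : ((k + 1 == k = false)%R * (k + 2 == k = false)%R *
  (k == k + 1 = false)%R * (k == k + 2 = false)%R *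
  (k + 1 == k + 2 = false)%R * (k + 2 == k + 1 = false)%R)%type.
Proof. by case: (ord3P k) => ->. Qed.

Section Triangle.
Variables (R : realType).
Implicit Types (t : 'I_3 -> plane R) (x y : plane R) (k i : 'I_3).

Definition orient (a b c : plane R) : R :=
  (b.1 - a.1) * (c.2 - a.2) - (b.2 - a.2) * (c.1 - a.1).

Definition area2 t := orient (t 0) (t 1) (t 2).

(** Cramer's formula: a barycentric coordinate is a quotient of signed areas, hence affine and
    defined on the whole plane. *)
Definition bary t k x := orient x (t (k + 1)) (t (k + 2)) / area2 t.

Definition affine (f : plane R -> R) := exists c0 c1 c2, forall x, f x = c0 + c1 * x.1 + c2 * x.2.

Lemma plane_eq x y : x.1 = y.1 -> x.2 = y.2 -> x = y.
Proof. by case: x => ? ?; case: y => ? ? /= -> ->. Qed.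

Lemma sum_fst (F : 'I_3 -> plane R) : (\sum_i F i).1 = \sum_i (F i).1.
Proof. by rewrite !sum3. Qed.
Lemma sum_snd (F : 'I_3 -> plane R) : (\sum_i F i).2 = \sum_i (F i).2.
Proof. by rewrite !sum3. Qed.

Lemma orient_cyc t k : orient (t k) (t (k + 1)) (t (k + 2)) = area2 t.
Proof. by rewrite /area2 /orient; case: (ord3P k) => ->; rewrite !ord3E //; ring. Qed.

Lemma bary_affine t k : affine (bary t k).
Proof.
rewrite /affine /bary /orient.
exists (((t (k + 1)).1 * (t (k + 2)).2 - (t (k + 1)).2 * (t (k + 2)).1) / area2 t).
exists (((t (k + 1)).2 - (t (k + 2)).2) / area2 t).
exists (((t (k + 2)).1 - (t (k + 1)).1) / area2 t) => x.
rewrite !(mulrAC _ (area2 t)^-1) -!mulrDl; congr (_ / _); ring.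
Qed.

Lemma bary_vert t k i : area2 t != 0 -> bary t k (t i) = (k == i)%:R.
Proof.
move=> h; rewrite /bary; case: (ord3k k i) => ->.
- by rewrite orient_cyc divff // eqxx.
- rewrite eq_sym (negPf (ord3_neq1 k)); rewrite [orient _ _ _](_ : _ = 0) ?mul0r //.
  by rewrite /orient; ring.
- rewrite eq_sym (negPf (ord3_neq2 k)); rewrite [orient _ _ _](_ : _ = 0) ?mul0r //.
  by rewrite /orient; ring.
Qed.

Lemma bary_sum1 t x : area2 t != 0 -> \sum_k bary t k x = 1.
Proof.
move=> h; rewrite sum3 /bary -!mulrDl -(divff h); congr (_ / _).
by rewrite /area2 /orient !ord3E; ring.
Qed.

Lemma affine_conv f (l : 'I_3 -> R) t : affine f -> \sum_i l i = 1 ->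
  f (\sum_i scalep (l i) (t i)) = \sum_i l i * f (t i).
Proof.
move=> [c0 [c1 [c2 hf]]]; rewrite hf sum_fst sum_snd !sum3 !hf /= => hl.
by rewrite -[c0 in LHS]mulr1 -hl; ring.
Qed.

Lemma bary_combo t x : area2 t != 0 -> x = \sum_k scalep (bary t k x) (t k).
Proof.
move=> h; have E a b : a / area2 t * b * area2 t = a * b by field.
apply: plane_eq; rewrite ?sum_fst ?sum_snd sum3 /= /bary;
  apply: (mulIf h); rewrite !(mulrDl _ _ (area2 t)) !E /area2 /orient !ord3E; ring.
Qed.

Lemma affine_bary f t x : area2 t != 0 -> affine f ->
  f x = \sum_i bary t i x * f (t i).
Proof.
by move=> h hf; rewrite {1}(bary_combo x h) affine_conv // bary_sum1.
Qed.

Lemma conv_bary (l : 'I_3 -> R) t k : area2 t != 0 -> \sum_i l i = 1 ->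
  bary t k (\sum_i scalep (l i) (t i)) = l k.
Proof.
move=> h hl; rewrite affine_conv //; last exact: bary_affine.
rewrite (bigD1 k) //= bary_vert // eqxx mulr1 big1 ?addr0 // => i /negPf ik.
by rewrite bary_vert // eq_sym ik mulr0.
Qed.

(** Nondegeneracy makes barycentric coordinates unique, so the existential convex combination
    becomes a list of sign conditions, with which the later geometry is carried out. *)
Lemma faceP t (A : {set 'I_3}) x : area2 t != 0 -> face t A x <->
  (forall k, 0 <= bary t k x) /\ (forall k, k \notin A -> bary t k x = 0).
Proof.
move=> h; split=> [[l [l0 lA l1 ->]]|[b0 bA]].
  by split=> k; rewrite conv_bary //; exact: lA.
by exists (bary t ^~ x); split => //; [exact: bary_sum1|exact: bary_combo].
Qed.

Lemma affine_segment f x y s : affine f ->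
  f (segment x y s) = (1 - s) * f x + s * f y.
Proof. by move=> [c0 [c1 [c2 hf]]]; rewrite !hf /=; ring. Qed.

Lemma bary_inj t x y : area2 t != 0 -> (forall k, bary t k x = bary t k y) -> x = y.
Proof.
by move=> h e; rewrite (bary_combo x h) (bary_combo y h); apply: eq_bigr => k _; rewrite e.
Qed.

Lemma bary_exists t (l : 'I_3 -> R) : area2 t != 0 -> \sum_i l i = 1 ->
  exists x, forall k, bary t k x = l k.
Proof.
by move=> h hl; exists (\sum_i scalep (l i) (t i)) => k; rewrite conv_bary.
Qed.

End Triangle.

Section MeshGeo.
Variables (R : realType) (m : mesh R) (hnd : Defs.nondegenerate m) (hcf : conforming m).
Implicit Types (K : 'I_(nelt m)) (s : side m) (x : plane R).

Definition lam K := bary (vert K).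

Lemma area2_neq0 K : area2 (vert K) != 0.
Proof. by have := hnd K; rewrite /area2 /orient. Qed.

Lemma eltP K x : elt K x <-> forall k, 0 <= lam K k x.
Proof.
rewrite /elt faceP; last exact: area2_neq0.
by split=> [[]//|h]; split => // k; rewrite inE.
Qed.

Lemma side_setP s x : side_set s x <-> elt s.1 x /\ lam s.1 s.2 x = 0.
Proof.
rewrite /side_set faceP; last exact: area2_neq0.
split=> [[h1 h2]|[/eltP h1 h2]]; split=> //.
- exact/eltP.
- by apply: h2; rewrite !inE negbK.
- by move=> k; rewrite !inE negbK => /eqP ->.
Qed.

Lemma lam_affine K k : affine (lam K k). Proof. exact: bary_affine. Qed.

Lemma lam_sum K k x : lam K k x + lam K (k + 1) x + lam K (k + 2) x = 1.
Proof. by rewrite -(sum3k (fun k => lam K k x)) bary_sum1 // area2_neq0. Qed.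

Lemma lam_vert K k i : lam K k (vert K i) = (k == i)%:R.
Proof. by rewrite /lam bary_vert // area2_neq0. Qed.

Definition ipt K x := forall k, 0 < lam K k x.

Lemma ipt_elt K x : ipt K x -> elt K x.
Proof. by move=> h; apply/eltP => k; exact: ltW. Qed.

(** Conformity puts the intersection of two distinct elements in a proper face of [K], where some
    coordinate vanishes. *)
Lemma ipt_uniq K K' x : ipt K x -> elt K' x -> K = K'.
Proof.
move=> hx hx'; apply/eqP/negP => /negP /hcf [A [B [hA eA _]]].
have : (elt K `&` elt K') x by split; [exact: ipt_elt|].
rewrite eA => /(faceP _ _ (area2_neq0 _)) [_ h].
have [k kA] : exists k, k \notin A.
  by move: hA; rewrite -finset.subTset => /subsetPn [k _ kA]; exists k.
by have := hx k; rewrite /lam h // ltxx.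
Qed.

Lemma ipt_exists K : exists x, ipt K x.
Proof.
have [|x hx] := @bary_exists R (vert K) (fun=> 3%:R^-1) (area2_neq0 K).
  by rewrite sum3; field.
by exists x => k; rewrite /lam hx invr_gt0 ltr0n.
Qed.

Definition is_vertex x := exists K k, x = vert K k.

Lemma set3_proper (A : {set 'I_3}) : A != [set: 'I_3]%SET ->
  (exists i, A \subset [set i])%SET \/ exists k, A = ([set~ k])%SET.
Proof.
rewrite -finset.subTset => /subsetPn [k _ kA].
have [k1|k1] := boolP (k + 1 \in A); last first.
  left; exists (k + 2); apply/fintype.subsetP => i iA; rewrite inE.
  by case: (ord3k k i) iA => -> // ; rewrite ?(negPf kA) ?(negPf k1).
have [k2|k2] := boolP (k + 2 \in A); last first.
  left; exists (k + 1); apply/fintype.subsetP => i iA; rewrite inE.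
  by case: (ord3k k i) iA => -> // ; rewrite ?(negPf kA) ?(negPf k2).
right; exists k; apply/finset.setP => i; rewrite !inE.
case: (ord3k k i) => ->; first by rewrite eqxx (negPf kA).
- by rewrite k1 ord3_neq1.
- by rewrite k2 ord3_neq2.
Qed.

Lemma face1_vert K (A : {set 'I_3}) i x : (A \subset [set i])%SET -> face (vert K) A x -> x = vert K i.
Proof.
move=> /fintype.subsetP sA /(faceP _ _ (area2_neq0 _)) [_ h].
have h' k : k != i -> lam K k x = 0.
  by move=> ki; apply: h; apply: contraNN ki => /sA; rewrite inE.
apply: (bary_inj (area2_neq0 K)) => k; rewrite -/(lam K k x) -/(lam K k _) lam_vert.
case: eqVneq => [->|/h' //].
have := lam_sum K i x; by rewrite (h' (i + 1)) ?(h' (i + 2)) ?ord3F // !addr0.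
Qed.

Lemma side_a_in s : side_set s (side_a s).
Proof.
apply/side_setP; split; first apply/eltP => k; rewrite /side_a lam_vert //.
by rewrite eq_sym (negPf (ord3_neq1 _)).
Qed.
Lemma side_b_in s : side_set s (side_b s).
Proof.
apply/side_setP; split; first apply/eltP => k; rewrite /side_b lam_vert //.
by rewrite eq_sym (negPf (ord3_neq2 _)).
Qed.

Lemma side_seg s x : side_set s x -> exists2 t, 0 <= t <= 1 & x = segment (side_a s) (side_b s) t.
Proof.
move=> /side_setP [/eltP h h0]; exists (lam s.1 (s.2 + 2) x).
  have := lam_sum s.1 s.2 x; have := h (s.2 + 1); have := h (s.2 + 2).
  by rewrite h0; lra.
apply: (bary_inj (area2_neq0 s.1)) => k; rewrite -/(lam _ _ _) -/(lam s.1 k _).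
rewrite affine_segment; last exact: lam_affine.
rewrite /side_a /side_b !lam_vert.
have := lam_sum s.1 s.2 x; rewrite h0 add0r => e.
case: (ord3k s.2 k) => ->; rewrite ?eqxx.
- by rewrite !ord3F h0 !mulr0 addr0.
- by rewrite !ord3F /=; lra.
- by rewrite !ord3F /=; lra.
Qed.

Lemma side_ab_neq s : side_a s != side_b s.
Proof.
apply/eqP => e; have := lam_vert s.1 (s.2 + 1) (s.2 + 1).
have := lam_vert s.1 (s.2 + 1) (s.2 + 2).
rewrite -/(side_a s) -/(side_b s) e eqxx !ord3F => -> /eqP.
by rewrite eq_sym oner_eq0.
Qed.

(** Each segment has its ends in the other one, so the direction vectors are multiples of each other
    by two ratios in [-1, 1] whose product is 1. Both ratios are then 1 or both are -1, which gives
    the two matchings. *)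
Lemma segment_ends (a b a' b' : plane R) (p q p' q' : R) : a != b ->
  0 <= p <= 1 -> 0 <= q <= 1 -> 0 <= p' <= 1 -> 0 <= q' <= 1 ->
  a = segment a' b' p -> b = segment a' b' q ->
  a' = segment a b p' -> b' = segment a b q' ->
  (a = a' /\ b = b') \/ (a = b' /\ b = a').
Proof.
move=> ab hp hq hp' hq' ea eb ea' eb'.
have e1 : (q - p) * (q' - p') = 1.
  have eb1 : b.1 - a.1 = (q - p) * (b'.1 - a'.1) by rewrite ea eb /=; ring.
  have eb2 : b.2 - a.2 = (q - p) * (b'.2 - a'.2) by rewrite ea eb /=; ring.
  have eb1' : b'.1 - a'.1 = (q' - p') * (b.1 - a.1) by rewrite ea' eb' /=; ring.
  have eb2' : b'.2 - a'.2 = (q' - p') * (b.2 - a.2) by rewrite ea' eb' /=; ring.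
  have h1 : (b.1 - a.1) * ((q - p) * (q' - p') - 1) = 0.
    by rewrite mulrBr mulr1 {2}eb1 eb1'; ring.
  have h2 : (b.2 - a.2) * ((q - p) * (q' - p') - 1) = 0.
    by rewrite mulrBr mulr1 {2}eb2 eb2'; ring.
  move/eqP: h1; move/eqP: h2; rewrite !mulf_eq0 !subr_eq0.
  case/orP => [/eqP e1|/eqP-> //]; case/orP => [/eqP e2|/eqP-> //].
  by case/eqP: ab; apply: plane_eq.
have [h|h] : (p = 0 /\ q = 1) \/ (p = 1 /\ q = 0).
  have [h|h] := leP (q - p) 0; [right|left]; split; nra.
- left; rewrite ea eb; case: h => -> ->; split; apply: plane_eq => /=; ring.
- right; rewrite ea eb; case: h => -> ->; split; apply: plane_eq => /=; ring.
Qed.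

Lemma same_side_of_sets s s' : side_set s = side_set s' -> same_side s s'.
Proof.
move=> e.
have := side_a_in s; rewrite {1}e => /side_seg [p hp ep].
have := side_b_in s; rewrite {1}e => /side_seg [q hq eq].
have := side_a_in s'; rewrite -{1}e => /side_seg [p' hp' ep'].
have := side_b_in s'; rewrite -{1}e => /side_seg [q' hq' eq'].
rewrite /same_side.
have [[-> ->]|[-> ->]] := segment_ends (side_ab_neq s) hp hq hp' hq' ep eq ep' eq'.
  by rewrite !eqxx.
by rewrite !eqxx orbT.
Qed.

(** The common face contains a point that is not a vertex, so it is a full side seen from either
    element. *)
Lemma common_side K K' x : K != K' -> elt K x -> elt K' x -> ~ is_vertex x ->
  exists k k', [/\ same_side (K, k) (K', k'), side_set (K, k) x & side_set (K', k') x].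
Proof.
move=> KK' hx hx' hv; have [A [B [hA eA eB]]] := hcf KK'.
(* Conformity as stated keeps only [A] from being full; a full [B] would put an interior point of
   [K'] in [K]. *)
have hB : B != [set: 'I_3]%SET.
  apply/eqP => BT; have [y hy] := ipt_exists K'.
  have : face (vert K') B y by rewrite BT; exact: ipt_elt.
  by rewrite -eB => -[/(ipt_uniq hy) e _]; rewrite e eqxx in KK'.
have hxx : (elt K `&` elt K') x by [].
have [[i Ai]|[k Ak]] := set3_proper hA.
  by case: hv; exists K, i; apply: (face1_vert Ai); rewrite -eA.
have [[i Bi]|[k' Bk]] := set3_proper hB.
  by case: hv; exists K', i; apply: (face1_vert Bi); rewrite -eB.
exists k, k'; rewrite /side_set /= -Ak -Bk; split.
- apply: same_side_of_sets; rewrite /side_set /=.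
  by rewrite -Ak -Bk -eA -eB.
- by rewrite -eA.
- by rewrite -eB.
Qed.

Lemma same_side_sym s s' : same_side s s' = same_side s' s.
Proof.
rewrite /same_side ![side_a s' == _]eq_sym ![side_b s' == _]eq_sym.
by congr (_ || _); rewrite andbC.
Qed.

Lemma affine_side f s x : affine f -> f (side_a s) = 0 -> f (side_b s) = 0 ->
  f x = lam s.1 s.2 x * f (vert s.1 s.2).
Proof.
move=> hf fa fb; rewrite (affine_bary x (area2_neq0 s.1) hf).
by rewrite (sum3k _ s.2) -/(side_a s) -/(side_b s) fa fb !mulr0 !addr0.
Qed.

Lemma lam_side_a s : lam s.1 s.2 (side_a s) = 0.
Proof. by have /side_setP[] := side_a_in s. Qed.
Lemma lam_side_b s : lam s.1 s.2 (side_b s) = 0.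
Proof. by have /side_setP[] := side_b_in s. Qed.

Lemma same_side_ab s s' : same_side s s' ->
  (side_a s = side_a s' /\ side_b s = side_b s') \/
  (side_a s = side_b s' /\ side_b s = side_a s').
Proof. by case/orP => /andP[/eqP-> /eqP->]; [left|right]. Qed.

(** Both coordinates vanish on the shared side, and an affine function vanishing there is fixed by
    its value at the opposite vertex. *)
Lemma lam_same_side s s' x : same_side s s' ->
  lam s'.1 s'.2 x = lam s'.1 s'.2 (vert s.1 s.2) * lam s.1 s.2 x.
Proof.
move=> /same_side_ab h; rewrite mulrC; apply: affine_side.
- exact: lam_affine.
- by case: h => -[-> _]; rewrite ?lam_side_a ?lam_side_b.
- by case: h => -[_ ->]; rewrite ?lam_side_a ?lam_side_b.
Qed.

Lemma small_pos (a b : R) : 0 < a -> exists2 e : R, 0 < e & forall t : R, 0 <= t <= e -> 0 < (1 - t) * a + t * b.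
Proof.
move=> a0; exists (a / (2 * (a + `|b|))).
  by rewrite divr_gt0 // mulr_gt0 // ltr_pwDl.
move=> t /andP[t0]; rewrite ler_pdivlMr; last by rewrite mulr_gt0 // ltr_pwDl.
have := ler_norm (- b); rewrite normrN => hb h.
have : t * (- b) <= t * `|b| by rewrite ler_wpM2l.
lra.
Qed.

(** Otherwise a point slightly off the midpoint of the shared side, on the way to the opposite
    vertex of [s], is interior to both elements. *)
Lemma opposite_sides s s' : s.1 != s'.1 -> same_side s s' ->
  lam s'.1 s'.2 (vert s.1 s.2) < 0.
Proof.
move=> ss' hs; rewrite ltNge; apply/negP => h.
have h0 : 0 < lam s'.1 s'.2 (vert s.1 s.2).
  rewrite lt_neqAle h andbT; apply/eqP => e.
  have := lam_same_side (vert s'.1 s'.2) hs; rewrite -e mul0r lam_vert eqxx.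
  by move/eqP; rewrite oner_eq0.
pose mid := segment (side_a s) (side_b s) 2^-1.
have mid' : forall k, k != s'.2 -> lam s'.1 k mid = 2^-1.
  move=> k kn; rewrite affine_segment; last exact: lam_affine.
  have -> : (1 - 2^-1) * lam s'.1 k (side_a s) + 2^-1 * lam s'.1 k (side_b s) =
     2^-1 * (lam s'.1 k (side_a s') + lam s'.1 k (side_b s')).
    by case: (same_side_ab hs) => -[-> ->]; field.
  rewrite /side_a /side_b !lam_vert; case: (ord3k s'.2 k) kn => ->.
  - by rewrite eqxx.
  - by rewrite eqxx !ord3F addr0 mulr1.
  - by rewrite eqxx !ord3F add0r mulr1.
have lmid : lam s.1 s.2 mid = 0.
  rewrite affine_segment; last exact: lam_affine.
  by rewrite lam_side_a lam_side_b; ring.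
have ch : 0 < 2^-1 :> R by rewrite invr_gt0 ltr0n.
have [e1 e10 he1] := small_pos (lam s'.1 (s'.2 + 1) (vert s.1 s.2)) ch.
have [e2 e20 he2] := small_pos (lam s'.1 (s'.2 + 2) (vert s.1 s.2)) ch.
pose e := Num.min (Num.min e1 e2) 2^-1.
have e0 : 0 < e by rewrite !lt_min e10 e20 /= invr_gt0 ltr0n.
have el1 : 0 <= e <= e1 by rewrite (ltW e0) !ge_min lexx.
have el2 : 0 <= e <= e2 by rewrite (ltW e0) !ge_min lexx orbT.
have el3 : e <= 2^-1 by rewrite !ge_min lexx orbT.
pose x := segment mid (vert s.1 s.2) e.
have ix : ipt s.1 x.
  move=> k; rewrite affine_segment; last exact: lam_affine.
  rewrite lam_vert; case: (ord3k s.2 k) => ->.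
  - by rewrite eqxx lmid /=; lra.
  - rewrite affine_segment; last exact: lam_affine.
    rewrite /side_a /side_b !lam_vert eqxx !ord3F /=.
    lra.
  - rewrite affine_segment; last exact: lam_affine.
    rewrite /side_a /side_b !lam_vert eqxx !ord3F /=.
    lra.
have ix' : ipt s'.1 x.
  move=> k; rewrite affine_segment; last exact: lam_affine.
  case: (ord3k s'.2 k) => ->.
  - by rewrite (lam_same_side mid hs) lmid; nra.
  - by rewrite mid' ?ord3_neq1 // he1.
  - by rewrite mid' ?ord3_neq2 // he2.
by move: ss'; rewrite (ipt_uniq ix (ipt_elt ix')) eqxx.
Qed.

Lemma same_side_inj s s' : same_side s s' -> s.1 = s'.1 -> s = s'.
Proof.
move=> hs e; rewrite [s]surjective_pairing [s']surjective_pairing e; congr (_, _).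
have ha := lam_side_a s'; have hb := lam_side_b s'.
rewrite -e in ha hb.
have h : lam s.1 s'.2 (side_a s) = 0 /\ lam s.1 s'.2 (side_b s) = 0.
  by case: (same_side_ab hs) => -[-> ->].
move: h; rewrite /side_a /side_b !lam_vert; case: (ord3k s.2 s'.2) => -> //.
- by rewrite eqxx => -[/eqP]; rewrite oner_eq0.
- by rewrite eqxx => -[_ /eqP]; rewrite oner_eq0.
Qed.

Lemma same_side_trans s s' s'' : same_side s s' -> same_side s s'' -> same_side s' s''.
Proof.
by move=> /same_side_ab [[h1 h2]|[h1 h2]] /same_side_ab [[h3 h4]|[h3 h4]];
  rewrite /same_side -h1 -h2 -h3 -h4 !eqxx ?orbT.
Qed.

(** Three elements sharing a side would lie pairwise on opposite sides of one line. *)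
Lemma neighbour_unique s s' s'' : s'.1 != s.1 -> s''.1 != s.1 ->
  same_side s s' -> same_side s s'' -> s' = s''.
Proof.
move=> n' n'' h' h''; have h := same_side_trans h' h''.
apply: same_side_inj => //; apply/eqP/negP => /negP n.
have := opposite_sides n h.
rewrite (lam_same_side _ h'').
rewrite eq_sym in n'; rewrite eq_sym in n''.
have := opposite_sides n'' h''.
have := opposite_sides n' h'.
have := lam_same_side (vert s'.1 s'.2) h'; rewrite lam_vert eqxx /=.
set X := lam s'.1 _ _; set Y := lam s''.1 _ _; set Z := lam s.1 _ _ => e X0 Y0 YZ.
have : 0 < (Y * Z) * X by rewrite nmulr_rgt0.
by rewrite -mulrA [Z * X]mulrC -e mulr1 ltNge (ltW Y0).
Qed.

End MeshGeo.

(** * Discrete forms on edges and elements *)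

Section Integrals.
Variable R : realType.
Implicit Types (x y a b : plane R).

Lemma Rintegral_quadratic (c0 c1 c2 : R) :
  \int[lebesgue_measure]_(t in `[0, 1]) (c0 + c1 * t + c2 * t ^+ 2) =
  c0 + c1 / 2 + c2 / 3.
Proof.
pose F := fun t : R => c0 * t + c1 / 2 * t ^+ 2 + c2 / 3 * t ^+ 3.
have dF (t : R) : is_derive t (1 : R) F (c0 + c1 * t + c2 * t ^+ 2).
  rewrite /F; apply: is_derive_eq.
  rewrite /GRing.scale /= ?mulr1; by field.
have cF (t : R) : {for t, continuous F}.
  apply: differentiable_continuous; apply/derivable1_diffP.
  exact: (@ex_derive _ _ _ _ _ _ _ (dF t)).
have cf (t : R) : {for t, continuous (fun t : R => c0 + c1 * t + c2 * t ^+ 2)}.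
  have dq : derivable (fun t : R => c0 + c1 * t + c2 * t ^+ 2) t (1 : R) by [].
  by apply: differentiable_continuous; apply/derivable1_diffP.
rewrite /Rintegral (@continuous_FTC2 _ _ F 0 1) //=.
- by rewrite /F !expr0n /= !mulr0 !addr0 subr0 !expr1n !mulr1.
- by apply: continuous_subspaceT => t; exact: cf.
- split.
  + by move=> t _; exact: (@ex_derive _ _ _ _ _ _ _ (dF t)).
  + exact/cvg_at_right_filter/cF.
  + exact/cvg_at_left_filter/cF.
- move=> t _; rewrite derive1E; exact: (@derive_val _ _ _ _ _ _ _ (dF t)).
Qed.

(** Products of affine functions are quadratic along the edge, which gives the exact mass matrix of
    a segment. *)
Lemma dot_segment_int (f g : plane R -> plane R) a b :
  (forall t, f (segment a b t) = scalep (1 - t) (f a) + scalep t (f b)) ->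
  (forall t, g (segment a b t) = scalep (1 - t) (g a) + scalep t (g b)) ->
  \int[lebesgue_measure]_(t in `[0, 1]) dot (f (segment a b t)) (g (segment a b t))
  = (2 * dot (f a) (g a) + dot (f a) (g b) + dot (f b) (g a) + 2 * dot (f b) (g b)) / 6.
Proof.
move=> hf hg.
pose q t := dot (f a) (g a) +
   (dot (f a) (g b) + dot (f b) (g a) - 2 * dot (f a) (g a)) * t +
   (dot (f a) (g a) + dot (f b) (g b) - dot (f a) (g b) - dot (f b) (g a)) * t ^+ 2.
transitivity (\int[lebesgue_measure]_(t in `[0, 1]) q t).
  by apply: eq_Rintegral => t _; rewrite hf hg /q /dot /=; ring.
by rewrite /q Rintegral_quadratic; field.
Qed.

End Integrals.

Section Edges.
Variables (R : realType) (m : mesh R) (hnd : Defs.nondegenerate m) (hcf : conforming m).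
Implicit Types (K : 'I_(nelt m)) (s : side m) (x : plane R) (e : edge m).
Implicit Types (u v : dgspace R m) (al : 'I_(nelt m) -> R).

(** Conformity leaves at most one candidate, so an edge is determined by its first side and sums
    over edges become sums over sides. *)
Definition nb s : option (side m) := [pick s' | (s'.1 != s.1) && same_side s s'].

Lemma nbP s s' : nb s = Some s' <-> s'.1 != s.1 /\ same_side s s'.
Proof.
rewrite /nb; case: pickP => [s1 /andP[h1 h2]|h]; split => //.
- by move=> [<-].
- by move=> [h3 h4]; rewrite (neighbour_unique hnd hcf h1 h3 h2 h4).
- by move=> [h3 h4]; have := h s'; rewrite h3 h4.
Qed.

Lemma nb_None s : nb s = None <-> forall s', s'.1 != s.1 -> ~~ same_side s s'.
Proof.
split=> [h s' n|h].
  apply/negP => hs; have : nb s = Some s' by apply/nbP.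
  by rewrite h.
rewrite /nb; case: pickP => // s1 /andP[h1 h2].
by have := h _ h1; rewrite h2.
Qed.

Lemma nb_sym s s' : nb s = Some s' -> nb s' = Some s.
Proof. by move=> /nbP[h1 h2]; apply/nbP; rewrite eq_sym same_side_sym. Qed.

Lemma is_edgeE e : is_edge e =
  (nb e.1 == e.2) && (if e.2 is Some s' then (e.1.1 < s'.1)%N else true).
Proof.
case: e => s [s'|] /=; rewrite /is_edge /=.
- rewrite andbC; apply/andP/andP => -[h1 h2]; split => //.
  + by apply/eqP/nbP; split => //; apply: contraTN h2 => /eqP ->; rewrite ltnn.
  + by have /eqP/nbP[] := h1.
- rewrite andbT; apply/forallP/eqP => [h|/nb_None h s'].
  + by apply/nb_None => s' n; have := h s'; rewrite n.
  + by apply/implyP; apply: h.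
Qed.

Lemma sum_edge (V : nmodType) (F : edge m -> V) : \sum_(e | is_edge e) F e =
  \sum_s (if nb s is Some s' then if (s.1 < s'.1)%N then F (s, Some s') else 0
          else F (s, None)).
Proof.
have -> : \sum_(e | is_edge e) F e = \sum_s \sum_(o | is_edge (s, o)) F (s, o).
  by rewrite pair_big_dep /=; apply: eq_big => -[].
apply: eq_bigr => s _.
under eq_bigl do rewrite is_edgeE /=.
case hs: (nb s) => [s'|].
- case: ifPn => h.
  + rewrite (big_pred1 (Some s')) // => o /=.
    apply/idP/idP => [/andP[/eqP<-]//|/eqP->]; by rewrite eqxx.
  + rewrite big1 // => o /andP[/eqP<-]; by rewrite (negPf h).
- rewrite (big_pred1 None) // => o /=.
  apply/idP/idP => [/andP[/eqP<-]//|/eqP->]; by rewrite eqxx.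
Qed.

(** Every side belongs to exactly one edge. The sides that come second in an interior edge are
    reached by the involution exchanging neighbours, which fixes boundary sides. *)
Lemma sum_side (V : nmodType) (g : side m -> V) : \sum_s g s =
  \sum_(e | is_edge e) (if e.2 is Some s' then g e.1 + g s' else g e.1).
Proof.
rewrite sum_edge /=.
pose A s := if nb s is Some s' then if (s.1 < s'.1)%N then g s else 0 else g s.
pose B s := if nb s is Some s' then if (s.1 < s'.1)%N then g s' else 0 else 0.
pose nbi s := odflt s (nb s).
have nbiK : involutive nbi.
  move=> s; rewrite /nbi; case hs: (nb s) => [s'|] /=; last by rewrite hs.
  by rewrite (nb_sym hs).
transitivity (\sum_s (A s + B s)); last first.
  apply: eq_bigr => s _; rewrite /A /B; case: (nb s) => [s'|]; last by rewrite addr0.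
  by case: ifP => // _; rewrite addr0.
rewrite big_split /= [X in _ + X](reindex nbi); last first.
  by exists nbi => s _; exact: nbiK.
rewrite -big_split; apply: eq_bigr => s _; rewrite /A /B /nbi.
case hs: (nb s) => [s'|] /=; last by rewrite hs addr0.
rewrite (nb_sym hs); have /nbP[n _] := hs.
case: (ltngtP s.1 s'.1) => //; rewrite ?addr0 ?add0r // => /val_inj e.
by rewrite e eqxx in n.
Qed.

Lemma dot_normal s : dot (normal s) (normal s) = 1.
Proof.
rewrite /normal; set d := (_, _).
have nd : 0 < dot d d.
  rewrite /dot -!expr2 lt_neqAle addr_ge0 ?sqr_ge0 // andbT.
  rewrite eq_sym paddr_eq0 ?sqr_ge0 // !sqrf_eq0 /= !subr_eq0.
  apply/negP => /andP[/eqP h2 /eqP h1].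
  have := side_ab_neq hnd s; rewrite [X in X == _]surjective_pairing.
  by rewrite [X in _ == X]surjective_pairing h1 h2 eqxx.
set sg := Num.sg _.
have sg2 : sg ^+ 2 = 1.
  rewrite /sg sqr_sg; suff -> : dot d (vert s.1 s.2 - side_a s) != 0 by [].
  have := area2_neq0 hnd s.1; rewrite -(orient_cyc _ s.2) /orient.
  rewrite -/(side_a s) -/(side_b s); apply: contra_neq.
  rewrite /dot /d /= => h; rewrite -[RHS]oppr0 -h; ring.
have en2 : enorm d ^+ 2 = dot d d by rewrite /enorm sqr_sqrtr // ltW.
have en0 : enorm d != 0 by rewrite /enorm sqrtr_eq0 -ltNge.
transitivity (sg ^+ 2 * (dot d d / enorm d ^+ 2)).
  by rewrite /dot /=; field.
by rewrite sg2 mul1r en2 divff // gt_eqF.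
Qed.

(** Both normals come from the same line, and their signs are decided by the opposite vertices,
    which it separates. The two cases are the two ways of matching the ends of the side. *)
Lemma normal_opp s s' : nb s = Some s' -> normal s' = - normal s.
Proof.
move=> /nbP[n hs]; have hop := opposite_sides hnd hcf (s:=s) (s':=s').
rewrite eq_sym in n; move: (hop n hs) => {}hop.
pose d s0 : plane R := ((side_b s0).2 - (side_a s0).2, (side_a s0).1 - (side_b s0).1).
pose g s0 x := dot (d s0) (x - side_a s0).
have ga s0 : affine (g s0).
  exists (- dot (d s0) (side_a s0)), (d s0).1, (d s0).2 => x.
  by rewrite /g /dot /=; ring.
have g0 s0 : g s0 (side_a s0) = 0 /\ g s0 (side_b s0) = 0.
  by split; rewrite /g /dot /d /=; ring.
have gl s0 x : g s0 x = lam s0.1 s0.2 x * g s0 (vert s0.1 s0.2).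
  by apply: affine_side => //; [exact: (g0 _).1|exact: (g0 _).2].
have key : Num.sg (g s' (vert s.1 s.2)) = - Num.sg (g s' (vert s'.1 s'.2)).
  by rewrite gl sgrM (ltr0_sg hop) mulN1r.
have en s0 c : enorm (scalep c (d s0)) = `|c| * enorm (d s0).
  rewrite /enorm (_ : dot _ _ = c ^+ 2 * dot (d s0) (d s0)); last by rewrite /dot /=; ring.
  by rewrite sqrtrM ?sqr_ge0 // sqrtr_sqr.
have [[ea eb]|[ea eb]] := same_side_ab hs.
- have dd : d s = d s' by rewrite /d ea eb.
  rewrite /normal -/(d s) -/(d s') ea -/(g s' (vert s.1 s.2)) -/(g s' _) dd key.
  by apply: plane_eq; rewrite /= opprK; ring.
- have dd : d s = scalep (- 1) (d s') by apply: plane_eq; rewrite /d ea eb /=; ring.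
  have gg : dot (d s) (vert s.1 s.2 - side_a s) = - g s' (vert s.1 s.2).
    by rewrite dd ea /g /dot /d /=; ring.
  rewrite /normal -/(d s) -/(d s') -/(g s' _) gg sgrN key dd en normrN1 mul1r.
  by apply: plane_eq; rewrite /=; ring.
Qed.

(* The trace outside the domain is taken to be zero. *)
Definition jmp u s x : R := ev u s.1 x - (if nb s is Some s' then ev u s'.1 x else 0).

(** Opposite normals turn the vector jump into a scalar times one unit normal, so inner products of
    jumps reduce to products of scalars. *)
Lemma jumpE u e x : is_edge e -> jump u e x = scalep (jmp u e.1 x) (normal e.1).
Proof.
rewrite is_edgeE => /andP[/eqP h _]; rewrite /jump /jmp.
case: e h => s [s'|] /= h; rewrite h.
- by rewrite (normal_opp h); apply: plane_eq => /=; ring.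
- by rewrite subr0.
Qed.

Lemma jmp_nb u s s' x : nb s = Some s' -> jmp u s' x = - jmp u s x.
Proof. by move=> h; rewrite /jmp h (nb_sym h) opprB. Qed.

Lemma jmp_affine u s : affine (jmp u s).
Proof.
rewrite /affine /jmp /ev; case: (nb s) => [s'|].
- exists (u s.1 0 - u s'.1 0), (u s.1 1 - u s'.1 1), (u s.1 2 - u s'.1 2) => x; ring.
- by exists (u s.1 0), (u s.1 1), (u s.1 2) => x; rewrite subr0.
Qed.

Lemma side_len_gt0 s : 0 < side_len s.
Proof.
rewrite /side_len /enorm sqrtr_gt0 /dot lt_neqAle addr_ge0 -?expr2 ?sqr_ge0 // andbT.
rewrite eq_sym paddr_eq0 ?sqr_ge0 // !sqrf_eq0 /= !subr_eq0.
apply/negP => /andP[/eqP h1 /eqP h2].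
by have /eqP[] := side_ab_neq hnd s; exact: plane_eq.
Qed.

Lemma jump_formE al u v : jump_form al u v =
  \sum_(e | is_edge e) edge_weight al e *
   ((2 * jmp u e.1 (side_a e.1) * jmp v e.1 (side_a e.1)
     + jmp u e.1 (side_a e.1) * jmp v e.1 (side_b e.1)
     + jmp u e.1 (side_b e.1) * jmp v e.1 (side_a e.1)
     + 2 * jmp u e.1 (side_b e.1) * jmp v e.1 (side_b e.1)) / 6).
Proof.
apply: eq_bigr => e he; rewrite /edge_int dot_segment_int.
- rewrite !jumpE //.
  have dn a b : dot (scalep a (normal e.1)) (scalep b (normal e.1)) = a * b.
    rewrite -[RHS]mulr1 -(dot_normal e.1) /dot /=; ring.
  rewrite !dn mulrA divfK ?mulrA // /edge_len gt_eqF //; exact: side_len_gt0.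
- move=> t; rewrite !jumpE // (affine_segment _ _ _ (jmp_affine u e.1)).
  by apply: plane_eq => /=; ring.
- move=> t; rewrite !jumpE // (affine_segment _ _ _ (jmp_affine v e.1)).
  by apply: plane_eq => /=; ring.
Qed.

Lemma flux_formE al u v : flux_form al u v =
  \sum_(e | is_edge e) edge_len e * (dot (avg_flux al u e) (normal e.1) *
     (jmp v e.1 (side_a e.1) + jmp v e.1 (side_b e.1)) / 2).
Proof.
apply: eq_bigr => e he; rewrite /edge_int; congr (_ * _).
rewrite (@dot_segment_int _ (fun=> avg_flux al u e)); first last.
- move=> t; rewrite !jumpE // (affine_segment _ _ _ (jmp_affine v e.1)).
  by apply: plane_eq => /=; ring.
- by move=> t; apply: plane_eq => /=; ring.
rewrite !jumpE //; move: (normal e.1) => n; rewrite /dot /=; by field.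
Qed.

End Edges.

Section Euclid.
Variable R : realType.
Implicit Types x y : plane R.

Lemma dot_ge0 x : 0 <= dot x x.
Proof. by rewrite /dot -!expr2 addr_ge0 ?sqr_ge0. Qed.

Lemma enorm_ge0 x : 0 <= enorm x. Proof. exact: sqrtr_ge0. Qed.

Lemma sqr_enorm x : enorm x ^+ 2 = dot x x.
Proof. by rewrite /enorm sqr_sqrtr // dot_ge0. Qed.

Lemma enorm_le x (r : R) : 0 <= r -> (enorm x <= r) = (dot x x <= r ^+ 2).
Proof. by move=> r0; rewrite -sqr_enorm ler_pXn2r // nnegrE enorm_ge0. Qed.

End Euclid.

Section Measure.
Variables (R : realType) (m : mesh R) (hnd : Defs.nondegenerate m).
Implicit Types (K : 'I_(nelt m)) (x y c : plane R) (r : R).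
Implicit Types (u v : dgspace R m) (al : 'I_(nelt m) -> R).

Local Notation plane' := (measurableTypeR R * measurableTypeR R)%type.

Lemma measurable_halfplane (f : plane R -> R) : affine f ->
  measurable ([set x | 0 <= f x] : set plane').
Proof.
move=> [c0 [c1 [c2 hf]]].
have mf : measurable_fun [set: plane'] (fun x : plane' => c0 + c1 * x.1 + c2 * x.2 : R).
  apply: measurable_funD; last first.
    by apply: measurable_funM; [exact: measurable_cst|exact: measurable_snd].
  apply: measurable_funD; first exact: measurable_cst.
  by apply: measurable_funM; [exact: measurable_cst|exact: measurable_fst].
rewrite [X in measurable X](_ : _ = setT `&`
    (fun x : plane' => c0 + c1 * x.1 + c2 * x.2 : R) @^-1` `[0, +oo[); last first.
  by rewrite setTI; apply/seteqP; split => x /=; rewrite hf in_itv /= andbT.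
exact: mf.
Qed.

Lemma measurable_elt K : measurable (elt K : set plane').
Proof.
rewrite [X in measurable X](_ : _ = [set x | 0 <= lam K 0 x] `&`
    [set x | 0 <= lam K 1 x] `&` [set x | 0 <= lam K 2 x]).
  by apply: measurableI; [apply: measurableI|]; apply: measurable_halfplane;
    exact: lam_affine.
apply/seteqP; split => x /=.
  by move=> /(eltP hnd) h; split; [split|]; exact: h.
by move=> [[h0 h1] h2]; apply/(eltP hnd) => k; case: (ord3P k) => ->.
Qed.

Lemma le_leb2 (A B : set plane') : measurable A -> measurable B -> A `<=` B ->
  (@leb2 R A <= @leb2 R B)%E.
Proof.
move=> mA mB AB.
by apply: (@le_measure _ _ _ (lebesgue_measure \x lebesgue_measure)%E) => //; rewrite inE.
Qed.

Definition area K : R := fine (leb2 (elt K)).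

Lemma elt_energyE al u v K :
  elt_energy al u v K = al K * dot (grad u K) (grad v K) * area K.
Proof. by rewrite /elt_energy Rintegral_cst //; exact: measurable_elt. Qed.

Lemma leb2_rect (a b c d : R) : a <= b -> c <= d ->
  leb2 (`[a, b] `*` `[c, d]) = ((b - a) * (d - c))%:E.
Proof.
move=> ab cd; rewrite /leb2 product_measure1E; try exact: measurable_itv.
transitivity (lebesgue_measure `[a, b] * lebesgue_measure `[c, d])%E; first by [].
rewrite !lebesgue_measure_itv /= !lte_fin EFinM; congr (_ * _)%E.
- by move: ab; rewrite le_eqVlt => /predU1P[->|->//]; rewrite ltxx subrr.
- by move: cd; rewrite le_eqVlt => /predU1P[->|->//]; rewrite ltxx subrr.
Qed.

Lemma leb2_elt_fin K : leb2 (elt K) \is a fin_num.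
Proof.
pose B : R := \sum_i `|(vert K i).1| + \sum_i `|(vert K i).2|.
have B1 : 0 <= B by rewrite addr_ge0 // sumr_ge0.
have sub : elt K `<=` `[- B, B] `*` `[- B, B].
  move=> x /(eltP hnd) h.
  have lam1 k : lam K k x <= 1.
    by have := lam_sum hnd K k x; have := h (k + 1); have := h (k + 2); lra.
  have b1 : `|x.1| <= B.
    rewrite [X in `|X.1|](bary_combo x (area2_neq0 hnd K)) sum_fst.
    apply: le_trans (ler_norm_sum _ _ _) _; rewrite /B ler_wpDr ?sumr_ge0 //.
    by apply: ler_sum => i _; rewrite /= -/(lam K i x) normrM ler_piMl // ger0_norm // lam1.
  have b2 : `|x.2| <= B.
    rewrite [X in `|X.2|](bary_combo x (area2_neq0 hnd K)) sum_snd.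
    apply: le_trans (ler_norm_sum _ _ _) _; rewrite /B ler_wpDl ?sumr_ge0 //.
    by apply: ler_sum => i _; rewrite /= -/(lam K i x) normrM ler_piMl // ger0_norm // lam1.
  by split; rewrite /= in_itv /= -ler_norml.
rewrite ge0_fin_numE //.
apply: (@le_lt_trans _ _ (leb2 (`[- B, B] `*` `[- B, B]))).
  apply: le_leb2 => //; first exact: measurable_elt.
  by apply: measurableX; exact: measurable_itv.
by rewrite leb2_rect ?ltry //; lra.
Qed.

(** The disc contains a concentric square of side [r], whose measure is explicit. *)
Lemma area_ge K c r : 0 < r -> [set x | enorm (x - c) <= r] `<=` elt K ->
  r ^+ 2 <= area K.
Proof.
move=> r0 sub.
have sub' : `[c.1 - r / 2, c.1 + r / 2] `*` `[c.2 - r / 2, c.2 + r / 2] `<=` elt K.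
  move=> x [/=]; rewrite !in_itv /= => /andP[h1 h2] /andP[h3 h4]; apply: sub => /=.
  rewrite enorm_le ?ltW // /dot /=; nra.
rewrite -lee_fin /area fineK ?leb2_elt_fin //.
have -> : (r ^+ 2)%:E = leb2 (`[c.1 - r / 2, c.1 + r / 2] `*` `[c.2 - r / 2, c.2 + r / 2]).
  rewrite leb2_rect; [|lra|lra].
  by congr (_%:E); field.
apply: le_leb2 => //; last exact: measurable_elt.
by apply: measurableX; exact: measurable_itv.
Qed.

End Measure.

(** * Packing and metric estimates *)

Section Packing.
Variable R : realType.

(** Pigeonhole on a grid of mesh [d]: two indices in the same cell have both coordinates closer than
    [d] and coincide. *)
Lemma card_separated (T : finType) (X : {set T}) (f g : T -> R) (a b A B d : R) :
  0 < d -> (forall x, x \in X -> a <= f x <= a + A) ->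
  (forall x, x \in X -> b <= g x <= b + B) -> 0 <= A -> 0 <= B ->
  (forall x y, x \in X -> y \in X -> `|f x - f y| < d -> `|g x - g y| < d -> x = y) ->
  #|X|%:R <= (A / d + 1) * (B / d + 1).
Proof.
move=> d0 hf hg A0 B0 sep.
pose p := Num.truncn (A / d); pose q := Num.truncn (B / d).
pose F x : 'I_p.+1 := inord (Num.truncn ((f x - a) / d)).
pose G x : 'I_q.+1 := inord (Num.truncn ((g x - b) / d)).
have near (w : T -> R) (c C : R) : (forall x, x \in X -> c <= w x <= c + C) ->
    {in X &, forall x y, (inord (Num.truncn ((w x - c) / d)) : 'I_(Num.truncn (C / d)).+1)
      = inord (Num.truncn ((w y - c) / d)) -> `|w x - w y| < d}.
  move=> hw x y xX yX /(congr1 val) /=.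
  have bd z : z \in X -> (Num.truncn ((w z - c) / d) < (Num.truncn (C / d)).+1)%N.
    move=> zX; rewrite ltnS; apply: le_truncn.
    by rewrite ler_pM2r ?invr_gt0 //; have := hw _ zX; lra.
  rewrite !inordK ?bd // => e.
  have t z : z \in X -> ((Num.truncn ((w z - c) / d))%:R * d <= w z - c <
      (Num.truncn ((w z - c) / d))%:R * d + d).
    move=> zX; have /truncn_itv : 0 <= (w z - c) / d.
      by rewrite divr_ge0 ?(ltW d0) //; have := hw _ zX; lra.
    by set N := Num.truncn _; rewrite ler_pdivlMr // ltr_pdivrMr // -[N.+1%:R]natr1 mulrDl mul1r.
  have := t _ xX; have := t _ yX; rewrite e ltr_norml; lra.
have inj : {in X &, injective (fun x => (F x, G x))}.
  move=> x y xX yX [eF eG]; apply: sep => //.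
  - exact: near hf _ _ xX yX eF.
  - exact: near hg _ _ xX yX eG.
have := @leq_card_in _ _ _ _ inj; rewrite card_prod !card_ord => hc.
apply: (@le_trans _ _ (p.+1 * q.+1)%:R); first by rewrite ler_nat.
rewrite natrM; apply: ler_pM => //; rewrite -natr1 lerD2r truncn_le divr_ge0 //; exact: ltW.
Qed.

Lemma card_separated1 (T : finType) (X : {set T}) (f : T -> R) (a A d : R) :
  0 < d -> (forall x, x \in X -> a <= f x <= a + A) -> 0 <= A ->
  (forall x y, x \in X -> y \in X -> `|f x - f y| < d -> x = y) ->
  #|X|%:R <= A / d + 1.
Proof.
move=> d0 hf A0 sep.
have -> : A / d + 1 = (A / d + 1) * (0 / d + 1) by rewrite mul0r add0r mulr1.
apply: (@card_separated T X f (fun=> 0) a 0 A 0 d) => // [x _|x y xX yX hxy _].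
  by rewrite addr0 lexx.
exact: sep.
Qed.

Lemma avoid_seq (s : seq R) (a b : R) : a < b -> exists2 x, a < x < b & x \notin s.
Proof.
elim: s a b => [|y s IH] a b ab; first by exists ((a + b) / 2) => //; lra.
have [h|h] := leP y ((a + b) / 2).
- have [|x hx xs] := IH ((a + b) / 2) b; first by lra.
  exists x; first by lra.
  by rewrite inE negb_or xs andbT; apply/eqP; lra.
- have [|x hx xs] := IH a ((a + b) / 2); first by lra.
  exists x; first by lra.
  by rewrite inE negb_or xs andbT; apply/eqP; lra.
Qed.

End Packing.

Section Metric.
Variable R : realType.
Implicit Types (x y : plane R).

Lemma dot_conv (t : 'I_3 -> plane R) (l : 'I_3 -> R) y (M : R) :
  (forall i, 0 <= l i) -> \sum_i l i = 1 ->
  (forall i, dot (t i - y) (t i - y) <= M) ->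
  dot (\sum_i scalep (l i) (t i) - y) (\sum_i scalep (l i) (t i) - y) <= M.
Proof.
move=> l0 l1 h.
have -> : M = \sum_i l i * M by rewrite -mulr_suml l1 mul1r.
apply: (@le_trans _ _ (\sum_i l i * dot (t i - y) (t i - y))); last first.
  by apply: ler_sum => i _; rewrite ler_wpM2l.
move: l1; rewrite !sum3 => l1; rewrite -subr_ge0.
have -> : l 2 = 1 - l 0 - l 1 by lra.
(* Variance identity: the gap in the convexity inequality is the sum of the [l i * l j] times the
   squared mutual distances. *)
set X := (X in 0 <= X).
have -> : X = l 0 * l 1 * dot (t 0 - t 1) (t 0 - t 1) +
  l 0 * (1 - l 0 - l 1) * dot (t 0 - t 2) (t 0 - t 2) +
  l 1 * (1 - l 0 - l 1) * dot (t 1 - t 2) (t 1 - t 2).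
  by rewrite /X /dot /=; ring.
have l2 : 0 <= 1 - l 0 - l 1 by have := l0 2; lra.
by rewrite !addr_ge0 // !mulr_ge0 // dot_ge0.
Qed.

Lemma dotC x y : dot x y = dot y x.
Proof. by rewrite /dot; ring. Qed.

Lemma dot_oppl x : dot (- x) (- x) = dot x x.
Proof. by rewrite /dot /=; ring. Qed.

Lemma dot_CS x y : dot x y ^+ 2 <= dot x x * dot y y.
Proof.
rewrite -subr_ge0.
have -> : dot x x * dot y y - dot x y ^+ 2 = (x.1 * y.2 - x.2 * y.1) ^+ 2.
  by rewrite /dot; ring.
exact: sqr_ge0.
Qed.

Lemma abs_le_sqr (a b : R) : 0 <= b -> (`|a| <= b) = (a ^+ 2 <= b ^+ 2).
Proof.
by move=> b0; rewrite -(ler_pXn2r (n := 2)) ?nnegrE // -normrX ger0_norm // sqr_ge0.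
Qed.

End Metric.

Section MeshMetric.
Variables (R : realType) (m : mesh R) (hnd : Defs.nondegenerate m).
Implicit Types (K : 'I_(nelt m)) (s : side m) (x y c : plane R) (r : R).

Lemma side_len_le s : side_len s <= mesh_size m.
Proof.
apply: (@le_trans _ _ (diam s.1)).
  have := @le_bigmax _ _ _ 0 (fun k => side_len (s.1, k)) s.2.
  by rewrite -surjective_pairing.
exact: (@le_bigmax _ _ _ 0 (fun K => diam K)).
Qed.

Lemma sqr_side_len s : side_len s ^+ 2 = dot (side_b s - side_a s) (side_b s - side_a s).
Proof. exact: sqr_enorm. Qed.

Lemma mesh_size_gt0 K : 0 < mesh_size m.
Proof. exact: lt_le_trans (side_len_gt0 hnd (K, 0)) (side_len_le _). Qed.

Lemma mesh_size_ge0 : 0 <= mesh_size m.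
Proof.
exact: bigmax_ge_id.
Qed.

Lemma vert_dist K i j : dot (vert K i - vert K j) (vert K i - vert K j) <= mesh_size m ^+ 2.
Proof.
have h k : dot (vert K (k + 2) - vert K (k + 1)) (vert K (k + 2) - vert K (k + 1))
    <= mesh_size m ^+ 2.
  rewrite -(sqr_side_len (K, k)) ler_pXn2r ?nnegrE ?mesh_size_ge0 ?side_len_le //.
  exact/ltW/side_len_gt0.
have h' k : dot (vert K (k + 1) - vert K (k + 2)) (vert K (k + 1) - vert K (k + 2))
    <= mesh_size m ^+ 2 by rewrite -dot_oppl opprB.
have h0 k : dot (vert K k - vert K k) (vert K k - vert K k) <= mesh_size m ^+ 2.
  by rewrite subrr /dot mulr0 addr0 sqr_ge0.
case: (ord3P i) => ->; case: (ord3P j) => ->.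
- exact: h0.
- by have := h' 2; rewrite !ord3E.
- by have := h 1; rewrite !ord3E.
- by have := h 2; rewrite !ord3E.
- exact: h0.
- by have := h' 0; rewrite !ord3E.
- by have := h' 1; rewrite !ord3E.
- by have := h 0; rewrite !ord3E.
- exact: h0.
Qed.

Lemma elt_dist K x y : elt K x -> elt K y -> dot (x - y) (x - y) <= mesh_size m ^+ 2.
Proof.
move=> /(eltP hnd) hx /(eltP hnd) hy.
rewrite (bary_combo x (area2_neq0 hnd K)).
apply: dot_conv => [//||i]; first by rewrite bary_sum1 // area2_neq0.
rewrite -dot_oppl opprB (bary_combo y (area2_neq0 hnd K)).
apply: dot_conv => [//||j]; first by rewrite bary_sum1 // area2_neq0.
exact: vert_dist.
Qed.

Lemma lam_le1 K k x : elt K x -> lam K k x <= 1.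
Proof.
move=> /(eltP hnd) h; have := lam_sum hnd K k x.
by have := h (k + 1); have := h (k + 2); lra.
Qed.

Lemma lam_grad K k : exists2 g : plane R, dot g g != 0 &
  forall x y, lam K k x - lam K k y = dot g (x - y).
Proof.
have [c0 [c1 [c2 h]]] := lam_affine K k.
have e x y : lam K k x - lam K k y = dot (c1, c2) (x - y).
  by rewrite !h /dot /=; ring.
exists (c1, c2) => //; apply/eqP => g0.
have c10 : c1 = 0 by move: g0; rewrite /dot /=; nra.
have c20 : c2 = 0 by move: g0; rewrite /dot /=; nra.
have := e (vert K k) (vert K (k + 1)); rewrite !lam_vert // eqxx ord3F subr0.
by rewrite /dot /= c10 c20 !mul0r addr0 => /eqP; rewrite oner_eq0.
Qed.

(** The coordinate lies in [0, 1] on the disc; walking from the centre by [r] along plus and minus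
    the gradient [g] gives both bounds. In particular [enorm g] is at most [1 / (2 * r)]. *)
Lemma disc_lam K c r k : 0 < r -> [set x | enorm (x - c) <= r] `<=` elt K ->
  exists2 g : plane R, 0 < enorm g & (forall x y, lam K k x - lam K k y = dot g (x - y))
   /\ r * enorm g <= lam K k c <= 1 - r * enorm g.
Proof.
move=> r0 sub; have [g g0 hg] := lam_grad K k; exists g.
  by rewrite /enorm sqrtr_gt0 lt_neqAle eq_sym g0 dot_ge0.
split=> //.
have n0 : 0 < enorm g by rewrite /enorm sqrtr_gt0 lt_neqAle eq_sym g0 dot_ge0.
have in_elt w : w ^+ 2 = 1 -> elt K (c + scalep (w * r / enorm g) g).
  move=> w1; apply: sub => /=; rewrite enorm_le ?(ltW r0) //.
  have -> : c + scalep (w * r / enorm g) g - c = scalep (w * r / enorm g) g.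
    by apply: plane_eq => /=; ring.
  have -> : dot (scalep (w * r / enorm g) g) (scalep (w * r / enorm g) g) =
    w ^+ 2 * r ^+ 2 * (dot g g / enorm g ^+ 2).
    by rewrite /dot /=; field; exact: lt0r_neq0.
  by rewrite w1 sqr_enorm divff // !mul1r mulr1.
have lw w : lam K k (c + scalep (w * r / enorm g) g) = lam K k c + w * (r * enorm g).
  apply: (addIr (- lam K k c)); rewrite [RHS]addrAC subrr add0r.
  rewrite hg (_ : dot _ _ = w * r * (dot g g / enorm g)); last first.
    by rewrite /dot /=; field; exact: lt0r_neq0.
  rewrite -sqr_enorm expr2 mulfK ?lt0r_neq0 //; ring.
have /(eltP hnd) /(_ k) h1 : elt K (c + scalep (-1 * r / enorm g) g).
  by apply: in_elt; ring.
have h2 : lam K k (c + scalep (1 * r / enorm g) g) <= 1.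
  by apply: lam_le1; apply: in_elt; ring.
move: h1 h2; rewrite !lw; lra.
Qed.

Lemma disc_ipt K c r : 0 < r -> [set x | enorm (x - c) <= r] `<=` elt K -> ipt K c.
Proof.
move=> r0 sub k; have [g g0 [_ /andP[h _]]] := disc_lam k r0 sub.
by apply: lt_le_trans h; rewrite mulr_gt0.
Qed.

Lemma lam_lip K c r k x y (d : R) : 0 < r -> [set x | enorm (x - c) <= r] `<=` elt K ->
  0 <= d -> dot (x - y) (x - y) <= d ^+ 2 -> `|lam K k x - lam K k y| <= d / (2 * r).
Proof.
move=> r0 sub d0 hd; have [g g0 [hg h]] := disc_lam k r0 sub.
rewrite hg abs_le_sqr; last by rewrite divr_ge0 // mulr_ge0 // ltW.
apply: le_trans (dot_CS _ _) _; rewrite -sqr_enorm -[d / _]mulrC exprMn.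
apply: ler_pM => //; rewrite ?sqr_ge0 ?dot_ge0 //.
rewrite ler_pXn2r ?nnegrE ?enorm_ge0 ?invr_ge0 ?mulr_ge0 ?(ltW r0) //.
by rewrite -[_^-1]mul1r ler_pdivlMr ?mulr_gt0 //; move: h; lra.
Qed.

End MeshMetric.

(** * Fine elements inside a coarse element *)

Section Refinement.
Variables (R : realType) (Om : set (plane R)) (Th TH : mesh R).
Hypotheses (ndh : Defs.nondegenerate Th) (cfh : conforming Th)
  (covh : closure Om = \bigcup_K elt (m := Th) K).
Hypotheses (ndH : Defs.nondegenerate TH) (cfH : conforming TH)
  (covH : closure Om = \bigcup_K elt (m := TH) K).
Hypothesis hsub : forall t : 'I_(nelt Th), exists K : 'I_(nelt TH), elt t `<=` elt K.
Implicit Types (t : 'I_(nelt Th)) (K : 'I_(nelt TH)) (x y z : plane R).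
Implicit Types (u : dgspace R Th) (q : 'I_(nelt Th) -> R) (S : {set 'I_(nelt Th)}).

Definition inK K t : bool := `[< elt t `<=` elt K >].

Lemma inKP K t : inK K t -> forall x, elt t x -> elt K x.
Proof. by move=> /asboolP h x; exact: h. Qed.

Lemma closed_elt_segment t x y : closed [set s : R | elt t (segment x y s)].
Proof.
have cl k : closed [set s : R | 0 <= lam t k (segment x y s)].
  have cf (s : R) : {for s, continuous
      (fun s : R => (1 - s) * lam t k x + s * lam t k y)}.
    have df : derivable (fun s : R => (1 - s) * lam t k x + s * lam t k y) s (1 : R) by [].
    by apply: differentiable_continuous; apply/derivable1_diffP.
  rewrite [X in closed X](_ : _ =
      (fun s : R => (1 - s) * lam t k x + s * lam t k y) @^-1` [set r | 0 <= r]).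
    by apply: closed_comp; [move=> s _; exact: cf|exact: closed_ge].
  by apply/seteqP; split => s /=; rewrite affine_segment //; exact: lam_affine.
rewrite [X in closed X](_ : _ = [set s : R | 0 <= lam t 0 (segment x y s)] `&`
   [set s : R | 0 <= lam t 1 (segment x y s)] `&` [set s : R | 0 <= lam t 2 (segment x y s)]).
  by apply: closedI; [apply: closedI|]; exact: cl.
apply/seteqP; split => s /=.
  by move=> /(eltP ndh) h; split; [split|]; exact: h.
by move=> [[h0 h1] h2]; apply/(eltP ndh) => k; case: (ord3P k) => ->.
Qed.

Lemma closed_elts_segment (P : 'I_(nelt Th) -> Prop) x y :
  closed [set s : R | exists2 t, P t & elt t (segment x y s)].
Proof.
rewrite [X in closed X](_ : _ =
  \bigcup_(t in [set t | P t]) [set s : R | elt t (segment x y s)]).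
  by apply: closed_bigcup => [|t _]; [exact: finite_finset|exact: closed_elt_segment].
by apply/seteqP; split => s /= [t pt ht]; exists t.
Qed.

Lemma segment0 x y : segment x y 0 = x.
Proof. by apply: plane_eq => /=; ring. Qed.
Lemma segment1 x y : segment x y 1 = y.
Proof. by apply: plane_eq => /=; ring. Qed.

(** Finitely many closed elements that cover the rest of the segment also cover its start. This
    passes from points just off [x] to [x] itself. *)
Lemma elts_at_start (P : 'I_(nelt Th) -> Prop) x y :
  (forall s : R, 0 < s <= 1 -> exists2 t, P t & elt t (segment x y s)) ->
  exists2 t, P t & elt t x.
Proof.
move=> h; pose D := [set s : R | exists2 t, P t & elt t (segment x y s)].
suff [t pt] : D 0 by rewrite segment0; exists t.
apply: contrapT => hn.
have cD : open (~` D) by apply: closed_openC; exact: closed_elts_segment.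
have : nbhs (0 : R) (~` D) by apply: open_nbhs_nbhs.
move=> /nbhs_ballP[e /= e0 he].
have hm : 0 < Num.min (e / 2) 1 by rewrite lt_min ltr01 andbT; lra.
have : D (Num.min (e / 2) 1) by apply: h; rewrite hm ge_min lexx orbT.
apply: he; rewrite /ball /= sub0r normrN gtr0_norm // gt_min; apply/orP; left; lra.
Qed.

Lemma segment_ipt K x y (s : R) : elt K x -> ipt K y -> 0 < s <= 1 -> ipt K (segment x y s).
Proof.
move=> /(eltP ndH) hx hy hs k; rewrite affine_segment; last exact: lam_affine.
have := hx k; have := hy k; nra.
Qed.

(** The fine element covering [x] lies in some coarse element, and [K] is the only one containing
    this interior point. *)
Lemma cover_ipt K x : ipt K x -> exists2 t, inK K t & elt t x.
Proof.
move=> hx; have : closure Om x by rewrite covH; exists K => //; exact: ipt_elt.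
rewrite covh => -[t _ ht]; exists t => //; have [K' hK'] := hsub t.
by rewrite (ipt_uniq ndH cfH hx (hK' _ ht)); apply/asboolP.
Qed.

Lemma cover_elt K x : elt K x -> exists2 t, inK K t & elt t x.
Proof.
move=> hx; have [c hc] := ipt_exists ndH K.
apply: (@elts_at_start (fun t => inK K t) x c) => s hs.
exact/cover_ipt/segment_ipt.
Qed.

Definition adj t t' := (t != t') && `[< exists k k', same_side (t, k) (t', k') >].

Definition on_segment K x y : {set 'I_(nelt Th)} :=
  [set t | inK K t && `[< exists2 s : R, 0 <= s <= 1 & elt t (segment x y s) >]]%SET.

(** Connectedness of [0, 1]: the parameters met by elements linked to [t] and those met by elements
    of [K] not linked to [t] form two closed sets. They are disjoint because two elements meeting
    off the vertices share a side. *)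
Lemma connect_segment K x y t t' :
  (forall s : R, 0 <= s <= 1 -> elt K (segment x y s)) ->
  (forall s : R, 0 <= s <= 1 -> ~ is_vertex Th (segment x y s)) ->
  inK K t -> inK K t' -> elt t x -> elt t' y ->
  connect [rel a b | [&& a \in on_segment K x y, b \in on_segment K x y & adj a b]] t t'.
Proof.
move=> inn nv tK t'K tx t'y; set S := on_segment K x y; set e := [rel a b | _].
have inS a (s : R) : inK K a -> 0 <= s <= 1 -> elt a (segment x y s) -> a \in S.
  by move=> aK hs ha; rewrite inE aK; apply/asboolP; exists s.
have s01 : 0 <= (0 : R) <= 1 by rewrite lexx ler01.
have s11 : 0 <= (1 : R) <= 1 by rewrite lexx ler01.
have meet a b (s : R) : inK K a -> inK K b -> 0 <= s <= 1 -> elt a (segment x y s) ->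
    elt b (segment x y s) -> connect e t a -> connect e t b.
  move=> aK bK hs ha hb /connect_trans; apply.
  case: (eqVneq a b) => [->|ab]; first exact: connect0.
  apply: connect1; rewrite /= (inS a s) // (inS b s) //= /adj ab /=.
  have [k [k' [hk _ _]]] := common_side ndh cfh ab ha hb (nv s hs).
  by apply/asboolP; exists k, k'.
pose B := [set s : R | s \in `[0, 1] /\ exists2 a, (inK K a /\ connect e t a) & elt a (segment x y s)].
have BE : B = [set` `[(0 : R), 1]].
  apply: segment_connected.
  - exists 0; split; first by rewrite in_itv.
    by exists t => //; rewrite segment0.
  - exists (~` [set s : R | exists2 a, (inK K a /\ ~ connect e t a) & elt a (segment x y s)]).
      exact/closed_openC/closed_elts_segment.
    apply/seteqP; split => s /=.
    + move=> [hs [a [aK ca] ha]]; split => // -[b [bK nb] hb]; apply: nb.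
      by apply: (meet a b s) => //; move: hs; rewrite in_itv.
    + move=> [hs hn]; split => //.
      have [a aK ha] := cover_elt (inn s ltac:(by move: hs; rewrite in_itv)).
      exists a => //; split=> //; apply: contrapT => nc; apply: hn.
      by exists a.
  - exists [set s : R | exists2 a, (inK K a /\ connect e t a) & elt a (segment x y s)].
      exact: closed_elts_segment.
    by [].
have : B 1 by rewrite BE /= in_itv.
move=> [_ [a [aK ca] ha]].
by apply: (meet a t' 1) => //; rewrite segment1.
Qed.

(* [q] dominates the squared oscillation of [u] on every fine element of [K] and
   its squared jumps across the fine sides interior to [K]. *)
Definition compat K u q :=
  (forall t, inK K t -> mesh_size Th ^+ 2 * dot (grad u t) (grad u t) <= q t) /\
  (forall t k t' k' x, inK K t -> inK K t' -> t != t' -> same_side (t, k) (t', k') ->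
     side_set (t, k) x -> (ev u t x - ev u t' x) ^+ 2 <= q t).

Lemma abs_le_sqrt (a b : R) : a ^+ 2 <= b -> `|a| <= Num.sqrt b.
Proof.
move=> h; rewrite abs_le_sqr ?sqrtr_ge0 // sqr_sqrtr //.
exact: le_trans (sqr_ge0 a) h.
Qed.

Lemma osc_sqr u t x y : elt t x -> elt t y ->
  (ev u t x - ev u t y) ^+ 2 <= mesh_size Th ^+ 2 * dot (grad u t) (grad u t).
Proof.
move=> hx hy; have -> : ev u t x - ev u t y = dot (grad u t) (x - y).
  by rewrite /ev /dot /=; ring.
apply: le_trans (dot_CS _ _) _; rewrite mulrC ler_wpM2r ?dot_ge0 //.
exact: (elt_dist ndh hx hy).
Qed.

(** Telescoping: each element pays its own oscillation and the jump to the next element, both at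
    most the root of [q], hence the factor 2. *)
Lemma chain_le K u q t p x y : compat K u q -> inK K t -> all (inK K) p ->
  path adj t p -> elt t x -> elt (last t p) y ->
  `|ev u t x - ev u (last t p) y| <= 2 * \sum_(a <- t :: p) Num.sqrt (q a).
Proof.
move=> [h1 h2]; elim: p t x => [|t' p IH] t x tK /=.
  move=> _ _ tx ty; rewrite big_seq1.
  have := abs_le_sqrt (le_trans (osc_sqr u tx ty) (h1 _ tK)).
  have := sqrtr_ge0 (q t); lra.
move=> /andP[t'K pK] /andP[/andP[tt' /asboolP[k [k' hs]]] hp] tx ly.
rewrite big_cons.
have hz := side_a_in ndh (t, k).
have hz' : side_set (t', k') (side_a (t, k)).
  by case: (same_side_ab hs) => -[-> _]; [exact: side_a_in|exact: side_b_in].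
have tz : elt t (side_a (t, k)) by case/(side_setP ndh): hz.
have t'z : elt t' (side_a (t, k)) by case/(side_setP ndh): hz'.
have b1 := abs_le_sqrt (le_trans (osc_sqr u tx tz) (h1 _ tK)).
have b2 := abs_le_sqrt (h2 _ _ _ _ _ tK t'K tt' hs hz).
have b3 := IH t' _ t'K pK hp t'z ly.
rewrite (_ : ev u t x - _ = (ev u t x - ev u t (side_a (t, k))) +
  (ev u t (side_a (t, k)) - ev u t' (side_a (t, k))) +
  (ev u t' (side_a (t, k)) - ev u (last t' p) y)); last by ring.
apply: le_trans (ler_normD _ _) _.
have := ler_normD (ev u t x - ev u t (side_a (t, k)))
  (ev u t (side_a (t, k)) - ev u t' (side_a (t, k))).
lra.
Qed.

Lemma sqr_sum_le (T : finType) (S : {set T}) (f : T -> R) :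
  (\sum_(i in S) f i) ^+ 2 <= #|S|%:R * \sum_(i in S) f i ^+ 2.
Proof.
rewrite expr2 mulr_suml.
apply: (@le_trans _ _ (\sum_(i in S) \sum_(j in S) (f i ^+ 2 + f j ^+ 2) / 2)).
  apply: ler_sum => i _; rewrite mulr_sumr; apply: ler_sum => j _.
  have := sqr_ge0 (f i - f j); nra.
rewrite le_eqVlt; apply/orP; left; apply/eqP.
under eq_bigr do rewrite -mulr_suml big_split /= sumr_const.
rewrite -mulr_suml big_split /= sumr_const sumrMnl -mulr2n -[(_ *+ _) *+ 2]mulr_natr.
by rewrite mulfK ?pnatr_eq0 // mulr_natl.
Qed.

Lemma segment_bound K u q x y t t' : compat K u q -> (forall t, 0 <= q t) ->
  (forall s : R, 0 <= s <= 1 -> elt K (segment x y s)) ->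
  (forall s : R, 0 <= s <= 1 -> ~ is_vertex Th (segment x y s)) ->
  inK K t -> inK K t' -> elt t x -> elt t' y ->
  (ev u t x - ev u t' y) ^+ 2 <=
    4 * #|on_segment K x y|%:R * \sum_(a in on_segment K x y) q a.
Proof.
move=> hc q0 inn nv tK t'K tx t'y.
have /connectP[p hp lp] := connect_segment inn nv tK t'K tx t'y.
set S := on_segment K x y in hp *.
(* A path without repetition, so that every element of the segment is counted at most once. *)
case/shortenP: hp lp => p' hp' up' _ lp.
have tS : t \in S.
  by rewrite inE tK; apply/asboolP; exists 0; rewrite ?lexx ?ler01 // segment0.
have allS : all (fun a => a \in S) (t :: p').
  rewrite /= tS /=; elim: (p') (t) hp' => //= b p1 IH a /andP[/and3P[_ bS _] h].
  by rewrite bS (IH b).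
have pK : all (inK K) p'.
  by apply/allP => a ap; have /allP/(_ a) := allS; rewrite inE ap orbT inE => /(_ isT) /andP[].
have hadj : path adj t p' by apply: sub_path hp' => a b /and3P[].
have ly : elt (last t p') y by rewrite -lp.
have := chain_le hc tK pK hadj tx ly; rewrite -lp => hb.
have hs : \sum_(a <- t :: p') Num.sqrt (q a) <= \sum_(a in S) Num.sqrt (q a).
  rewrite big_uniq // [leLHS]big_mkcond [leRHS]big_mkcond /=; apply: ler_sum => a _.
  case: ifPn => [ha|_]; last by case: ifP => // _; exact: sqrtr_ge0.
  by rewrite (allP allS).
rewrite -[X in X <= _]ger0_norm ?sqr_ge0 // normrX.
apply: (@le_trans _ _ ((2 * \sum_(a in S) Num.sqrt (q a)) ^+ 2)).
  have hb' : `|ev u t x - ev u t' y| <= 2 * \sum_(a in S) Num.sqrt (q a) by lra.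
  by rewrite ler_pXn2r ?nnegrE ?normr_ge0 //; exact: le_trans hb'.
rewrite exprMn -[4 * _ * _]mulrA (_ : 2 ^+ 2 = 4 :> R); last by ring.
rewrite ler_wpM2l //; apply: le_trans (sqr_sum_le _ _) _.
by under [X in _ * X <= _]eq_bigr do rewrite sqr_sqrtr //.
Qed.

Definition level K j (r : R) : {set 'I_(nelt Th)} :=
  [set t | inK K t && `[< exists2 x, elt t x & lam K j x = r >]]%SET.

Definition generic K j (r : R) := forall x, lam K j x = r -> ~ is_vertex Th x.

Lemma line_bound K u q j r x y t t' : compat K u q -> (forall t, 0 <= q t) ->
  generic K j r -> elt K x -> elt K y -> lam K j x = r -> lam K j y = r ->
  inK K t -> inK K t' -> elt t x -> elt t' y ->
  (ev u t x - ev u t' y) ^+ 2 <=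
    4 * #|level K j r|%:R * \sum_(a in level K j r) q a.
Proof.
move=> hc q0 gr Kx Ky lx ly tK t'K tx t'y.
have lseg s : lam K j (segment x y s) = r.
  by rewrite affine_segment ?lx ?ly; [ring|exact: lam_affine].
have inn (s : R) : 0 <= s <= 1 -> elt K (segment x y s).
  move=> hs; apply/(eltP ndH) => k; rewrite affine_segment; last exact: lam_affine.
  by have := (eltP ndH _ _).1 Kx k; have := (eltP ndH _ _).1 Ky k; nra.
have nv (s : R) : 0 <= s <= 1 -> ~ is_vertex Th (segment x y s) by move=> _; apply: gr.
apply: le_trans (segment_bound hc q0 inn nv tK t'K tx t'y) _.
have sub : on_segment K x y \subset level K j r.
  apply/fintype.subsetP => a; rewrite !inE => /andP[-> /asboolP[s hs ha]].
  by apply/asboolP; exists (segment x y s).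
apply: ler_pM.
- by rewrite mulr_ge0.
- by rewrite sumr_ge0.
- by rewrite ler_pM2l // ler_nat subset_leq_card.
- rewrite [leLHS]big_mkcond [leRHS]big_mkcond /=; apply: ler_sum => a _.
  case: ifPn => [ha|_]; first by rewrite (fintype.subsetP sub).
  by case: ifP.
Qed.

Lemma elt_convex (m : mesh R) (nd : Defs.nondegenerate m) (K : 'I_(nelt m)) x y (s : R) :
  elt K x -> elt K y -> 0 <= s <= 1 -> elt K (segment x y s).
Proof.
move=> /(eltP nd) hx /(eltP nd) hy hs; apply/(eltP nd) => k.
rewrite affine_segment; last exact: lam_affine.
by have := hx k; have := hy k; nra.
Qed.

Lemma side_set_convex (m : mesh R) (nd : Defs.nondegenerate m) (s : side m) x y (r : R) :
  side_set s x -> side_set s y -> 0 <= r <= 1 -> side_set s (segment x y r).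
Proof.
move=> /(side_setP nd)[ex lx] /(side_setP nd)[ey ly] hr; apply/(side_setP nd); split.
  exact: elt_convex.
rewrite affine_segment; last exact: lam_affine.
by rewrite lx ly; ring.
Qed.

Lemma same_side_set (m : mesh R) (nd : Defs.nondegenerate m) (s s' : side m) x :
  same_side s s' -> side_set s x -> side_set s' x.
Proof.
move=> hs /(side_seg nd)[r hr ->]; apply: side_set_convex => //.
- by case: (same_side_ab hs) => -[-> _]; [exact: side_a_in|exact: side_b_in].
- by case: (same_side_ab hs) => -[_ ->]; [exact: side_b_in|exact: side_a_in].
Qed.

(** The probe point of a side: it is never a vertex of a conforming mesh, so any other element
    containing it shares the whole side. *)
Definition midp (m : mesh R) (s : side m) : plane R := segment (side_a s) (side_b s) 2^-1.

Lemma midp_in (m : mesh R) (nd : Defs.nondegenerate m) (s : side m) : side_set s (midp s).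
Proof. by apply: side_set_convex; [|exact: side_a_in|exact: side_b_in|lra]. Qed.

Lemma affine_midp (m : mesh R) (f : plane R -> R) (s : side m) : affine f ->
  f (midp s) = (f (side_a s) + f (side_b s)) / 2.
Proof. by move=> hf; rewrite affine_segment //; field. Qed.

Lemma lam_midp (m : mesh R) (nd : Defs.nondegenerate m) (s : side m) k :
  lam s.1 k (midp s) = if k == s.2 then 0 else 2^-1.
Proof.
rewrite affine_midp; last exact: lam_affine.
rewrite /side_a /side_b !lam_vert //; case: (ord3k s.2 k) => ->;
  rewrite ?eqxx !ord3F /= ?addr0 ?add0r ?mul0r ?mul1r //.
Qed.

Lemma lam_eq1 (m : mesh R) (nd : Defs.nondegenerate m) (K : 'I_(nelt m)) i x :
  elt K x -> lam K i x = 1 -> x = vert K i.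
Proof.
move=> /(eltP nd) hx h1; apply: (bary_inj (area2_neq0 nd K)) => k.
rewrite -!/(lam _ _ _) lam_vert //.
have := lam_sum nd K i x; have h2 := hx (i + 1); have h3 := hx (i + 2).
rewrite h1 => h; case: (ord3k i k) => ->; rewrite ?eqxx ?ord3F /= //; lra.
Qed.

(** If the midpoint were a vertex of another element [K], the common face would be the whole side;
    but a vertex of [K] is not the midpoint of two distinct points of [K]. *)
Lemma midp_not_vertex (m : mesh R) (nd : Defs.nondegenerate m) (cf : conforming m)
  (s : side m) : ~ is_vertex m (midp s).
Proof.
have n0 : 2^-1 != 0 :> R by rewrite invr_eq0 pnatr_eq0.
have own i : midp s <> vert s.1 i.
  move=> e; have := lam_midp nd s i; rewrite e lam_vert // eqxx.
  case: ifP => _ /eqP; first by rewrite oner_eq0.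
  by move=> h12; clear e; move/eqP: h12 => /= ?; lra.
move=> [K [i e]]; case: (eqVneq s.1 K) => [sK|sK]; first by move: e; rewrite -sK; exact: own.
have [A [B [hA eA _]]] := cf _ _ sK.
have ms : elt s.1 (midp s) by have [] := (side_setP nd _ _).1 (midp_in nd s).
have mK : elt K (midp s) by apply/(eltP nd) => k; rewrite e lam_vert.
have mA : face (vert s.1) A (midp s) by rewrite -eA.
have [[j Aj]|[j Aj]] := set3_proper hA; first by case: (own j); exact: (face1_vert nd Aj mA).
have sub x : side_set s x -> elt K x.
  move=> hx; have : face (vert s.1) A x; last by rewrite -eA => -[].
  suff -> : A = ([set~ s.2])%SET by [].
  rewrite Aj; congr (~: [set _])%SET.
  move: mA => /(faceP _ _ (area2_neq0 nd _)) [_ /(_ j)]; rewrite Aj !inE eqxx => /(_ isT).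
  rewrite -/(lam _ _ _) lam_midp //; case: eqP => // _ /eqP; by rewrite (negPf n0).
have l1 : lam K i (midp s) = 1 by rewrite e lam_vert // eqxx.
rewrite affine_midp in l1; last exact: lam_affine.
have ha := lam_le1 nd i (sub _ (side_a_in nd s)).
have hb := lam_le1 nd i (sub _ (side_b_in nd s)).
have /eqP := side_ab_neq nd s; apply.
rewrite (lam_eq1 nd (sub _ (side_a_in nd s)) (i := i)); last lra.
by rewrite (lam_eq1 nd (sub _ (side_b_in nd s)) (i := i)); last lra.
Qed.

(* A coarse vertex is an extreme point of the fine elements of its coarse
   element that contain it. *)
Lemma coarse_vertex x : is_vertex TH x -> is_vertex Th x.
Proof.
move=> [K [i ->]]; set v := vert K i.
have Kv : elt K v by apply/(eltP ndH) => k; rewrite lam_vert.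
have [t tK tv] := cover_elt Kv; exists t.
apply: contrapT => hn.
have h0 := (eltP ndh _ _).1 tv.
have l1 : lam K i v = 1 by rewrite lam_vert // eqxx.
have tvert j : elt t (vert t j) by apply/(eltP ndh) => k; rewrite lam_vert.
have lt1 j : lam K i (vert t j) < 1.
  rewrite lt_neqAle (lam_le1 ndH) ?andbT; last exact: inKP tK _ (tvert j).
  apply/eqP => e; apply: hn; exists j.
  by rewrite (lam_eq1 ndH (inKP tK (tvert j)) e).
have := affine_bary v (area2_neq0 ndh t) (lam_affine K i); rewrite l1 sum3 -!/(lam _ _ _).
have := lam_sum ndh t 0 v; rewrite !ord3E.
pose M := Num.max (lam K i (vert t 0)) (Num.max (lam K i (vert t 1)) (lam K i (vert t 2))).
have M1 : M < 1 by rewrite !gt_max !lt1.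
have lM j : lam K i (vert t j) <= M.
  by case: (ord3P j) => ->; rewrite !le_max lexx ?orbT.
have hM j := ler_wpM2l (h0 j) (lM j).
have := hM 0; have := hM 1; have := hM 2; nra.
Qed.

Lemma ipt_open K x y : ipt K x -> exists2 e : R, 0 < e <= 1 &
  forall s, 0 <= s <= e -> ipt K (segment x y s).
Proof.
move=> hx.
have [e0 e00 h0] := small_pos (lam K 0 y) (hx 0).
have [e1 e10 h1] := small_pos (lam K 1 y) (hx 1).
have [e2 e20 h2] := small_pos (lam K 2 y) (hx 2).
exists (Num.min 1 (Num.min e0 (Num.min e1 e2))).
  by rewrite !lt_min ltr01 e00 e10 e20 ge_min lexx.
move=> s /andP[s0]; rewrite !le_min => /and4P[_ se0 se1 se2] k.
rewrite affine_segment; last exact: lam_affine.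
by case: (ord3P k) => ->; [apply: h0|apply: h1|apply: h2]; rewrite s0.
Qed.

Lemma segment_segment x y (r s : R) : segment x (segment x y r) s = segment x y (r * s).
Proof. by apply: plane_eq => /=; ring. Qed.

Lemma side_at_midp s k : side_set (m := Th) (s.1, k) (midp s) -> k = s.2.
Proof.
move=> /(side_setP ndh)[_ /=]; rewrite lam_midp //; case: eqP => // _ /eqP.
by rewrite invr_eq0 pnatr_eq0.
Qed.

Lemma nb_of_midp (s : side Th) t : elt t (midp s) -> t != s.1 ->
  exists k, nb s = Some (t, k).
Proof.
move=> ht n; have ms : elt s.1 (midp s) by have [] := (side_setP ndh _ _).1 (midp_in ndh s).
have sn : s.1 != t by rewrite eq_sym.
have [k [k' [hk h1 _]]] := common_side ndh cfh sn ms ht (@midp_not_vertex _ ndh cfh s).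
exists k'; apply/(nbP ndh cfh); split => //.
by move: hk; rewrite (side_at_midp h1) -surjective_pairing.
Qed.

(** A nonnegative affine function that vanishes at the midpoint of a segment vanishes at both
    ends. *)
Lemma lam0_side (K : 'I_(nelt TH)) k (s : side Th) : inK K s.1 -> lam K k (midp s) = 0 ->
  side_set s `<=` side_set (K, k).
Proof.
move=> sK h0.
have ea : elt K (side_a s).
  by apply: (inKP sK); have [] := (side_setP ndh _ _).1 (side_a_in ndh s).
have eb : elt K (side_b s).
  by apply: (inKP sK); have [] := (side_setP ndh _ _).1 (side_b_in ndh s).
rewrite affine_midp in h0; last exact: lam_affine.
have := (eltP ndH _ _).1 ea k; have := (eltP ndH _ _).1 eb k => hb ha.
move=> x /(side_seg ndh)[r hr ->]; apply: side_set_convex => //; apply/(side_setP ndH);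
  split => //=; lra.
Qed.

(* Just beyond a side whose midpoint is interior to [K] lies another fine element of [K]. *)
Lemma coarse_side K (s : side Th) : inK K s.1 ->
  (forall s', nb s = Some s' -> ~ inK K s'.1) ->
  exists k, side_set s `<=` side_set (K, k).
Proof.
move=> sK hn.
suff [k hk] : exists k, lam K k (midp s) = 0 by exists k; exact: lam0_side.
apply: contrapT => h0.
have mK : elt K (midp s).
  by apply: (inKP sK); have [] := (side_setP ndh _ _).1 (midp_in ndh s).
have ip : ipt K (midp s).
  move=> k; rewrite lt_neqAle ((eltP ndH _ _).1 mK) andbT; apply/eqP => e.
  by apply: h0; exists k.
(* The reflection of the opposite vertex in the midpoint: moving towards [w] leaves the element
   [s.1]. *)
pose w := segment (vert s.1 s.2) (midp s) 2.
have [e e0 he] := ipt_open w ip.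
have [|t [tK ts] tm] := @elts_at_start (fun t => inK K t /\ t != s.1) (midp s)
    (segment (midp s) w e).
  move=> r hr; rewrite segment_segment.
  have [|t tK ht] := @cover_ipt K (segment (midp s) w (e * r)); first by apply: he; nra.
  exists t => //; split=> //; apply/eqP => ets; move: ht; rewrite ets => /(eltP ndh) /(_ s.2).
  rewrite affine_segment; last exact: lam_affine.
  rewrite /w affine_segment; last exact: lam_affine.
  rewrite lam_midp // eqxx lam_vert // eqxx /=; nra.
have [k hk] := nb_of_midp tm ts.
exact: hn hk tK.
Qed.

(** Otherwise [t] would lie in a proper face of [K], where some coordinate vanishes; being affine
    and zero at the vertices of a nondegenerate triangle, that coordinate would vanish
    everywhere. *)
Lemma inK_uniq K K' t : inK K t -> inK K' t -> K = K'.
Proof.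
move=> tK tK'; apply/eqP/negP => /negP n.
have [A [B [hA eA _]]] := cfH n.
have tA x : elt t x -> face (vert K) A x.
  by move=> tx; rewrite -eA; split; [exact: inKP tK _ tx|exact: inKP tK' _ tx].
have [k kA] : exists k, k \notin A.
  by move: hA; rewrite -finset.subTset => /subsetPn [k _ kA]; exists k.
have z x : elt t x -> lam K k x = 0.
  by move=> /tA /(faceP _ _ (area2_neq0 ndH _)) [_ /(_ k kA)].
have := affine_bary (vert K k) (area2_neq0 ndh t) (lam_affine K k).
rewrite lam_vert // eqxx big1 => [/eqP|i _]; first by rewrite oner_eq0.
by rewrite z ?mulr0 //; apply/(eltP ndh) => j; rewrite lam_vert.
Qed.

(** The midpoint of [s] lies in both coarse elements and is not a coarse vertex, as coarse vertices
    are fine vertices; so the coarse elements share a side through it. *)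
Lemma coarse_interface K K' (s s' : side Th) : nb s = Some s' -> inK K s.1 -> inK K' s'.1 ->
  K != K' -> exists k k', [/\ same_side (K, k) (K', k'),
     side_set s `<=` side_set (K, k) & side_set s `<=` side_set (K', k')].
Proof.
move=> /(nbP ndh cfh)[n hs] sK sK' KK'.
have ms := midp_in ndh s; have ms' := same_side_set ndh hs ms.
have mK : elt K (midp s) by apply: (inKP sK); have [] := (side_setP ndh _ _).1 ms.
have mK' : elt K' (midp s) by apply: (inKP sK'); have [] := (side_setP ndh _ _).1 ms'.
have nv : ~ is_vertex TH (midp s) by move/coarse_vertex; exact: midp_not_vertex.
have [k [k' [hk h1 h2]]] := common_side ndH cfH KK' mK mK' nv.
have sub : side_set s `<=` side_set (K, k).
  by apply: lam0_side => //; have [] := (side_setP ndH _ _).1 h1.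
exists k, k'; split => // x hx; apply: (same_side_set ndH hk); exact: sub.
Qed.

(* Otherwise [(K, k)] would be shared with a second coarse element, whose fine
   elements would cover the other side of [s]. *)
Lemma boundary_coarse_side K (s : side Th) k y t : inK K s.1 -> nb s = None ->
  side_set s `<=` side_set (K, k) -> side_set (K, k) y -> inK K t -> elt t y ->
  ~ is_vertex Th y -> exists i, nb (t, i) = None /\ side_set (t, i) y.
Proof.
move=> sK ns sk yk tK ty ny.
have [Ky yk0] := (side_setP ndH _ _).1 yk.
have tv j : elt t (vert t j) by apply/(eltP ndh) => l; rewrite lam_vert.
have lv0 j : 0 <= lam K k (vert t j) by apply: (eltP ndH _ _).1; exact: inKP tK _ (tv j).
have eqy := affine_bary y (area2_neq0 ndh t) (lam_affine K k).
have h0 := (eltP ndh _ _).1 ty.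
have nz : ~ (forall j, lam K k (vert t j) = 0).
  move=> hz; have := affine_bary (vert K k) (area2_neq0 ndh t) (lam_affine K k).
  rewrite lam_vert // eqxx big1 => [/eqP|i _]; first by rewrite oner_eq0.
  by rewrite hz mulr0.
(* [lam K k] is nonnegative on [t] and vanishes at [y]; if no coordinate of [y] vanished, it would
   vanish at all vertices of [t]. *)
have [i yi] : exists i, lam t i y = 0.
  apply: contrapT => hn; apply: nz => j; move: eqy; rewrite yk0 => /esym/eqP.
  rewrite psumr_eq0 => [/allP/(_ j)|j' _]; last by rewrite mulr_ge0 //; exact: h0.
  rewrite mem_index_enum => /(_ isT)/implyP/(_ isT); rewrite mulf_eq0 => /orP[/eqP e|/eqP//].
  by case: hn; exists j.
have syi : side_set (t, i) y by apply/(side_setP ndh).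
exists i; split => //; apply: contrapT => hnn.
case hnb : (nb (t, i)) hnn => [s''|] // _.
(* [y] is no vertex of [t], so its two other coordinates are positive, which forces both ends of the
   side [(t, i)] onto the line of the coarse side. *)
have pos j : j != i -> 0 < lam t j y.
  move=> ji; rewrite lt_neqAle h0 andbT; apply/eqP => e; apply: ny.
  exists t; have [l lij] : exists l, [/\ l != i, l != j & forall o, o != l -> o = i \/ o = j].
    case: (ord3k i j) ji => -> ; rewrite ?eqxx // => _.
      exists (i + 2); rewrite !ord3F; split => // o; case: (ord3k i o) => ->; rewrite ?eqxx //; by [left|right].
    exists (i + 1); rewrite !ord3F; split => // o; case: (ord3k i o) => ->; rewrite ?eqxx //; by [left|right].
  exists l; apply: (lam_eq1 ndh ty); case: lij => li lj ho.
  have z o : o != l -> lam t o y = 0 by case/ho => ->.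
  have := lam_sum ndh t l y; rewrite (z (l + 1)) ?(z (l + 2)) ?ord3F // !addr0 //.
have ab0 : lam K k (side_a (t, i)) = 0 /\ lam K k (side_b (t, i)) = 0.
  move: eqy; rewrite yk0 (sum3k _ i) -!/(lam _ _ _) yi mul0r add0r /side_a /side_b /=.
  have := pos (i + 1); have := pos (i + 2); rewrite !ord3F => /(_ isT) p2 /(_ isT) p1.
  have := lv0 (i + 1); have := lv0 (i + 2) => q2 q1 e0.
  by split; nra.
have [n'' hs''] := (nbP ndh cfh _ _).1 hnb.
have lK x : lam K k x = lam t i x * lam K k (vert t i).
  by have := @affine_side _ _ ndh (lam K k) (t, i) x (lam_affine K k) ab0.1 ab0.2.
have vi : 0 < lam K k (vert t i).
  rewrite lt_neqAle lv0 andbT; apply/eqP => e; apply: nz => j.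
  by rewrite lK -e mulr0.
have opp : lam t i (vert s''.1 s''.2) < 0.
  have := @opposite_sides _ _ ndh cfh s'' (t, i) n''; rewrite same_side_sym; exact.
have [K'' K''t] := hsub s''.1.
have s''K : inK K'' s''.1 by apply/asboolP.
have KK'' : K != K''.
  apply/eqP => e; move: s''K; rewrite -e => s''K.
  have tv'' : elt s''.1 (vert s''.1 s''.2) by apply/(eltP ndh) => l; rewrite lam_vert.
  have := (eltP ndH _ _).1 (inKP s''K tv'') k; rewrite lK; nra.
have [k1 [k1' [hk1 sub1 _]]] := coarse_interface hnb tK s''K KK''.
(* Two different sides of [K] meet in a single vertex and cannot both contain the fine side. *)
have k1k : k1 = k.
  have m1 := sub1 _ (midp_in ndh (t, i)).
  have [_ /= z1] := (side_setP ndH _ _).1 m1.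
  have [_ /= za] := (side_setP ndH _ _).1 (sub1 _ (side_a_in ndh (t, i))).
  have [_ /= zb] := (side_setP ndH _ _).1 (sub1 _ (side_b_in ndh (t, i))).
  apply/eqP/negP => /negP kk1.
  have vl (p : plane R) : lam K k p = 0 -> lam K k1 p = 0 -> forall o, o != k -> o != k1 -> lam K o p = 1.
    move=> p0 p1 o ok ok1; have := lam_sum ndH K o p.
    have c1 : forall o', o' != o -> lam K o' p = 0.
      move=> o' o'o; have : o' = k \/ o' = k1.
        move: kk1 ok ok1 o'o; case: (ord3k k k1) => ->; case: (ord3k k o) => ->;
          case: (ord3k k o') => ->; rewrite ?eqxx ?ord3F //; by [left|right].
      by case=> ->.
    by rewrite (c1 (o + 1)) ?(c1 (o + 2)) ?ord3F // !addr0.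
  have [l [lk lk1]] : exists l, l != k /\ l != k1.
    case: (ord3k k k1) kk1 => ->; rewrite ?eqxx // => _.
      by exists (k + 2); rewrite !ord3F.
    by exists (k + 1); rewrite !ord3F.
  have Ka : elt K (side_a (t, i)) by have [] := (side_setP ndH _ _).1 (sub1 _ (side_a_in ndh (t, i))).
  have Kb : elt K (side_b (t, i)) by have [] := (side_setP ndH _ _).1 (sub1 _ (side_b_in ndh (t, i))).
  have /eqP := side_ab_neq ndh (t, i); apply.
  rewrite (lam_eq1 ndH Ka (vl _ ab0.1 za l lk lk1)).
  by rewrite (lam_eq1 ndH Kb (vl _ ab0.2 zb l lk lk1)).
rewrite k1k in hk1.
(* The second coarse element shares [(K, k)], so it contains the midpoint of [s], and one of its
   fine elements is a neighbour of [s]. *)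
have [m'' _] := (side_setP ndH _ _).1 (same_side_set ndH hk1 (sk _ (midp_in ndh s))).
have [t1 t1K t1m] := cover_elt m''.
have t1s : t1 != s.1.
  by apply/eqP => e; move: t1K; rewrite e => /(inK_uniq sK) /eqP; rewrite (negPf KK'').
by have [l] := nb_of_midp t1m t1s; rewrite ns.
Qed.

End Refinement.

(** * Poincare and trace inequalities on a coarse element *)

Section Poincare.
Variables (R : realType) (Om : set (plane R)) (Th TH : mesh R).
Hypotheses (ndh : Defs.nondegenerate Th) (cfh : conforming Th)
  (covh : closure Om = \bigcup_K elt (m := Th) K).
Hypotheses (ndH : Defs.nondegenerate TH) (cfH : conforming TH)
  (covH : closure Om = \bigcup_K elt (m := TH) K).
Hypothesis hsub : forall t : 'I_(nelt Th), exists K : 'I_(nelt TH), elt t `<=` elt K.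
Variables (sigma : R) (c : 'I_(nelt Th) -> plane R) (cH : 'I_(nelt TH) -> plane R).
Hypothesis sig0 : 0 < sigma.
Hypothesis hc : forall t, [set x | enorm (x - c t) <= mesh_size Th / sigma] `<=` elt t.
Hypothesis hcH : forall K, [set x | enorm (x - cH K) <= mesh_size TH / sigma] `<=` elt K.
Implicit Types (t : 'I_(nelt Th)) (K : 'I_(nelt TH)) (x y z : plane R).
Implicit Types (u : dgspace R Th) (q : 'I_(nelt Th) -> R) (S : {set 'I_(nelt Th)}).

Local Notation level := (level Th).
Local Notation h := (mesh_size Th).
Local Notation H := (mesh_size TH).
(** Lengths in coarse barycentric coordinates, both of order [h / H]: two fine centres closer than
    [d] in two coordinates coincide, and [L] bounds the oscillation of a coordinate of [K] on one
    fine element. *)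
Local Notation d := (h / (2 * sigma * H)).
Local Notation L := (sigma ^+ 2 * d).

Let cover_elt := cover_elt ndh covh ndH cfH covH hsub.
Let coarse_side := coarse_side ndh cfh covh ndH cfH covH hsub.
Let boundary_coarse_side := boundary_coarse_side ndh cfh covh ndH cfH covH hsub.

Lemma fine_size_gt0 K : 0 < h.
Proof.
have [x hx] := ipt_exists ndH K.
have [t _ _] := cover_ipt covh ndH cfH covH hsub hx.
exact: mesh_size_gt0 t.
Qed.

Lemma coarse_size_gt0 K : 0 < H. Proof. exact: mesh_size_gt0 K. Qed.

Lemma fine_le_coarse : h <= H.
Proof.
apply: bigmax_le => [|t _]; first exact: mesh_size_ge0.
apply: bigmax_le => [|k _]; first exact: mesh_size_ge0.
have [K tK] := hsub t.
have := elt_dist ndH (K := K) (x := side_b (t, k)) (y := side_a (t, k)).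
rewrite -sqr_enorm ler_pXn2r ?nnegrE ?enorm_ge0 ?mesh_size_ge0 //; apply; apply: tK.
  by have /(side_setP ndh)[] := side_b_in ndh (t, k).
by have /(side_setP ndh)[] := side_a_in ndh (t, k).
Qed.

Lemma step_gt0 K : 0 < d.
Proof. by rewrite divr_gt0 ?mulr_gt0 ?(fine_size_gt0 K) ?(coarse_size_gt0 K). Qed.

Lemma centre_ipt t : ipt t (c t).
Proof. by apply: disc_ipt (hc (t := t)) => //; rewrite divr_gt0 // (mesh_size_gt0 ndh t). Qed.

Lemma centre_elt t : elt t (c t). Proof. exact/ipt_elt/centre_ipt. Qed.

Lemma lam_osc K k t x y : inK K t -> elt t x -> elt t y -> `|lam K k x - lam K k y| <= L.
Proof.
move=> tK tx ty; have H0 := coarse_size_gt0 K.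
have r0 : 0 < H / sigma by rewrite divr_gt0.
apply: le_trans (lam_lip ndH k r0 (hcH (K := K)) (mesh_size_ge0 Th) (elt_dist ndh tx ty)) _.
rewrite le_eqVlt; apply/orP; left; apply/eqP; field.
by rewrite !lt0r_neq0.
Qed.

(** The difference of the centres combines two sides of [K], of length at most [H], with
    coefficients below [d], so it is at most [2 * d * H = h / sigma]. The centre of [t'] then lies
    in the disc of [t], while it is interior to [t']. *)
Lemma centre_sep1 K i t t' : inK K t -> inK K t' ->
  `|lam K i (c t) - lam K i (c t')| < d ->
  `|lam K (i + 1) (c t) - lam K (i + 1) (c t')| < d -> t = t'.
Proof.
move=> tK t'K hi hj; have H0 := coarse_size_gt0 K; have h0 := fine_size_gt0 K.
suff hd : elt t (c t') by rewrite (ipt_uniq ndh cfh (centre_ipt t') hd).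
apply: hc => /=; rewrite enorm_le; last by rewrite divr_ge0 // ltW.
set D1 := lam K i (c t) - _ in hi; set D2 := lam K (i + 1) _ - _ in hj.
pose p := vert K i - vert K (i + 2); pose r := vert K (i + 1) - vert K (i + 2).
have e : c t' - c t = scalep (- D1) p + scalep (- D2) r.
  have s1 := lam_sum ndH K i (c t); have s2 := lam_sum ndH K i (c t').
  have e1 : lam K (i + 2) (c t) = 1 - lam K i (c t) - lam K (i + 1) (c t) by lra.
  have e2 : lam K (i + 2) (c t') = 1 - lam K i (c t') - lam K (i + 1) (c t') by lra.
  rewrite {1}(bary_combo (c t') (area2_neq0 ndH K)) {1}(bary_combo (c t) (area2_neq0 ndH K)).
  rewrite !(sum3k _ i) -!/(lam _ _ _) e1 e2.
  by apply: plane_eq; rewrite /p /r /D1 /D2 /=; ring.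
have pp : dot p p <= H ^+ 2 by exact: vert_dist.
have rr : dot r r <= H ^+ 2 by exact: vert_dist.
have pr : `|dot p r| <= H ^+ 2.
  rewrite abs_le_sqr ?sqr_ge0 //; apply: le_trans (dot_CS _ _) _.
  by rewrite expr2; apply: ler_pM => //; exact: dot_ge0.
have -> : h / sigma = 2 * d * H.
  by field; rewrite !lt0r_neq0.
have d0 := step_gt0 K.
have -> : dot (c t' - c t) (c t' - c t) =
    D1 ^+ 2 * dot p p + D2 ^+ 2 * dot r r + 2 * (D1 * D2) * dot p r.
  by rewrite e /dot /=; ring.
have D12 : D1 ^+ 2 <= d ^+ 2 by rewrite -abs_le_sqr ?ltW.
have D22 : D2 ^+ 2 <= d ^+ 2 by rewrite -abs_le_sqr ?ltW.
have DD : `|D1 * D2| <= d ^+ 2 by rewrite normrM expr2; apply: ler_pM => //; exact: ltW.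
have b1 : D1 ^+ 2 * dot p p <= d ^+ 2 * H ^+ 2.
  by apply: ler_pM => //; [exact: sqr_ge0|exact: dot_ge0].
have b2 : D2 ^+ 2 * dot r r <= d ^+ 2 * H ^+ 2.
  by apply: ler_pM => //; [exact: sqr_ge0|exact: dot_ge0].
have b3 : (D1 * D2) * dot p r <= d ^+ 2 * H ^+ 2.
  by apply: le_trans (ler_norm _) _; rewrite normrM; apply: ler_pM.
rewrite -mulrA !exprMn -[2 ^+ 2]/(2 * 2); move: b1 b2 b3.
rewrite !exprMn; lra.
Qed.

Lemma centre_sep K i j t t' : i != j -> inK K t -> inK K t' ->
  `|lam K i (c t) - lam K i (c t')| < d ->
  `|lam K j (c t) - lam K j (c t')| < d -> t = t'.
Proof.
case: (ord3k i j) => ->; rewrite ?eqxx // => _ tK t'K hi hj.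
  exact: centre_sep1 hi hj.
have e : i = i + 2 + 1.
  by case: (ord3P i) => ->; rewrite !ord3E.
rewrite {1 2}e in hi; exact: centre_sep1 hj hi.
Qed.

Lemma lam_inK K k t x : inK K t -> elt t x -> 0 <= lam K k x <= 1.
Proof.
move=> tK tx; have Kx := inKP tK tx; rewrite (lam_le1 ndH) // andbT.
exact: (eltP ndH _ _).1.
Qed.

Lemma ratio_ge1 K : 1 <= H / h.
Proof. by rewrite ler_pdivlMr ?(fine_size_gt0 K) // mul1r fine_le_coarse. Qed.

Lemma inv_step K : 1 / d = 2 * sigma * (H / h).
Proof.
by have := coarse_size_gt0 K; have := fine_size_gt0 K => ? ?; field; rewrite !lt0r_neq0.
Qed.

Lemma L_ge0 K : 0 <= L.
Proof. by rewrite mulr_ge0 ?sqr_ge0 // ltW // (step_gt0 K). Qed.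

(** The strip is unrestricted in a second coordinate, whose range 1 is cut into [1 / d], a multiple
    of [H / h], cells. *)
Lemma card_strip (X : {set 'I_(nelt Th)}) K j (a A : R) :
  (forall t, t \in X -> inK K t) ->
  (forall t, t \in X -> a <= lam K j (c t) <= a + A * d) -> 0 <= A ->
  #|X|%:R <= (2 * sigma + 1) * (A + 1) * (H / h).
Proof.
move=> XK hX A0; have d0 := step_gt0 K; have n1 := ratio_ge1 K.
have := @card_separated R _ X (fun t => lam K (j + 1) (c t)) (fun t => lam K j (c t))
  0 a 1 (A * d) d d0.
rewrite mulfK ?lt0r_neq0 // (inv_step K) => hh.
apply: le_trans (hh _ _ _ _ _) _ => //.
- by move=> t tX; rewrite add0r; apply: lam_inK (XK _ tX) (centre_elt t).
- by rewrite mulr_ge0 // ltW.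
- by move=> t t' tX t'X; apply: centre_sep; rewrite ?ord3F ?XK.
- rewrite [leRHS]mulrAC ler_wpM2r //; first lra.
  by rewrite mulrDl mul1r; lra.
Qed.

Lemma card_box (X : {set 'I_(nelt Th)}) K i j (a A b B : R) : i != j ->
  (forall t, t \in X -> inK K t) ->
  (forall t, t \in X -> a <= lam K i (c t) <= a + A * d) -> 0 <= A ->
  (forall t, t \in X -> b <= lam K j (c t) <= b + B * d) -> 0 <= B ->
  #|X|%:R <= (A + 1) * (B + 1).
Proof.
move=> ij XK hX A0 hY B0; have d0 := step_gt0 K.
have := @card_separated R _ X (fun t => lam K i (c t)) (fun t => lam K j (c t))
  a b (A * d) (B * d) d d0.
rewrite !mulfK ?lt0r_neq0 //; apply => //.
- by rewrite mulr_ge0 // ltW.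
- by rewrite mulr_ge0 // ltW.
- by move=> t t' tX t'X; apply: centre_sep; rewrite ?XK.
Qed.

Lemma level_centre K j r t : t \in level K j r ->
  inK K t /\ r - L <= lam K j (c t) <= r + L.
Proof.
rewrite inE => /andP[tK /asboolP[x tx <-]]; split => //.
by have := lam_osc j tK tx (centre_elt t); rewrite ler_norml; lra.
Qed.

(** A level is met only by elements with centre in a strip of width [2 * L], which is
    [2 * sigma ^+ 2] times [d]; the factor 4 is that of [segment_bound]. *)
Definition c_line : R := 4 * ((2 * sigma + 1) * (2 * sigma ^+ 2 + 1)).

Lemma c_line_gt0 : 0 < c_line.
Proof. by rewrite /c_line !mulr_gt0 // addr_gt0 // ?mulr_gt0 // exprn_gt0. Qed.

Lemma card_level K j r :
  4 * #|level K j r|%:R <= c_line * (H / h).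
Proof.
rewrite /c_line -mulrA ler_pM2l //.
apply: (@card_strip _ K j (r - L) (2 * sigma ^+ 2)).
- by move=> t /level_centre[].
- by move=> t /level_centre[_]; lra.
- by rewrite mulr_ge0 ?sqr_ge0.
Qed.

Lemma line_bound_ratio K u q j r x y t t' : compat K u q -> (forall t, 0 <= q t) ->
  generic Th K j r -> elt K x -> elt K y -> lam K j x = r -> lam K j y = r ->
  inK K t -> inK K t' -> elt t x -> elt t' y ->
  (ev u t x - ev u t' y) ^+ 2 <= c_line * ((H / h) * \sum_(a in level K j r) q a).
Proof.
move=> hcp q0 gr Kx Ky lx ly tK t'K tx t'y.
apply: le_trans (line_bound ndh cfh covh ndH cfH covH hsub hcp q0 gr Kx Ky lx ly tK t'K tx t'y) _.
by rewrite mulrA ler_wpM2r ?sumr_ge0 // card_level.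
Qed.

Lemma generic_exists K j (a b : R) : a < b -> exists2 r, a < r < b & generic Th K j r.
Proof.
move=> ab; have [r hr nr] := avoid_seq [seq lam K j (vert s.1 s.2) | s : side Th] ab.
exists r => // x lx [t [k e]]; case/negP: nr; apply/mapP; exists (t, k); first exact: mem_enum.
by rewrite -e.
Qed.

Lemma exists_le_average (N : nat) (F : 'I_N -> R) : (0 < N)%N ->
  exists i, N%:R * F i <= \sum_j F j.
Proof.
case: N F => // N F _; apply: contrapT => hn.
have hlt i : \sum_j F j < N.+1%:R * F i.
  by rewrite ltNge; apply/negP => hi; apply: hn; exists i.
have : \sum_(i < N.+1) \sum_j F j < \sum_(i < N.+1) N.+1%:R * F i.
  by apply: ltr_sum => [|i _]; [apply/hasP; exists ord0; rewrite ?mem_index_enum|exact: hlt].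
by rewrite sumr_const card_ord -mulr_sumr mulr_natl ltxx.
Qed.

Definition mass K q : R := \sum_(t | inK K t) q t.

Lemma mass_ge0 K q : (forall t, 0 <= q t) -> 0 <= mass K q.
Proof. by move=> q0; apply: sumr_ge0. Qed.

(** [32 * sigma + 1] bounds the number of sampled levels that meet one fine element; the factor 2
    pays for rounding [H / h] down to an integer. *)
Definition c_good : R := 2 * (32 * sigma + 1).

(* Averaging over about [H / h] levels, of which each fine element meets a bounded
   number. *)
Lemma good_level K k q : (forall t, 0 <= q t) ->
  exists r, [/\ 4^-1 < r < 5 / 16, generic Th K k r &
    (H / h) * \sum_(t in level K k r) q t <= c_good * mass K q].
Proof.
move=> q0; have n1 := ratio_ge1 K; set N := Num.truncn (H / h).
have /truncn_itv : 0 <= H / h by lra.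
rewrite -/N -[N.+1%:R]natr1 => /andP[N1 N2].
have N0 : (0 < N)%N by rewrite truncn_gt0.
have NR : 1 <= N%:R :> R by rewrite ler1n.
(* One generic level in the first half of each of [N] equal cells of (1/4, 5/16), so that two of
   them differ by at least half a cell, [1 / (32 * N)]. *)
have ex (i : 'I_N) : exists r, 4^-1 + i%:R / (16 * N%:R) < r < 4^-1 + (i%:R + 2^-1) / (16 * N%:R) /\
    generic Th K k r.
  have [|r hr gr] := @generic_exists K k (4^-1 + i%:R / (16 * N%:R)) (4^-1 + (i%:R + 2^-1) / (16 * N%:R)).
    rewrite ltrD2l ltr_pM2r ?invr_gt0 ?mulr_gt0 //; lra.
  by exists r.
have [r hr] := choice ex.
have rb (i : 'I_N) : i%:R < (r i - 4^-1) * (16 * N%:R) < i%:R + 2^-1.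
  have [/andP[h1 h2] _] := hr i.
  have N16 : 0 < 16 * N%:R :> R by lra.
  rewrite -ltr_pdivrMr // -[X in _ && X]ltr_pdivlMr //; lra.
have [i hi] := exists_le_average (fun i => \sum_(t in level K k (r i)) q t) N0.
exists (r i); split; last first.
- have cnt t : #|[set i | t \in level K k (r i)]%SET|%:R <= 32 * sigma + 1.
    case: (pselect (inK K t)) => tK; last first.
      rewrite (_ : [set _ | _]%SET = finset.set0) ?cards0; first by rewrite addr_ge0 ?mulr_ge0 // ltW.
      by apply/finset.setP => j; rewrite !inE (negPf (introN idP tK)).
    have n16 : 0 < (32 * N%:R)^-1 :> R by rewrite invr_gt0; lra.
    have := @card_separated1 R _ [set i | t \in level K k (r i)]%SET r (lam K k (c t) - L)
      (2 * L) _ n16.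
    rewrite invrK => hh; apply: le_trans (hh _ _ _) _.
    + by move=> j; rewrite inE => /level_centre[_]; lra.
    + by rewrite mulr_ge0 // (L_ge0 K).
    + move=> j j' _ _; rewrite -[_^-1]mul1r ltr_pdivlMr; last lra.
      rewrite -[32 * N%:R]gtr0_norm; last lra.
      rewrite -normrM ltr_norml => hjj; apply: val_inj; apply/eqP; rewrite eqn_leq.
      have := rb j; have := rb j' => h1 h2.
      apply/andP; split; rewrite leqNgt; apply/negP => hlt.
      * have : j'%:R + 1 <= j%:R :> R by rewrite natr1 ler_nat.
        lra.
      * have : j%:R + 1 <= j'%:R :> R by rewrite natr1 ler_nat.
        lra.
    + rewrite lerD2r.
      have -> : 2 * L * (32 * N%:R) = 32 * sigma * (N%:R * (h / H)).
        by have := coarse_size_gt0 K => ?; field; rewrite !lt0r_neq0.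
      rewrite ger_pMr ?mulr_gt0 // -ler_pdivlMr ?divr_gt0 ?(coarse_size_gt0 K) ?(fine_size_gt0 K) //.
      by rewrite invf_div mul1r.
  have tot : \sum_i \sum_(t in level K k (r i)) q t <= (32 * sigma + 1) * mass K q.
    rewrite (exchange_big_dep (inK K)) /=; last by move=> j t _; rewrite inE => /andP[].
    rewrite /mass mulr_sumr; apply: ler_sum => t _.
    rewrite (eq_bigl (fun j => j \in [set i | t \in level K k (r i)]%SET)); last by move=> j; rewrite [RHS]finset.in_set.
    by rewrite sumr_const -[leLHS]mulr_natl ler_wpM2r.
  have G0 : 0 <= \sum_(t in level K k (r i)) q t by rewrite sumr_ge0.
  apply: (@le_trans _ _ (2 * (N%:R * \sum_(t in level K k (r i)) q t))).
    rewrite mulrA ler_wpM2r //; lra.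
  rewrite /c_good -mulrA ler_pM2l //; exact: le_trans hi tot.
- by have [] := hr i.
- have := rb i; have iN : i%:R + 1 <= N%:R :> R by rewrite natr1 ler_nat.
  have i0 : 0 <= i%:R :> R by []. 
  move=> /andP[h1 h2]; apply/andP; split; nra.
Qed.

(** At most two lines are followed, and squaring a sum of two increments costs the factor 4. *)
Definition c_ref : R := 4 * (c_line * c_good).

Lemma c_good_gt0 : 0 < c_good.
Proof. by rewrite /c_good mulr_gt0 // addr_gt0 // mulr_gt0. Qed.

Lemma c_ref_gt0 : 0 < c_ref.
Proof.
by apply: mulr_gt0 => //; apply: mulr_gt0; [exact: c_line_gt0|exact: c_good_gt0].
Qed.

Lemma elt_point K j k (a b : R) : j != k -> 0 <= a -> 0 <= b -> a + b <= 1 ->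
  exists x, [/\ elt K x, lam K j x = a & lam K k x = b].
Proof.
move=> jk a0 b0 ab.
pose l i := if i == j then a else if i == k then b else 1 - a - b.
have kj : (k == j) = false by rewrite eq_sym (negPf jk).
have [|x hx] := @bary_exists R (vert K) l (area2_neq0 ndH K).
  rewrite (sum3k _ j) /l eqxx; case: (ord3k j k) jk kj => ->; rewrite ?eqxx //= => _ _.
  - rewrite !ord3F; ring.
  - rewrite !ord3F; ring.
exists x; split.
- apply/(eltP ndH) => i; rewrite /lam hx /l; case: ifP => // _; case: ifP => // _; lra.
- by rewrite /lam hx /l eqxx.
- by rewrite /lam hx /l kj eqxx.
Qed.

(* Lines at levels in (1/4, 5/16) in the three directions meet pairwise in [K], so
   any two points on them are joined by at most two segments. *)
Lemma reference_point K q : (forall t, 0 <= q t) ->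
  exists (r : 'I_3 -> R) z tz, [/\ forall k, 4^-1 < r k < 5 / 16,
    forall k, generic Th K k (r k), inK K tz, elt tz z &
    forall u, compat K u q -> forall j x t, elt K x -> lam K j x = r j ->
      inK K t -> elt t x -> (ev u t x - ev u tz z) ^+ 2 <= c_ref * mass K q].
Proof.
move=> q0; have [r hr] := choice (fun k => good_level K k q0).
have r1 k : 4^-1 < r k < 5 / 16 by have [] := hr k.
have gr k : generic Th K k (r k) by have [] := hr k.
have Gr k : (H / h) * \sum_(t in level K k (r k)) q t <= c_good * mass K q by have [] := hr k.
have point i j : i != j -> exists x t, [/\ elt K x, lam K i x = r i, lam K j x = r j,
    inK K t & elt t x].
  move=> ij; have [|||x [Kx xi xj]] := @elt_point K i j (r i) (r j) ij.
  - by have := r1 i; lra.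
  - by have := r1 j; lra.
  - by have := r1 j; have := r1 i; lra.
  have [t tK tx] := cover_elt Kx.
  by exists x, t.
have [//|z [tz [Kz z0 z1 tzK tzz]]] := point 0 1.
have [//|z' [t' [Kz' z0' z2' t'K t'z']]] := point 0 2.
exists r, z, tz; split => // u cu j x t Kx xj tK tx.
have M0 := mass_ge0 K q0.
have hop i (x1 x2 : plane R) t1 t2 : elt K x1 -> elt K x2 -> lam K i x1 = r i -> lam K i x2 = r i ->
    inK K t1 -> inK K t2 -> elt t1 x1 -> elt t2 x2 ->
    (ev u t1 x1 - ev u t2 x2) ^+ 2 <= c_line * c_good * mass K q.
  move=> K1 K2 l1 l2 h1 h2 h3 h4.
  apply: le_trans (line_bound_ratio cu q0 (gr i) K1 K2 l1 l2 h1 h2 h3 h4) _.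
  by rewrite -[leRHS]mulrA ler_wpM2l // ltW // c_line_gt0.
have P0 : 0 <= c_line * c_good * mass K q.
  by rewrite mulr_ge0 // ltW // mulr_gt0 ?c_line_gt0 ?c_good_gt0.
have weak (e : R) : e <= c_line * c_good * mass K q -> e <= c_ref * mass K q.
  by rewrite /c_ref; lra.
case: (ord3P j) xj => -> xj.
- exact/weak/(hop 0).
- exact/weak/(hop 1).
- have e1 := hop 2 _ _ _ _ Kx Kz' xj z2' tK t'K tx t'z'.
  have e2 := hop 0 _ _ _ _ Kz' Kz z0' z0 t'K tzK t'z' tzz.
  have := sqr_ge0 ((ev u t x - ev u t' z') - (ev u t' z' - ev u tz z)).
  rewrite /c_ref; nra.
Qed.

Lemma centre_coarse_ipt K t : inK K t -> ipt K (c t).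
Proof.
move=> tK; apply: (@disc_ipt _ _ ndH _ _ (h / sigma)); first by rewrite divr_gt0 ?(fine_size_gt0 K).
by move=> x hx; apply: inKP tK _ _; apply: hc.
Qed.

(* Moving the centre slightly towards a vertex of [K] makes its level generic
   without increasing it. *)
Lemma descent K k t : inK K t -> exists jx : 'I_3 * plane R,
  [/\ jx.1 != k, elt t jx.2, lam K jx.1 jx.2 <= 2^-1 & generic Th K jx.1 (lam K jx.1 jx.2)].
Proof.
move=> tK; have ip := centre_coarse_ipt tK; have H0 := coarse_size_gt0 K.
have h0 := fine_size_gt0 K.
(* The two coordinates other than [k] sum to less than 1. A level of at most 1/2 ensures that its
   line meets the reference line of direction [k], at level below 5/16, inside [K]. *)
have [j jk lj] : exists2 j, j != k & lam K j (c t) <= 2^-1.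
  have [h1|h1] := leP (lam K (k + 1) (c t)) 2^-1; first by exists (k + 1); rewrite ?ord3F.
  exists (k + 2); rewrite ?ord3F //.
  by have := lam_sum ndH K k (c t); have := ip k; lra.
(* A relative displacement [e] moves the centre by at most [e * H], which stays in the inscribed
   disc of [t]. *)
pose e := Num.min 1 (h / (sigma * H)).
have e0 : 0 < e by rewrite lt_min ltr01 divr_gt0 ?mulr_gt0.
have e1 : e <= 1 by rewrite ge_min lexx.
have e2 : e * H <= h / sigma.
  apply: (@le_trans _ _ (h / (sigma * H) * H)).
    by rewrite ler_wpM2r ?(ltW H0) // ge_min lexx orbT.
  by rewrite le_eqVlt; apply/orP; left; apply/eqP; field; rewrite !lt0r_neq0.
pose l0 := lam K j (c t).
have l00 : 0 < l0 by exact: ip.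
have [|r hr gr] := @generic_exists K j ((1 - e) * l0) l0.
  by rewrite gtr_pMl //; lra.
pose s := 1 - r / l0.
have s0 : 0 <= s <= e.
  have : 1 - e <= r / l0 by rewrite ler_pdivlMr //; lra.
  have : r / l0 <= 1 by rewrite ler_pdivrMr //; lra.
  rewrite /s; lra.
pose x := segment (c t) (vert K (j + 1)) s.
have lx : lam K j x = r.
  rewrite affine_segment; last exact: lam_affine.
  by rewrite lam_vert // ord3F mulr0 addr0 /s -/l0; field; exact: lt0r_neq0.
exists (j, x); split => //=; last by rewrite lx.
- apply: hc => /=; rewrite enorm_le; last by rewrite divr_ge0 // ltW.
  have -> : x - c t = scalep s (vert K (j + 1) - c t).
    by apply: plane_eq; rewrite /x /=; ring.
  have -> : dot (scalep s (vert K (j + 1) - c t)) (scalep s (vert K (j + 1) - c t)) =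
    s ^+ 2 * dot (vert K (j + 1) - c t) (vert K (j + 1) - c t) by rewrite /dot /=; ring.
  have Kv : elt K (vert K (j + 1)) by apply/(eltP ndH) => i; rewrite lam_vert.
  have := elt_dist ndH Kv (ipt_elt ndH ip) => hd.
  apply: (@le_trans _ _ ((e * H) ^+ 2)).
    rewrite exprMn; apply: ler_pM => //; rewrite ?sqr_ge0 ?dot_ge0 //.
    by have /andP[? ?] := s0; rewrite ler_pXn2r ?nnegrE // ltW.
  rewrite ler_pXn2r ?nnegrE //; first by rewrite mulr_ge0 ?ltW.
  by rewrite divr_ge0 ?ltW.
- rewrite lx; apply: le_trans lj; rewrite -/l0; lra.
Qed.

Definition near_side K k : {set 'I_(nelt Th)} :=
  [set t | inK K t && [exists i : 'I_3, `[< side_set (t, i) `<=` side_set (K, k) >]]]%SET.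

Lemma near_side_lam K k t : t \in near_side K k -> inK K t /\ 0 <= lam K k (c t) <= L.
Proof.
rewrite inE => /andP[tK /existsP[i /asboolP hi]]; split => //.
have ha := side_a_in ndh (t, i); have [ta _] := (side_setP ndh _ _).1 ha.
have [_ /= l0] := (side_setP ndH _ _).1 (hi _ ha).
have := lam_osc k tK (centre_elt t) ta; rewrite l0 subr0 ler_norml.
by have := centre_coarse_ipt tK k; lra.
Qed.

Definition c_side : R := (2 * sigma + 1) * (sigma ^+ 2 + 1).

Lemma card_near_side K k : #|near_side K k|%:R <= c_side * (H / h).
Proof.
apply: (@card_strip _ K k 0 (sigma ^+ 2)); last exact: sqr_ge0.
- by move=> t /near_side_lam[].
- by move=> t /near_side_lam[_]; rewrite add0r.
Qed.

Definition c_box : R := 3 * ((sigma ^+ 2 + 1) * (4 * sigma ^+ 2 + 1)).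

(** Exchange of summation: an element [a] is charged only by those [t] whose centre has [lam K k]
    within [L] of 0 and [lam K j] within [2 * L] of that of [a]. Such a box holds boundedly many
    centres, so leaving a whole coarse side along lines costs no further power of [H / h]. *)
Lemma sum_levels K k q (J : 'I_(nelt Th) -> 'I_3) (X : 'I_(nelt Th) -> plane R) :
  (forall t, 0 <= q t) -> (forall t, t \in near_side K k -> J t != k /\ elt t (X t)) ->
  \sum_(t in near_side K k) \sum_(a in level K (J t) (lam K (J t) (X t))) q a
   <= c_box * mass K q.
Proof.
move=> q0 hJ; rewrite (exchange_big_dep (inK K)) /=; last first.
  by move=> t a _; rewrite inE => /andP[].
rewrite /mass mulr_sumr; apply: ler_sum => a aK.
rewrite -big_set /= sumr_const -[leLHS]mulr_natl ler_wpM2r //.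
set X0 := (X in #|pred_of_set X|).
have inX0 t : (t \in X0) = (t \in near_side K k) && (a \in level K (J t) (lam K (J t) (X t))).
  by rewrite [LHS]finset.in_set.
have inX j t : (t \in [set t in X0 | J t == j]%SET) = (t \in X0) && (J t == j).
  by rewrite [LHS]finset.in_set.
have -> : #|X0|%:R = \sum_j #|[set t in X0 | J t == j]%SET|%:R :> R.
  rewrite -natr_sum; congr _%:R; rewrite -sum1_card (partition_big J xpredT) //=.
  by apply: eq_bigr => j _; rewrite -sum1_card; apply: eq_bigl => t; rewrite [RHS]inX.
apply: (@le_trans _ _ (\sum_(j < 3) (sigma ^+ 2 + 1) * (4 * sigma ^+ 2 + 1))); last first.
  by rewrite sumr_const card_ord /c_box [leRHS]mulr_natl.
apply: ler_sum => j _.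
case: (eqVneq j k) => [->|jk].
  rewrite (_ : [set t in X0 | J t == k]%SET = finset.set0) ?cards0.
    by have := sqr_ge0 sigma => s2; apply: mulr_ge0; lra.
  apply/finset.setP => t; rewrite inX inX0 finset.in_set0.
  by apply/negP => /andP[/andP[/hJ[/negPf h1 _] _]]; rewrite h1.
have L0 := L_ge0 K.
apply: (@card_box _ K k j 0 (sigma ^+ 2) (lam K j (c a) - 2 * L)).
- by rewrite eq_sym.
- by move=> t; rewrite inX inX0 => /andP[/andP[/near_side_lam[]]].
- by move=> t; rewrite inX inX0 => /andP[/andP[/near_side_lam[_ ?]]]; rewrite add0r.
- exact: sqr_ge0.
- move=> t; rewrite inX inX0 [a \in _]finset.in_set => /andP[/andP[tn /andP[_ /asboolP[x ax xl]]] /eqP tj].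
  have [_ tX] := hJ _ tn; have [tK _] := near_side_lam tn.
  rewrite tj in xl.
  have := lam_osc j tK (centre_elt t) tX; have := lam_osc j aK (centre_elt a) ax.
  rewrite xl !ler_norml; lra.
- by rewrite mulr_ge0 // sqr_ge0.
Qed.

Definition on_boundary K (s : side Th) : bool :=
  inK K s.1 && [exists k, `[< side_set s `<=` side_set (K, k) >]].

(** 72 is 4 * 2 * 3 * 3: the square of a sum of four terms, two ends of a side, three sides of a
    fine element, three sides of [K]. *)
Definition c_bd : R :=
  72 * (1 + c_line * c_box + c_side * (c_ref + 1)).

Lemma c_box_gt0 : 0 < c_box.
Proof.
have s2 := sqr_ge0 sigma; apply: mulr_gt0; first by [].
by apply: mulr_gt0; lra.
Qed.

Lemma c_side_gt0 : 0 < c_side.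
Proof. by rewrite /c_side mulr_gt0 // ltr_wpDl // ?mulr_ge0 ?sqr_ge0 // ltW. Qed.

Lemma c_bd_gt0 : 0 < c_bd.
Proof.
have h1 : 0 < c_line * c_box by rewrite mulr_gt0 ?c_line_gt0 ?c_box_gt0.
have h2 : 0 < c_side * (c_ref + 1).
  by rewrite mulr_gt0 ?c_side_gt0 // ltr_wpDl // ltW // c_ref_gt0.
by rewrite /c_bd mulr_gt0 // !addr_gt0.
Qed.

Lemma sqr4_le (a b e f g : R) : a = b + e + f + g ->
  a ^+ 2 <= 4 * (b ^+ 2 + e ^+ 2 + f ^+ 2 + g ^+ 2).
Proof.
move=> ->; have := sqr_ge0 (b - e); have := sqr_ge0 (b - f); have := sqr_ge0 (b - g).
have := sqr_ge0 (e - f); have := sqr_ge0 (e - g); have := sqr_ge0 (f - g); nra.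
Qed.

(** The reference data depend on [q] but not on [u], so the three basis functions of [K] can be
    compared at one point [z]. The points [y k] transfer known boundary values to [z]. *)
Lemma poincare K q : (forall t, 0 <= q t) ->
  exists z tz (y : 'I_3 -> plane R) (ty : 'I_3 -> 'I_(nelt Th)),
  [/\ inK K tz, elt tz z,
   forall k, [/\ inK K (ty k), elt (ty k) (y k), side_set (K, k) (y k) & ~ is_vertex Th (y k)] &
   forall u, compat K u q ->
    (forall k, (ev u (ty k) (y k) - ev u tz z) ^+ 2 <= c_ref * mass K q) /\
    (forall c', \sum_(s | on_boundary K s)
        ((ev u s.1 (side_a s) - c') ^+ 2 + (ev u s.1 (side_b s) - c') ^+ 2) <=
      c_bd * ((H / h) * (mass K q + (ev u tz z - c') ^+ 2)))].
Proof.
move=> q0; have [r [z [tz [r1 gr tzK tzz hu]]]] := reference_point K q0.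
(* [y k] is the point where the reference line of direction [k + 1] meets the side [k]. *)
have yex k : exists yt : plane R * 'I_(nelt Th), [/\ inK K yt.2, elt yt.2 yt.1,
    side_set (K, k) yt.1 & lam K (k + 1) yt.1 = r (k + 1)].
  have [||||x [Kx x0 x1]] := @elt_point K k (k + 1) 0 (r (k + 1)).
  - by rewrite ord3F.
  - by [].
  - by have := r1 (k + 1); lra.
  - by have := r1 (k + 1); lra.
  have [t tK tx] := cover_elt Kx.
  by exists (x, t); split => //; apply/side_setP.
have [yt hyt] := choice yex.
exists z, tz, (fun k => (yt k).1), (fun k => (yt k).2); split => //.
  move=> k; have [h1 h2 h3 h4] := hyt k; split => //.
  exact: gr h4.
move=> u cu; split.
  move=> k; have [h1 h2 h3 h4] := hyt k.
  by apply: (hu u cu (k + 1)) => //; have [] := (side_setP ndH _ _).1 h3.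
move=> c'; set D := ev u tz z - c'.
have Q0 := mass_ge0 K q0; have n1 := ratio_ge1 K.
have dex k t : exists jx : 'I_3 * plane R, inK K t ->
   [/\ jx.1 != k, elt t jx.2, lam K jx.1 jx.2 <= 2^-1 & generic Th K jx.1 (lam K jx.1 jx.2)].
  case: (boolP (inK K t)) => tK; last by exists (0, 0).
  by have [jx hjx] := descent k tK; exists jx.
have side_bound k : \sum_(t in near_side K k) \sum_i
     ((ev u t (side_a (t, i)) - c') ^+ 2 + (ev u t (side_b (t, i)) - c') ^+ 2) <=
     24 * ((H / h) * ((1 + c_line * c_box + c_side * (c_ref + 1)) * (mass K q + D ^+ 2))).
  have [jx hjx] := choice (dex k).
  pose G t := \sum_(a in level K (jx t).1 (lam K (jx t).1 (jx t).2)) q a.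
  have [E hE] : exists E, E = c_ref * mass K q + D ^+ 2 by eexists.
  (* From [p] to the generic point of [t], along its line to the reference line of direction [k],
     and from there to [z]: an oscillation, a line bound, the reference bound and the offset [D]. *)
  have point t p : t \in near_side K k -> elt t p ->
      (ev u t p - c') ^+ 2 <=
      4 * (q t + c_line * ((H / h) * G t) + c_ref * mass K q + D ^+ 2).
    move=> tn tp; have [tK _] := near_side_lam tn.
    have [jk tx lx gx] := hjx t tK.
    have lx0 : 0 <= lam K (jx t).1 (jx t).2 by apply: (eltP ndH _ _).1; exact: inKP tK _ tx.
    have [|||y [Ky yj yk]] := @elt_point K (jx t).1 k (lam K (jx t).1 (jx t).2) (r k) jk.
    - by [].
    - by have := r1 k; lra.
    - by have := r1 k; lra.
    have [t' t'K t'y] := cover_elt Ky.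
    have b1 := le_trans (osc_sqr ndh u tp tx) (cu.1 t tK).
    have b2 := line_bound_ratio cu q0 gx (inKP tK tx) Ky erefl yj tK t'K tx t'y.
    have b3 := hu u cu k y t' Ky yk t'K t'y.
    have -> : ev u t p - c' = (ev u t p - ev u t (jx t).2) + (ev u t (jx t).2 - ev u t' y) +
      (ev u t' y - ev u tz z) + D by rewrite /D; ring.
    by apply: le_trans (sqr4_le erefl) _; rewrite ler_pM2l // !lerD.
  apply: (@le_trans _ _ (\sum_(t in near_side K k) 24 *
     (q t + c_line * (H / h) * G t + E))).
    apply: ler_sum => t tn; rewrite sum3.
    have P (i : 'I_3) : (ev u t (side_a (t, i)) - c') ^+ 2 + (ev u t (side_b (t, i)) - c') ^+ 2 <=
       8 * (q t + c_line * ((H / h) * G t) + c_ref * mass K q + D ^+ 2).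
      have := point t _ tn ((side_setP ndh _ _).1 (side_a_in ndh (t, i))).1.
      have := point t _ tn ((side_setP ndh _ _).1 (side_b_in ndh (t, i))).1.
      by rewrite /=; lra.
    by rewrite hE; have := P 0; have := P 1; have := P 2; lra.
  rewrite -mulr_sumr ler_pM2l // !big_split /= sumr_const -mulr_sumr.
  have s1 : \sum_(t in near_side K k) q t <= mass K q.
    rewrite /mass [leLHS]big_mkcond [leRHS]big_mkcond /=; apply: ler_sum => t _.
    case: ifPn => [/near_side_lam[-> _]//|_]; by case: ifP.
  have s2 : \sum_(t in near_side K k) G t <= c_box * mass K q.
    apply: (@sum_levels K k q (fun t => (jx t).1) (fun t => (jx t).2)) => // t tn.
    by have [tK _] := near_side_lam tn; have [] := hjx t tK.
  have s3 : E *+ #|near_side K k| <=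
     c_side * (H / h) * ((c_ref + 1) * (mass K q + D ^+ 2)).
    rewrite -mulr_natl; apply: ler_pM => //.
    - by rewrite hE addr_ge0 ?sqr_ge0 // mulr_ge0 // ltW // c_ref_gt0.
    - exact: card_near_side.
    - have := mulr_ge0 (ltW c_ref_gt0) (sqr_ge0 D); rewrite hE; lra.
  have s2' : c_line * (H / h) * \sum_(t in near_side K k) G t <=
     c_line * (H / h) * (c_box * (mass K q + D ^+ 2)).
    apply: ler_wpM2l; first by rewrite mulr_ge0 ?(ltW c_line_gt0) //; lra.
    apply: le_trans s2 _; rewrite ler_wpM2l ?(ltW c_box_gt0) // lerDl sqr_ge0 //.
  have s1' : \sum_(t in near_side K k) q t <= (H / h) * (mass K q + D ^+ 2).
    apply: le_trans s1 _; have := sqr_ge0 D; nra.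
  by move: s1' s2' s3; lra.
apply: (@le_trans _ _ (\sum_k \sum_(t in near_side K k) \sum_i
     ((ev u t (side_a (t, i)) - c') ^+ 2 + (ev u t (side_b (t, i)) - c') ^+ 2))).
  set F := fun s : side Th => (ev u s.1 (side_a s) - c') ^+ 2 + (ev u s.1 (side_b s) - c') ^+ 2.
  have F0 s : 0 <= F s by rewrite /F addr_ge0 ?sqr_ge0.
  rewrite (exchange_big_dep xpredT) //= big_mkcond /=.
  rewrite (eq_bigr (fun s => if on_boundary K (s.1, s.2) then F (s.1, s.2) else 0)); last first.
    by case.
  rewrite -(pair_bigA _ (fun t i => if on_boundary K (t, i) then F (t, i) else 0)) /=.
  apply: ler_sum => t _.
  have [[k tk]|nk] := pselect (exists k, t \in near_side K k).
    apply: (@le_trans _ _ (\sum_i F (t, i))).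
      by apply: ler_sum => i _; case: ifP.
    rewrite [leRHS](bigD1 k) //= -[leLHS]addr0 lerD // sumr_ge0 // => k' _.
    by rewrite sumr_ge0 // => i _; exact: (F0 (t, i)).
  rewrite big1 => [|i _]; first by rewrite sumr_ge0 // => k _; rewrite sumr_ge0 // => i _; exact: (F0 (t, i)).
  case: ifP => // /andP[/= tK /existsP[k hk]]; case: nk; exists k.
  by rewrite finset.in_set tK; apply/existsP; exists i.
have := side_bound 0; have := side_bound 1; have := side_bound 2.
rewrite (sum3 (fun k => \sum_(t in near_side K k) _)) /c_bd; lra.
Qed.

Lemma sqr_size_le_area t : h ^+ 2 <= sigma ^+ 2 * area t.
Proof.
have h0 := mesh_size_gt0 ndh t.
have := area_ge ndh (divr_gt0 h0 sig0) (hc (t := t)).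
by rewrite expr_div_n ler_pdivrMr ?exprn_gt0 // mulrC.
Qed.

Lemma area_gt0 t : 0 < area t.
Proof.
have h0 := mesh_size_gt0 ndh t.
apply: lt_le_trans (area_ge ndh (divr_gt0 h0 sig0) (hc (t := t))).
by rewrite exprn_gt0 // divr_gt0.
Qed.

Lemma energy_onE K al u v : energy_on (elt K) al u v =
  \sum_(t | inK K t) al t * dot (grad u t) (grad v t) * area t.
Proof. by apply: eq_bigr => t _; rewrite elt_energyE. Qed.

Definition indicator K : dgspace R Th := \matrix_(t, i) (inK K t && (i == 0))%:R.

Lemma ev_indicator K t x : ev (indicator K) t x = (inK K t)%:R.
Proof. by rewrite /ev !mxE andbT !andbF !mul0r !addr0. Qed.

Lemma ev_sum (I : finType) (F : I -> dgspace R Th) t x :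
  ev (\sum_i F i) t x = \sum_i ev (F i) t x.
Proof. by rewrite /ev !summxE !mulr_suml -!big_split. Qed.

Lemma ev_sub u v t x : ev (u - v) t x = ev u t x - ev v t x.
Proof. by rewrite /ev !mxE; ring. Qed.

Lemma Sh_compat K u q : Sh (elt K) u ->
  (forall t, inK K t -> h ^+ 2 * dot (grad u t) (grad u t) <= q t) ->
  (forall t, 0 <= q t) -> compat K u q.
Proof.
move=> [_ hcont] hq q0; split => // t k t' k' x tK t'K _ hs hx.
have [tx _] := (side_setP ndh _ _).1 hx.
have [t'x _] := (side_setP ndh _ _).1 (same_side_set ndh hs hx).
by rewrite (hcont t t' x) ?subrr ?expr0n //; apply/asboolP.
Qed.

Section Basis.
Variables (al : 'I_(nelt Th) -> R) (al0 : forall t, 0 < al t).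
Variables (psi : 'I_(nelt TH) -> 'I_3 -> plane R -> R) (phi : 'I_(nelt TH) -> 'I_3 -> dgspace R Th).
Hypotheses (hpsi : forall K, boundary_data Th K (psi K)) (hphi : multiscale_basis al psi phi).

Lemma side_in_boundary K k x : side_set (K, k) x -> elt_boundary K x.
Proof. by move=> hx; exists k. Qed.

(* The difference of the two sides lies in [S0h K] and is discretely harmonic,
   hence has zero energy; it then vanishes along generic lines reaching the
   boundary of [K]. *)
Lemma basis_partition K : \sum_p phi K p = indicator K.
Proof.
pose w := \sum_p phi K p - indicator K.
have ew t x : ev w t x = \sum_p ev (phi K p) t x - (inK K t)%:R.
  by rewrite ev_sub ev_sum ev_indicator.
have off t : ~ elt t `<=` elt K -> row t w = 0.
  move=> ht; have htK : inK K t = false by apply/negP => /asboolP.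
  apply/rowP => i; rewrite !mxE htK /= subr0 summxE big1 // => p _.
  have [[hoff _] _ _] := hphi K p.
  by have := congr1 (fun r : 'rV_3 => r 0 i) (hoff t ht); rewrite !mxE.
have wS : Sh (elt K) w.
  split => // t t' x tK t'K tx t'x; rewrite !ew.
  have -> : inK K t by apply/asboolP.
  have -> : inK K t' by apply/asboolP.
  by congr (_ - _); apply: eq_bigr => p _; have [[_ hcont] _ _] := hphi K p; exact: hcont.
have wb t x : inK K t -> elt t x -> elt_boundary K x -> ev w t x = 0.
  move=> tK tx hx; rewrite ew tK.
  under eq_bigr => p _.
    have [_ hb _] := hphi K p; rewrite (hb t x _ tx hx); last exact/asboolP.
    over.
  by have [_ _ _ _ [hs _]] := hpsi K; rewrite hs // subrr.
have wS0 : S0h K w by split => // t x /asboolP tK; exact: wb.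
(* Harmonicity is tested with [w] itself. The indicator has no gradient, so the gradients of the
   basis functions sum to that of [w]. *)
have e0 : \sum_(t | inK K t) al t * dot (grad w t) (grad w t) * area t = 0.
  have : \sum_p energy_on (elt K) al (phi K p) w = 0.
    by rewrite big1 // => p _; have [_ _ ->] := hphi K p.
  under eq_bigr do rewrite energy_onE.
  rewrite exchange_big /= => hs; rewrite -[RHS]hs; apply: eq_bigr => t tK.
  rewrite -mulr_suml -mulr_sumr; congr (_ * _ * _).
  have -> : grad w t = (\sum_p (grad (phi K p) t).1, \sum_p (grad (phi K p) t).2).
    by rewrite /grad /w !mxE !summxE !andbF !subr0.
  by rewrite /dot /= !mulr_suml -big_split.
have g0 t : inK K t -> dot (grad w t) (grad w t) = 0.
  move=> tK; move/eqP: e0; rewrite psumr_eq0 => [/allP/(_ t)|t' _]; last first.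
    by rewrite !mulr_ge0 ?dot_ge0 ?(ltW (al0 _)) ?(ltW (area_gt0 _)).
  rewrite mem_index_enum tK /= => /(_ isT); rewrite !mulf_eq0.
  by rewrite (gt_eqF (al0 t)) (gt_eqF (area_gt0 t)) orbF /= => /eqP.
have cw : compat K w (fun=> 0).
  by apply: Sh_compat => // t tK; rewrite g0 // mulr0.
apply/eqP; rewrite -subr_eq0; apply/eqP; rewrite -/w; apply/row_matrixP => t; rewrite row0.
case: (boolP (inK K t)) => tK; last by apply: off => /asboolP; apply/negP.
have [[j x] /= [_ tx _ gx]] := descent 0 tK.
have Kx := inKP tK tx.
(* The generic line is followed up to a point with a vanishing coordinate, hence on the boundary of
   [K], where [w] is zero. *)
have [||||y [Ky y1 y2]] := @elt_point K j (j + 1) (lam K j x) 0.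
- by rewrite ord3F.
- exact: (eltP ndH _ _).1.
- by [].
- by rewrite addr0; exact: lam_le1.
have [t' t'K t'y] := cover_elt Ky.
have y0 : ev w t' y = 0.
  apply: wb => //; apply: (@side_in_boundary _ (j + 1)); exact/(side_setP ndH).
have := line_bound_ratio cw (fun=> lexx 0) gx Kx Ky erefl y1 tK t'K tx t'y.
rewrite big1 // !mulr0 y0 subr0 => x0.
have {}x0 : ev w t x = 0 by apply/eqP; rewrite -sqrf_eq0 eq_le x0 sqr_ge0.
have [w1 w2] : w t 1 = 0 /\ w t 2 = 0.
  by have := g0 t tK; rewrite /dot /grad /=; split; nra.
apply/rowP => i; rewrite !mxE; move: x0; rewrite /ev w1 w2 !mul0r !addr0 => w0.
case: (ord3P i) => ->.
- by move: w0; rewrite /w !mxE.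
- by move: w1; rewrite /w !mxE.
- by move: w2; rewrite /w !mxE.
Qed.

(** 27 is 3 * 3 * 3: the square of a sum of three values, the bounds of these values, and three
    basis energies each at most [gamma]. *)
Definition c_gamma : R := 27 * c_ref * sigma ^+ 2.

Lemma gamma1_ge (K : 'I_(nelt TH)) : 1 <= c_gamma * Defs.gamma (fun=> 1) phi.
Proof.
pose q t := h ^+ 2 * \sum_p dot (grad (phi K p) t) (grad (phi K p) t).
have q0 t : 0 <= q t by rewrite mulr_ge0 ?sqr_ge0 // sumr_ge0 // => p _; exact: dot_ge0.
have cp p : compat K (phi K p) q.
  have [hS _ _] := hphi K p; apply: Sh_compat => // t _.
  rewrite ler_wpM2l ?sqr_ge0 // (bigD1 p) //= lerDl sumr_ge0 // => p' _; exact: dot_ge0.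
have [z [tz [y [ty [tzK tzz hy hu]]]]] := poincare K q0.
have bd p : (ev (phi K p) tz z) ^+ 2 <= c_ref * mass K q.
  have [tyK tyy ys _] := hy p; have := (hu _ (cp p)).1 p.
  have [_ hb _] := hphi K p; rewrite (hb _ _ _ tyy (side_in_boundary ys)); last exact/asboolP.
  by have [_ _ _ _ [_ ->]] := hpsi K; rewrite // sub0r sqrrN.
have s1 : ev (phi K 0) tz z + ev (phi K 1) tz z + ev (phi K 2) tz z = 1.
  by rewrite -(sum3 (fun p => ev (phi K p) tz z)) -ev_sum basis_partition ev_indicator tzK.
have m1 : 1 <= 9 * (c_ref * mass K q).
  have := bd 0; have := bd 1; have := bd 2; move: s1.
  set a := ev _ _ _; set b := ev _ _ _; set e := ev _ _ _ => s1 h1 h2 h3.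
  have := sqr_ge0 (a - b); have := sqr_ge0 (a - e); have := sqr_ge0 (b - e).
  have : (a + b + e) ^+ 2 = 1 by rewrite s1 expr1n.
  nra.
have m2 : mass K q <= sigma ^+ 2 * (3 * Defs.gamma (fun=> 1) phi).
  apply: (@le_trans _ _ (sigma ^+ 2 * \sum_p energy_on (elt K) (fun=> 1) (phi K p) (phi K p))).
    under [X in _ * X]eq_bigr do rewrite energy_onE.
    rewrite exchange_big /mass /= mulr_sumr; apply: ler_sum => t _.
    rewrite -mulr_suml mulrA [_ * _ * area t]mulrAC.
    under [X in _ <= _ * X]eq_bigr do rewrite mul1r.
    by apply: ler_wpM2r; [rewrite sumr_ge0 // => p _; exact: dot_ge0|exact: sqr_size_le_area].
  rewrite ler_wpM2l ?sqr_ge0 //.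
  have e p : energy_on (elt K) (fun=> 1) (phi K p) (phi K p) <= Defs.gamma (fun=> 1) phi.
    apply: (@le_trans _ _ (\big[Num.max/0]_(p < 3) energy_on (elt K) (fun=> 1) (phi K p) (phi K p))).
      exact: (@le_bigmax _ _ _ 0 (fun p => energy_on (elt K) (fun=> 1) (phi K p) (phi K p))).
    exact: (@le_bigmax _ _ _ 0 (fun K => \big[Num.max/0]_(p < 3) energy_on (elt K) (fun=> 1) (phi K p) (phi K p))).
  rewrite sum3; have := e 0; have := e 1; have := e 2; lra.
have r0 := c_ref_gt0.
have : 9 * (c_ref * mass K q) <= 9 * (c_ref * (sigma ^+ 2 * (3 * Defs.gamma (fun=> 1) phi))).
  by rewrite ler_pM2l // ler_pM2l.
rewrite /c_gamma; lra.
Qed.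

End Basis.

Definition jumpsq u (s : side Th) : R := jmp u s (side_a s) ^+ 2 + jmp u s (side_b s) ^+ 2.

(** The jumps include boundary traces, through which [u] is controlled on coarse elements touching
    the domain boundary. *)
Definition local_mass u t : R :=
  h ^+ 2 * dot (grad u t) (grad u t) + \sum_k jumpsq u (t, k).

Lemma jumpsq_ge0 u s : 0 <= jumpsq u s.
Proof. by rewrite addr_ge0 ?sqr_ge0. Qed.

Lemma local_mass_ge0 u t : 0 <= local_mass u t.
Proof.
apply: addr_ge0; first by apply: mulr_ge0; [exact: sqr_ge0|exact: dot_ge0].
by apply: sumr_ge0 => k _; exact: jumpsq_ge0.
Qed.

Lemma jumpsq_le_mass u t k : jumpsq u (t, k) <= local_mass u t.
Proof.
rewrite /local_mass (bigD1 k) //= addrCA lerDl; apply: addr_ge0.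
  by apply: mulr_ge0; [exact: sqr_ge0|exact: dot_ge0].
by apply: sumr_ge0 => k' _; exact: jumpsq_ge0.
Qed.

Lemma jmp_le u s x : side_set s x -> jmp u s x ^+ 2 <= jumpsq u s.
Proof.
move=> /(side_seg ndh)[r /andP[r0 r1] ->]; rewrite (affine_segment _ _ _ (jmp_affine u s)) /jumpsq.
set a := jmp u s _; set b := jmp u s _.
have h1 : 0 <= r * (1 - r) * (a - b) ^+ 2 
  by apply: mulr_ge0 (sqr_ge0 _); apply: mulr_ge0; lra.
have h2 : 0 <= r * a ^+ 2 by apply: mulr_ge0 (sqr_ge0 _).
have h3 : 0 <= (1 - r) * b ^+ 2 by apply: mulr_ge0 (sqr_ge0 _); lra.
nra.
Qed.

Lemma local_mass_compat K u : compat K u (local_mass u).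
Proof.
split => [t tK|t k t' k' x tK t'K tt' hs hx].
  by rewrite lerDl sumr_ge0 // => k _; exact: jumpsq_ge0.
apply: le_trans (jumpsq_le_mass u t k).
have hn : nb (t, k) = Some (t', k') by apply/(nbP ndh cfh); rewrite eq_sym.
by apply: le_trans (jmp_le u hx); rewrite /jmp hn.
Qed.

Definition c_trace : R := c_bd * (1 + 2 * (c_ref + 1)).

Lemma c_trace_gt0 : 0 < c_trace.
Proof.
rewrite /c_trace mulr_gt0 ?c_bd_gt0 // addr_gt0 // mulr_gt0 // addr_gt0 //; exact: c_ref_gt0.
Qed.

(** Without a boundary side the constant is the reference value. With one, the coarse side
    containing it lies on the domain boundary, the point [y k] there carries a boundary trace of
    [u], and so the reference value is itself bounded by the local mass and 0 is admissible. *)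
Lemma coarse_constant K u : exists c',
  (forall s : side Th, inK K s.1 -> nb s = None -> c' = 0) /\
  \sum_(s | on_boundary K s)
     ((ev u s.1 (side_a s) - c') ^+ 2 + (ev u s.1 (side_b s) - c') ^+ 2)
   <= c_trace * ((H / h) * mass K (local_mass u)).
Proof.
have q0 := local_mass_ge0 u; have n1 := ratio_ge1 K; have r0 := c_ref_gt0.
have M0 := mass_ge0 K q0.
have [z [tz [y [ty [tzK tzz hy hu]]]]] := poincare K q0.
have [hu1 hu2] := hu u (local_mass_compat K u).
have fin c' : (ev u tz z - c') ^+ 2 <= 2 * (c_ref + 1) * mass K (local_mass u) ->
   \sum_(s | on_boundary K s)
     ((ev u s.1 (side_a s) - c') ^+ 2 + (ev u s.1 (side_b s) - c') ^+ 2)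
   <= c_trace * ((H / h) * mass K (local_mass u)).
  move=> hc'; apply: le_trans (hu2 c') _; rewrite /c_trace -[leRHS]mulrA.
  rewrite ler_wpM2l ?(ltW c_bd_gt0) // mulrCA ler_wpM2l //; first lra.
  by rewrite mulrDl mul1r lerD2l.
have [[s [sK sn]]|nbd] := pselect (exists s : side Th, inK K s.1 /\ nb s = None); last first.
  exists (ev u tz z); split => [s sK sn|]; first by case: nbd; exists s.
  by apply: fin; rewrite subrr expr0n /= !mulr_ge0 // addr_ge0 // ltW.
exists 0; split => //; apply: fin; rewrite subr0.
have [|k sk] := coarse_side sK; first by rewrite sn.
have [tK tyy yk nv] := hy k.
have [i [ni si]] := boundary_coarse_side sK sn sk yk tK tyy nv.
have b1 : ev u (ty k) (y k) ^+ 2 <= mass K (local_mass u).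
  have := jmp_le u si; rewrite /jmp ni subr0 => hj.
  apply: le_trans hj _; apply: le_trans (jumpsq_le_mass u (ty k) i) _.
  by rewrite /mass (bigD1 (ty k)) //= lerDl sumr_ge0.
have := hu1 k; have := sqr_ge0 (2 * ev u (ty k) (y k) - ev u tz z); nra.
Qed.

Lemma sum_mass (q : 'I_(nelt Th) -> R) : (forall t, 0 <= q t) ->
  \sum_(K : 'I_(nelt TH)) mass K q <= \sum_t q t.
Proof.
move=> q0; rewrite /mass (exchange_big_dep xpredT) //=; apply: ler_sum => t _.
have [K tK] := hsub t; have {}tK : inK K t by apply/asboolP.
rewrite (big_pred1 K) // => K'; apply/idP/eqP => [tK'|-> //].
exact: (inK_uniq ndh ndH cfH tK' tK).
Qed.

End Poincare.

(** * Boundedness and definiteness of the forms *)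

Section Forms.
Variables (R : realType) (m : mesh R) (nd : Defs.nondegenerate m) (cf : conforming m).
Implicit Types (t : 'I_(nelt m)) (s : side m) (x : plane R) (e : edge m).
Implicit Types (u v w : dgspace R m) (al : 'I_(nelt m) -> R).

Lemma evZ (k : R) u v t x : ev (k *: u + v) t x = k * ev u t x + ev v t x.
Proof. by rewrite /ev !mxE; ring. Qed.

Lemma jmpZ (k : R) u v s x : jmp (k *: u + v) s x = k * jmp u s x + jmp v s x.
Proof. by rewrite /jmp; case: (nb s) => [s'|]; rewrite !evZ; ring. Qed.

Lemma dot_gradZ (k : R) u v w t :
  dot (grad (k *: u + v) t) (grad w t) = k * dot (grad u t) (grad w t) + dot (grad v t) (grad w t).
Proof. by rewrite /dot /grad /= !mxE; ring. Qed.

Lemma avg_fluxZ al (k : R) u v e x : dot (avg_flux al (k *: u + v) e) x =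
  k * dot (avg_flux al u e) x + dot (avg_flux al v e) x.
Proof. by rewrite /avg_flux /dot /grad; case: e.2 => [s'|] /=; rewrite !mxE; ring. Qed.

Lemma energyZ al (k : R) u v w : \sum_t elt_energy al (k *: u + v) w t =
  k * \sum_t elt_energy al u w t + \sum_t elt_energy al v w t.
Proof.
rewrite mulr_sumr -big_split; apply: eq_bigr => t _.
by rewrite !elt_energyE // dot_gradZ /=; ring.
Qed.

Lemma jump_formZ al (k : R) u v w :
  jump_form al (k *: u + v) w = k * jump_form al u w + jump_form al v w.
Proof.
rewrite !jump_formE // mulr_sumr -big_split; apply: eq_bigr => e _.
by rewrite !jmpZ /=; ring.
Qed.

Lemma flux_formZl al (k : R) u v w :
  flux_form al (k *: u + v) w = k * flux_form al u w + flux_form al v w.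
Proof.
rewrite !flux_formE // mulr_sumr -big_split; apply: eq_bigr => e _.
by rewrite avg_fluxZ /=; ring.
Qed.

Lemma flux_formZr al (k : R) u v w :
  flux_form al w (k *: u + v) = k * flux_form al w u + flux_form al w v.
Proof.
rewrite !flux_formE // mulr_sumr -big_split; apply: eq_bigr => e _.
by rewrite !jmpZ /=; ring.
Qed.

Lemma a_h_linear al eta (k : R) u v w :
  a_h al eta (k *: u + v) w = k * a_h al eta u w + a_h al eta v w.
Proof. by rewrite /a_h energyZ jump_formZ flux_formZl flux_formZr; ring. Qed.

Lemma a_h_sym al eta u v : a_h al eta u v = a_h al eta v u.
Proof.
rewrite /a_h; have -> : \sum_t elt_energy al u v t = \sum_t elt_energy al v u t.
  by apply: eq_bigr => t _; rewrite !elt_energyE // dotC.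
have -> : jump_form al u v = jump_form al v u.
  by rewrite !jump_formE //; apply: eq_bigr => e _; ring.
ring.
Qed.

Definition energy al u : R := \sum_t elt_energy al u u t.

Lemma energyE al u : energy al u = \sum_t al t * dot (grad u t) (grad u t) * area t.
Proof. by apply: eq_bigr => t _; rewrite elt_energyE. Qed.

Lemma dgnorm2E al u : dgnorm2 al u = energy al u + jump_form al u u.
Proof. by []. Qed.

(** Three times the integral of the squared affine jump over [0, 1]. The two bounds below are the
    extreme eigenvalues 1/2 and 3/2 of this quadratic form. *)
Definition jq u s : R := jmp u s (side_a s) ^+ 2 + jmp u s (side_a s) * jmp u s (side_b s)
  + jmp u s (side_b s) ^+ 2.

Lemma jump_form_diag al u : jump_form al u u =
  \sum_(e | is_edge e) edge_weight al e * (jq u e.1 / 3).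
Proof.
rewrite jump_formE //; apply: eq_bigr => e _; congr (_ * _).
by rewrite /jq; field.
Qed.

Lemma jq_ge u s : jmp u s (side_a s) ^+ 2 + jmp u s (side_b s) ^+ 2 <= 2 * jq u s.
Proof. rewrite /jq; have := sqr_ge0 (jmp u s (side_a s) + jmp u s (side_b s)); nra. Qed.

Lemma jq_le u s : jq u s <= 3 / 2 * (jmp u s (side_a s) ^+ 2 + jmp u s (side_b s) ^+ 2).
Proof. rewrite /jq; have := sqr_ge0 (jmp u s (side_a s) - jmp u s (side_b s)); nra. Qed.

Section Positive.
Variables (al : 'I_(nelt m) -> R) (al0 : forall t, 0 < al t).
Variables (sigma : R) (c : 'I_(nelt m) -> plane R) (sig0 : 0 < sigma).
Hypothesis hc : forall t, [set x | enorm (x - c t) <= mesh_size m / sigma] `<=` elt t.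

Lemma edge_weightE e : edge_weight al e =
  if e.2 is Some s' then 2 * al e.1.1 * al s'.1 / (al e.1.1 + al s'.1) else al e.1.1.
Proof.
rewrite /edge_weight /wplus; case: e.2 => [s'|] //=.
have h1 := al0 e.1.1; have h2 := al0 s'.1; field.
by rewrite !lt0r_neq0 // addr_gt0.
Qed.

Lemma edge_weight_gt0 e : 0 < edge_weight al e.
Proof. by rewrite edge_weightE; case: e.2 => [s'|] //; rewrite divr_gt0 ?mulr_gt0 ?addr_gt0. Qed.

(** A harmonic mean is at most twice either coefficient, which keeps the flux bound free of the
    contrast. *)
Lemma edge_weight_le e : edge_weight al e <= 2 * al e.1.1.
Proof.
rewrite edge_weightE; have h1 := al0 e.1.1; case: e.2 => [s'|]; last lra.
have h2 := al0 s'.1; rewrite ler_pdivrMr ?addr_gt0 //; nra.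
Qed.

Lemma edge_weight_le' e s' : e.2 = Some s' -> edge_weight al e <= 2 * al s'.1.
Proof.
rewrite edge_weightE => ->; have h1 := al0 e.1.1.
have h2 := al0 s'.1; rewrite ler_pdivrMr ?addr_gt0 //; nra.
Qed.

Lemma edge_weight_ge (a : R) e : 0 <= a -> (forall t, a <= al t) -> a <= edge_weight al e.
Proof.
move=> a0 ha; rewrite edge_weightE; case: e.2 => [s'|] //.
have h1 := al0 e.1.1; have h2 := al0 s'.1; have h3 := ha e.1.1; have h4 := ha s'.1.
rewrite ler_pdivlMr ?addr_gt0 //; nra.
Qed.

Lemma energy_ge0 u : 0 <= energy al u.
Proof.
rewrite energyE; apply: sumr_ge0 => t _; rewrite !mulr_ge0 ?dot_ge0 ?(ltW (al0 t)) //.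
by rewrite fine_ge0 // measure_ge0.
Qed.

Lemma jq_ge0 u s : 0 <= jq u s.
Proof.
have := jq_ge u s; have := sqr_ge0 (jmp u s (side_a s)); have := sqr_ge0 (jmp u s (side_b s)); lra.
Qed.

Lemma jump_form_ge0 u : 0 <= jump_form al u u.
Proof.
rewrite jump_form_diag; apply: sumr_ge0 => e _.
by rewrite mulr_ge0 ?(ltW (edge_weight_gt0 e)) // divr_ge0 // jq_ge0.
Qed.

Lemma len2_le s : side_len s ^+ 2 <= sigma ^+ 2 * area s.1.
Proof.
have h0 := mesh_size_gt0 nd s.1.
apply: (@le_trans _ _ (mesh_size m ^+ 2)).
  by rewrite ler_pXn2r ?nnegrE ?side_len_le // ltW // side_len_gt0.
have := area_ge nd (divr_gt0 h0 sig0) (hc (t := s.1)).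
by rewrite expr_div_n ler_pdivrMr ?exprn_gt0 // mulrC.
Qed.

Lemma dot_normal_sqr_le x s : dot x (normal s) ^+ 2 <= dot x x.
Proof. by have := dot_CS x (normal s); rewrite dot_normal // mulr1. Qed.

Definition c_flux : R := 3 * sigma ^+ 2 + 2.

(* Inverse inequality: the flux is constant on elements of area comparable to the
   squared length of their sides. *)
Lemma flux_form_le u v : `|flux_form al u v| <= c_flux * (energy al u + jump_form al v v).
Proof.
pose g s := al s.1 * dot (grad u s.1) (grad u s.1) * area s.1.
have sg : \sum_s g s = 3 * energy al u.
  rewrite energyE mulr_sumr.
  rewrite (eq_bigr (fun s => al s.1 * dot (grad u s.1) (grad u s.1) * area s.1)) //.
  rewrite -(pair_bigA _ (fun t (_ : 'I_3) => al t * dot (grad u t) (grad u t) * area t)) /=.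
  by apply: eq_bigr => t _; rewrite sumr_const card_ord mulr_natl.
apply: (@le_trans _ _ (\sum_(e | is_edge e) (sigma ^+ 2 *
   (if e.2 is Some s' then g e.1 + g s' else g e.1) + 2 * (edge_weight al e * (jq v e.1 / 3))))); last first.
  rewrite big_split /= -!mulr_sumr -sum_side // sg -jump_form_diag /c_flux.
  have := energy_ge0 u; have := jump_form_ge0 v; have := sqr_ge0 sigma; nra.
rewrite flux_formE //; apply: le_trans (ler_norm_sum _ _ _) _; apply: ler_sum => e he.
have W0 := edge_weight_gt0 e.
have L0 : 0 < edge_len e by exact: side_len_gt0.
have hq := jq_ge v e.1.
set ja := jmp v e.1 (side_a e.1) in hq *; set jb := jmp v e.1 (side_b e.1) in hq *.
(* The inverse inequality for one element adjacent to the edge. *)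
have one s : forall (W : R), 0 < W -> W <= 2 * al s.1 ->  edge_len e ^+ 2 <= sigma ^+ 2 * area s.1 ->
    W * (edge_len e * dot (grad u s.1) (normal e.1)) ^+ 2 <= 2 * sigma ^+ 2 * g s.
  move=> W W1 W2 hl; rewrite exprMn.
  have d1 := dot_normal_sqr_le (grad u s.1) e.1.
  have -> : 2 * sigma ^+ 2 * g s = 2 * al s.1 * (sigma ^+ 2 * area s.1 * dot (grad u s.1) (grad u s.1)).
    by rewrite /g; ring.
  apply: ler_pM => //; first exact: ltW.
    by apply: mulr_ge0; exact: sqr_ge0.
  by apply: ler_pM => //; exact: sqr_ge0.
have young (W p : R) : 0 < W ->
    `|W / 2 * p * (ja + jb) / 2| <= W * p ^+ 2 / 4 + W * (jq v e.1 / 3) * (3 / 4).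
  move=> W1; rewrite ler_norml.
  have h1 := sqr_ge0 (p - (ja + jb) / 2); have h2 := sqr_ge0 (p + (ja + jb) / 2).
  have h3 : (ja + jb) ^+ 2 <= 2 * (ja ^+ 2 + jb ^+ 2) by have := sqr_ge0 (ja - jb); nra.
  have k1 : 0 <= W * (p ^+ 2 + (ja + jb) ^+ 2 / 4 - p * (ja + jb)).
    by rewrite mulr_ge0 ?(ltW W1) //; lra.
  have k2 : 0 <= W * (p ^+ 2 + (ja + jb) ^+ 2 / 4 + p * (ja + jb)).
    by rewrite mulr_ge0 ?(ltW W1) //; lra.
  have k3 : W * (ja + jb) ^+ 2 <= W * (2 * (2 * jq v e.1)).
    by rewrite ler_wpM2l ?(ltW W1) //; lra.
  by apply/andP; split; lra.
have l1 : edge_len e ^+ 2 <= sigma ^+ 2 * area e.1.1 by exact: len2_le.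
move: he; rewrite is_edgeE // => /andP[/eqP hn _].
have W1 := edge_weight_le e; have We := edge_weightE e; have W2 := @edge_weight_le' e.
set W := edge_weight al e in W0 W1 We W2 *.
have o1 := one e.1 W W0 W1 l1.
have Q0 : 0 <= W * (jq v e.1 / 3) by rewrite mulr_ge0 ?(ltW W0) // divr_ge0 // jq_ge0.
have combine (P1 P2 G1 G2 Q : R) : 0 <= Q -> 0 <= P1 -> 0 <= P2 -> P1 <= 2 * sigma ^+ 2 * G1 ->
    P2 <= 2 * sigma ^+ 2 * G2 ->
    P1 / 4 + Q * (3 / 4) + (P2 / 4 + Q * (3 / 4)) <= sigma ^+ 2 * (G1 + G2) + 2 * Q by lra.
have WP (P : R) : 0 <= W * P ^+ 2 by rewrite mulr_ge0 ?sqr_ge0 ?(ltW W0).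
rewrite /avg_flux; case: e.2 hn We W2 => [s'|] hn We W2.
  have /nbP[] // := hn => n hs.
  have l2 : edge_len e ^+ 2 <= sigma ^+ 2 * area s'.1.
    rewrite (_ : edge_len e = side_len s'); first exact: len2_le.
    rewrite /edge_len /side_len; case: (same_side_ab hs) => -[-> ->] //.
    by rewrite /enorm -dot_oppl opprB.
  have o2 := one s' W W0 (W2 _ erefl) l2.
  have y1 := young W (edge_len e * dot (grad u e.1.1) (normal e.1)) W0.
  have y2 := young W (edge_len e * dot (grad u s'.1) (normal e.1)) W0.
  (* On either side the averaging weight times the coefficient equals [W / 2]. *)
  rewrite [X in `|X|](_ : _ =
      W / 2 * (edge_len e * dot (grad u e.1.1) (normal e.1)) * (ja + jb) / 2 +
      W / 2 * (edge_len e * dot (grad u s'.1) (normal e.1)) * (ja + jb) / 2); last first.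
    have h1 := al0 e.1.1; have h2 := al0 s'.1; move: (normal e.1) (edge_len e) => nn ll.
    rewrite We /wplus /dot /=.
    by field; rewrite !lt0r_neq0 // addr_gt0.
  apply: le_trans (ler_normD _ _) _; apply: le_trans (lerD y1 y2) _.
  exact: combine Q0 (WP _) (WP _) o1 o2.
have y1 := young W (edge_len e * dot (grad u e.1.1) (normal e.1)) W0.
(* A boundary flux is written as two equal halves, in the form of the interior case. *)
rewrite [X in `|X|](_ : _ = W / 2 * (edge_len e * dot (grad u e.1.1) (normal e.1)) * (ja + jb) / 2 +
      W / 2 * (edge_len e * dot (grad u e.1.1) (normal e.1)) * (ja + jb) / 2); last first.
  by move: (normal e.1) (edge_len e) => nn ll; rewrite We /dot /=; field.
apply: le_trans (ler_normD _ _) _; apply: le_trans (lerD y1 y1) _.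
have := WP (edge_len e * dot (grad u e.1.1) (normal e.1)).
set P := W * (_ * _) ^+ 2 in o1 *; set Q := W * (_ / _) in Q0 *; lra.
Qed.

(* Shoelace formula: the signed areas swept by the sides of an element add up to
   its area, and the two sides of an interior edge sweep opposite areas. *)
Definition swept s : R := Num.sg (area2 (vert s.1)) *
  ((side_a s).1 * (side_b s).2 - (side_a s).2 * (side_b s).1).

Lemma sum_swept t : \sum_k swept (t, k) = `|area2 (vert t)|.
Proof.
rewrite normrEsg /swept /= -mulr_sumr; congr (_ * _).
by rewrite sum3 /side_a /side_b /= !ord3E /area2 /orient; ring.
Qed.

Lemma swept_nb s s' : nb s = Some s' -> swept s' = - swept s.
Proof.
move=> /(nbP nd cf)[n hs]; rewrite eq_sym in n.
have := opposite_sides nd cf n hs; rewrite /lam /bary -/(side_a s') -/(side_b s').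
have := orient_cyc (vert s.1) s.2; rewrite -/(side_a s) -/(side_b s) => eo.
have a0 := area2_neq0 nd s'.1; have a1 := area2_neq0 nd s.1.
have key (a b : R) : a != 0 -> a / b < 0 -> Num.sg b = - Num.sg a.
  move=> an ab; have := ltr0_sg ab; rewrite sgrM sgrV => hh.
  have := sqr_sg a; rewrite an /= expr2 => h2.
  have : Num.sg a * (Num.sg a * Num.sg b) = Num.sg b by rewrite mulrA h2 mul1r.
  by rewrite hh mulrN1 => ->.
rewrite /swept; case: (same_side_ab hs) => -[ea eb]; rewrite -ea -eb.
- by rewrite eo => /(key _ _ a1) ->; ring.
- have -> : orient (vert s.1 s.2) (side_b s) (side_a s) = - area2 (vert s.1).
    by rewrite -eo /orient; ring.
  by move=> /key; rewrite oppr_eq0 sgrN opprK => /(_ a1) ->; ring.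
Qed.

(** Zero energy makes [u] constant on each element, and zero jumps match these constants. The sum of
    their squares times the areas, rewritten with swept areas as a sum over sides, cancels on
    interior edges and vanishes on boundary ones; this replaces a walk through the mesh to the
    boundary. *)
Lemma dgnorm2_eq0 u : dgnorm2 al u <= 0 -> u = 0.
Proof.
rewrite dgnorm2E => h0.
have E0 : energy al u = 0 by have := energy_ge0 u; have := jump_form_ge0 u; lra.
have J0 : jump_form al u u = 0 by have := energy_ge0 u; have := jump_form_ge0 u; lra.
have ar t : 0 < area t.
  have hs := mesh_size_gt0 nd t.
  apply: lt_le_trans (area_ge nd (divr_gt0 hs sig0) (hc (t := t))).
  by rewrite exprn_gt0 // divr_gt0.
have g0 t : dot (grad u t) (grad u t) = 0.
  move/eqP: E0; rewrite energyE psumr_eq0 => [/allP/(_ t)|t' _]; last first.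
    by rewrite !mulr_ge0 ?dot_ge0 ?(ltW (al0 _)) ?(ltW (ar _)).
  rewrite mem_index_enum /= => /(_ isT); rewrite !mulf_eq0.
  by rewrite (gt_eqF (al0 t)) (gt_eqF (ar t)) orbF /= => /eqP.
have gr t : u t 1 = 0 /\ u t 2 = 0.
  by have := g0 t; rewrite /dot /grad /=; split; nra.
have ec t x : ev u t x = u t 0 by rewrite /ev (gr t).1 (gr t).2 !mul0r !addr0.
have j0 e : is_edge e -> jmp u e.1 (side_a e.1) = 0.
  move=> he; move/eqP: J0; rewrite jump_form_diag psumr_eq0 => [/allP/(_ e)|e' _]; last first.
    by rewrite mulr_ge0 ?(ltW (edge_weight_gt0 _)) // divr_ge0 // jq_ge0.
  rewrite mem_index_enum he /= => /(_ isT); rewrite mulf_eq0 (gt_eqF (edge_weight_gt0 e)) /=.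
  move=> /eqP q0; have := jq_ge u e.1.
  have := sqr_ge0 (jmp u e.1 (side_a e.1)); have := sqr_ge0 (jmp u e.1 (side_b e.1)); nra.
have : \sum_t u t 0 ^+ 2 * `|area2 (vert t)| = 0.
  transitivity (\sum_s u s.1 0 ^+ 2 * swept s).
    rewrite [RHS](eq_bigr (fun s => u s.1 0 ^+ 2 * swept (s.1, s.2))); last by case.
    rewrite -(pair_bigA _ (fun t k => u t 0 ^+ 2 * swept (t, k))) /=.
    by apply: eq_bigr => t _; rewrite -mulr_sumr sum_swept.
  rewrite (sum_side nd cf) big1 // => e he; have := j0 e he.
  move: he; rewrite (is_edgeE nd cf) => /andP[/eqP hn _]; rewrite /jmp hn.
  case: e.2 hn => [s'|] hn; rewrite !ec.
    by rewrite (swept_nb hn) => /subr0_eq ->; ring.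
  by rewrite subr0 => ->; rewrite expr0n mul0r.
move/eqP; rewrite psumr_eq0 => [/allP hz|t _]; last by rewrite mulr_ge0 ?sqr_ge0.
apply/matrixP => t i; rewrite mxE; case: (ord3P i) => ->; [|exact: (gr t).1|exact: (gr t).2].
have := hz t; rewrite mem_index_enum => /(_ isT)/implyP/(_ isT).
by rewrite mulf_eq0 sqrf_eq0 normr_eq0 (negPf (area2_neq0 nd t)) orbF => /eqP.
Qed.

End Positive.
End Forms.

(** * The abstract additive Schwarz bound *)

Section RealEigenvalue.
Import complex polyrcf passmx.
Variables (R : realType) (V : vectType R) (a : V -> V -> R).
Hypotheses (aL : forall (k : R) u v w, a (k *: u + v) w = k * a u w + a v w)
  (aS : forall u v, a u v = a v u).
Hypothesis (aP : forall u, u != 0 -> 0 < a u u).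
Implicit Types (T P : 'End(V)) (u v w : V).

Lemma leigenvalueP T mu : passmx.leigenvalue T mu <-> exists2 v, v != 0 & T v = mu *: v.
Proof.
rewrite /passmx.leigenvalue /passmx.leigenspace; split => [h|[v v0 hv]].
  exists (vpick (lker (T - mu *: \1%VF))); first by rewrite vpick0.
  have := memv_pick (lker (T - mu *: \1%VF)).
  by rewrite memv_ker !lfunE /= lfunE /= lfunE /= lfunE /= subr_eq0 => /eqP.
apply/negP => /eqP h0; have : v \in lker (T - mu *: \1%VF).
  by rewrite memv_ker !lfunE /= lfunE /= lfunE /= lfunE /= hv subrr.
by rewrite h0 memv0 (negPf v0).
Qed.

Let n := \dim {:V}.
Let e : n.-tuple V := vbasis {:V}.
Let e_basis : basis_of {:V} e := vbasisP _.

Lemma leigenvalue_char T mu :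
  passmx.leigenvalue T mu = root (char_poly (passmx.mxof e e T)) mu.
Proof.
rewrite -eigenvalue_root_char /passmx.leigenvalue (passmx.leigenspaceE e_basis).
by rewrite (passmx.vsof_eq0 e_basis).
Qed.

Local Notation C := (complex.complex R).
Local Notation rc := (complex.real_complex R).

Lemma complex_ReD (x y : C) : complex.Re (x + y) = complex.Re x + complex.Re y.
Proof. by case: x; case: y. Qed.
Lemma complex_ImD (x y : C) : complex.Im (x + y) = complex.Im x + complex.Im y.
Proof. by case: x; case: y. Qed.

Lemma complex_ReM (x y : C) :
  complex.Re (x * y) = complex.Re x * complex.Re y - complex.Im x * complex.Im y.
Proof. by case: x; case: y. Qed.
Lemma complex_ImM (x y : C) :
  complex.Im (x * y) = complex.Im x * complex.Re y + complex.Re x * complex.Im y.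
Proof. by case: x => ? ?; case: y => ? ? /=; rewrite addrC. Qed.

Lemma exists_max_seq (s : seq R) : s != [::] ->
  exists2 x, x \in s & forall y, y \in s -> y <= x.
Proof.
elim: s => // x [|z s] IH _.
  by exists x; rewrite ?mem_head // => y; rewrite inE => /eqP ->.
have [//|w ws hw] := IH.
have [h|h] := leP x w.
  exists w; first by rewrite in_cons ws orbT.
  by move=> y; rewrite in_cons => /predU1P[->//|/hw].
exists x; first exact: mem_head.
by move=> y; rewrite in_cons => /predU1P[->//|/hw yw]; apply: le_trans yw (ltW h).
Qed.

(* A complex eigenvalue [p + q i] of a self-adjoint map, with eigenvector
   [x + y i], satisfies [q (a x x + a y y) = 0]. *)
Lemma selfadjoint_eigenvalue T : (exists v : V, v != 0) ->
  (forall u v, a (T u) v = a u (T v)) -> exists mu, passmx.leigenvalue T mu.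
Proof.
move=> [v0 v0n] adj; pose A := passmx.mxof e e T.
have n0 : (0 < n)%N by rewrite lt0n dimv_eq0; apply/negP => /eqP h; have := memvf v0; rewrite h memv0 (negPf v0n).
pose AC : 'M[C]_n := map_mx rc A.
(* A complex eigenvalue exists by algebraic closedness; the real and imaginary parts of its
   eigenvector are then followed separately. *)
have [z hz] : exists z, root (char_poly AC) z.
  by apply/closed_rootP; rewrite size_char_poly; case: (n) n0.
move: hz; rewrite -eigenvalue_root_char => /eigenvalueP[w hw wn].
pose p := complex.Re z; pose q := complex.Im z.
pose x : 'rV[R]_n := map_mx (@complex.Re R) w.
pose y : 'rV[R]_n := map_mx (@complex.Im R) w.
have ex : x *m A = p *: x - q *: y.
  apply/rowP => j; have := congr1 (fun M : 'rV[C]_n => complex.Re (M 0 j)) hw.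
  rewrite !mxE (big_morph _ complex_ReD (erefl : complex.Re 0 = 0)).
  rewrite complex_ReM -/p -/q.
  move=> <-; apply: eq_bigr => i _; rewrite !mxE.
  by case: (w 0 i) => ? ? /=; rewrite mulr0 subr0.
have ey : y *m A = q *: x + p *: y.
  apply/rowP => j; have := congr1 (fun M : 'rV[C]_n => complex.Im (M 0 j)) hw.
  rewrite !mxE (big_morph _ complex_ImD (erefl : complex.Im 0 = 0)).
  rewrite complex_ImM -/p -/q.
  move=> <-; apply: eq_bigr => i _; rewrite !mxE.
  by case: (w 0 i) => ? ? /=; rewrite mulr0 add0r.
pose X := passmx.vecof e x; pose Y := passmx.vecof e y.
have TX : T X = p *: X - q *: Y.
  by rewrite /X (passmx.hom_vecof _ e_basis) -/A ex linearB !linearZ.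
have TY : T Y = q *: X + p *: Y.
  by rewrite /Y (passmx.hom_vecof _ e_basis) -/A ey linearD !linearZ.
have xy : (X != 0) || (Y != 0).
  rewrite -negb_and; apply: contra wn => /andP[].
  rewrite !(passmx.vecof_eq0 e_basis) => /eqP x0 /eqP y0; apply/eqP/rowP => j.
  have := congr1 (fun M : 'rV[R]_n => M 0 j) x0; have := congr1 (fun M : 'rV[R]_n => M 0 j) y0.
  by rewrite !mxE; case: (w 0 j) => ? ? /= -> ->.
have a0 u : a 0 u = 0 by have := aL (-1) 0 0 u; rewrite scaler0 addr0; lra.
have aZ k u v : a (k *: u) v = k * a u v by have := aL k u 0 v; rewrite addr0 a0 addr0.
have aD u v w0 : a (u + v) w0 = a u w0 + a v w0 by have := aL 1 u v w0; rewrite scale1r mul1r.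
have aPP u : 0 <= a u u.
  by case: (eqVneq u 0) => [->|/aP/ltW//]; rewrite a0.
have q0 : q = 0.
  have : q * (a X X + a Y Y) = 0.
    have := adj X Y; rewrite TX TY -[- (q *: Y)]scaleNr aD !aZ aS [a X (_ + _)]aS aD !aZ.
    lra.
  move/eqP; rewrite mulf_eq0 => /orP[/eqP//|/eqP s0].
  by case/orP: xy => /aP; [have := aPP Y|have := aPP X]; lra.
exists p; apply/leigenvalueP; case/orP: xy => hn.
  by exists X => //; rewrite TX q0 scale0r subr0.
by exists Y => //; rewrite TY q0 scale0r add0r.
Qed.

(** The eigenvalues are the real roots of the characteristic polynomial, a finite list that
    self-adjointness makes nonempty. *)
Lemma extreme_eigenvalues T : (exists v : V, v != 0) ->
  (forall u v, a (T u) v = a u (T v)) ->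
  exists lmin lmax, [/\ passmx.leigenvalue T lmin, passmx.leigenvalue T lmax &
    forall mu, passmx.leigenvalue T mu -> lmin <= mu <= lmax].
Proof.
move=> vn adj; have [mu0 hmu0] := selfadjoint_eigenvalue vn adj.
pose p := char_poly (passmx.mxof e e T).
have p0 : p != 0 by rewrite monic_neq0 // char_poly_monic.
pose s := polyrcf.rootsR p.
have hs mu : passmx.leigenvalue T mu = (mu \in s).
  by rewrite leigenvalue_char -(polyrcf.roots_on_rootsR p0) in_itv.
have sn : s != [::] by apply/eqP => s0; move: hmu0; rewrite hs s0.
have [lmax smax hmax] := exists_max_seq sn.
have [|lmin smin hmin] := @exists_max_seq [seq - x | x <- s]; first by case: (s) sn.
exists (- lmin), lmax; split.
- by rewrite hs; case/mapP: smin => x xs ->; rewrite opprK.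
- by rewrite hs.
- move=> mu; rewrite hs => ms; rewrite hmax // andbT lerNl hmin //.
  exact: map_f.
Qed.

End RealEigenvalue.

Section Schwarz.
Variables (R : realType) (V : vectType R) (a : V -> V -> R).
Hypotheses (aL : forall (k : R) u v w, a (k *: u + v) w = k * a u w + a v w)
  (aS : forall u v, a u v = a v u).
Hypothesis (aP : forall u, u != 0 -> 0 < a u u).
Implicit Types (u v w : V).

Lemma form0l u : a 0 u = 0.
Proof. by have := aL (-1) 0 0 u; rewrite scaler0 addr0; lra. Qed.

Lemma formDl u v w : a (u + v) w = a u w + a v w.
Proof. by have := aL 1 u v w; rewrite scale1r mul1r. Qed.

Lemma formDr u v w : a w (u + v) = a w u + a w v.
Proof. by rewrite aS formDl ![a _ w]aS. Qed.

Lemma formZl k u v : a (k *: u) v = k * a u v.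
Proof. by have := aL k u 0 v; rewrite addr0 form0l addr0. Qed.

Lemma form_suml (I : finType) (F : I -> V) w : a (\sum_i F i) w = \sum_i a (F i) w.
Proof. by apply: (big_morph (a ^~ w)) => [u v|]; rewrite ?formDl ?form0l. Qed.

Lemma form_sumr (I : finType) (F : I -> V) w : a w (\sum_i F i) = \sum_i a w (F i).
Proof. by rewrite aS form_suml; apply: eq_bigr => i _; rewrite aS. Qed.

Lemma form_ge0 u : 0 <= a u u.
Proof. by case: (eqVneq u 0) => [->|/aP/ltW//]; rewrite form0l. Qed.

Lemma form_quad k u v :
  a (k *: u + v) (k *: u + v) = k ^+ 2 * a u u + 2 * k * a u v + a v v.
Proof. by rewrite aL [a u _]aS [a v _]aS !aL [a v u]aS; ring. Qed.

Lemma form_amgm u v : 2 * a u v <= a u u + a v v.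
Proof. by have := form_ge0 ((-1) *: u + v); rewrite form_quad; lra. Qed.

Lemma form_CS u v : a u v ^+ 2 <= a u u * a v v.
Proof.
case: (eqVneq u 0) => [->|un]; first by rewrite !form0l mul0r expr0n.
have u0 := aP un; have := form_ge0 ((- (a u v / a u u)) *: u + v).
rewrite form_quad (_ : _ + _ = a v v - a u v ^+ 2 / a u u); last first.
  by field; exact: lt0r_neq0.
by rewrite subr_ge0 ler_pdivrMr // mulrC.
Qed.

Variables (N : nat) (W0 : V -> Prop) (W : 'I_N -> V -> Prop).
Variables (T0 : 'End(V)) (Tl : 'I_N -> 'End(V)).
Hypotheses (h0 : galerkin_projection a W0 T0) (hl : forall i, galerkin_projection a (W i) (Tl i)).
Variables (M : nat) (nbr : rel 'I_N).
Hypothesis orth : forall i j u v, W i u -> W j v -> ~~ nbr i j -> i != j -> a u v = 0.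
Hypothesis nbrS : symmetric nbr.
Hypothesis deg : forall i, (#|[set j | (j != i) && nbr i j]%SET| <= M)%N.
Variable lam : R.
Hypothesis lam0 : 0 < lam.
Hypothesis split : forall u, exists u0 ul, [/\ W0 u0, forall i, W i (ul i),
  u = u0 + \sum_i ul i & a u0 u0 + \sum_i a (ul i) (ul i) <= lam * a u u].

Let T := T0 + \sum_i Tl i.

Lemma schwarzE u : T u = T0 u + \sum_i Tl i u.
Proof. by rewrite /T !lfunE /= sum_lfunE. Qed.

Lemma projection_adjoint (P : 'End(V)) (Wp : V -> Prop) : galerkin_projection a Wp P ->
  forall u v, a (P u) v = a (P u) (P v).
Proof.
move=> hP u v; have [_ h1] := hP v; have [pu _] := hP u.
by rewrite aS -h1 // aS.
Qed.

Lemma schwarz_selfadjoint u v : a (T u) v = a u (T v).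
Proof.
have pa P Wp (hP : galerkin_projection a Wp P) : a (P u) v = a u (P v).
  by rewrite (projection_adjoint hP u v) [RHS]aS (projection_adjoint hP v u) aS.
rewrite !schwarzE formDl formDr form_suml form_sumr (pa _ _ h0); congr (_ + _).
by apply: eq_bigr => i _; exact: pa (hl i).
Qed.

Lemma schwarz_energy u : a (T u) u = a (T0 u) (T0 u) + \sum_i a (Tl i u) (Tl i u).
Proof.
rewrite schwarzE formDl form_suml (projection_adjoint h0); congr (_ + _).
by apply: eq_bigr => i _; exact: projection_adjoint (hl i) _ _.
Qed.

Lemma form_le_of_sqr (S A k : R) : 0 <= S -> 0 <= A -> 0 <= k -> S ^+ 2 <= k * S * A -> S <= k * A.
Proof.
move=> S0 A0 k0 h; case: (eqVneq S 0) => [->|Sn]; first by rewrite mulr_ge0.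
have {S0}S0 : 0 < S by rewrite lt_neqAle eq_sym Sn S0.
by rewrite -(ler_pM2l S0); move: h; lra.
Qed.

(** The coarse projection does not increase energy, which accounts for 1 in [M + 2]. If [S] is the
    sum of the local energies and [v] the sum of the local projections, then [S = a v u], and
    counting interactions gives [a v v <= (M + 1) * S]; Cauchy-Schwarz yields
    [S <= (M + 1) * a u u]. *)
Lemma schwarz_upper u : a (T u) u <= (M%:R + 2) * a u u.
Proof.
have A0 := form_ge0 u; rewrite schwarz_energy.
have t0 : a (T0 u) (T0 u) <= a u u.
  rewrite -[a u u]mul1r; apply: form_le_of_sqr => //; first exact: form_ge0.
  by rewrite mul1r -{1}(projection_adjoint h0); exact: form_CS.
set S := \sum_i a (Tl i u) (Tl i u).
have S0 : 0 <= S by apply: sumr_ge0 => i _; exact: form_ge0.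
suff : S <= (M%:R + 1) * a u u by lra.
apply: form_le_of_sqr => //.
pose v := \sum_i Tl i u.
have vS : a v u = S.
  by rewrite form_suml; apply: eq_bigr => i _; exact: projection_adjoint (hl i) _ _.
rewrite -{1}vS; apply: le_trans (form_CS _ _) _; rewrite ler_wpM2r //.
pose b i := a (Tl i u) (Tl i u).
apply: (@le_trans _ _ (\sum_i \sum_j ((i == j) || nbr i j)%:R * ((b i + b j) / 2))).
  rewrite form_suml; apply: ler_sum => i _; rewrite form_sumr; apply: ler_sum => j _.
  case hij: ((i == j) || nbr i j); last first.
    move/negbT: hij; rewrite negb_or => /andP[ij nij].
    rewrite mul0r (orth (i := i) (j := j)) //; [exact: (hl i u).1|exact: (hl j u).1].
  by rewrite mul1r /b; have := form_amgm (Tl i u) (Tl j u); lra.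
pose k i j : R := ((i == j) || nbr i j)%:R.
have kS i j : k i j = k j i by rewrite /k eq_sym nbrS.
have kM i : \sum_j k i j <= M%:R + 1.
  rewrite /k -natr_sum natr1 ler_nat.
  rewrite (eq_bigr (fun j => if j \in (i |: [set j | (j != i) && nbr i j])%SET then 1 else 0)%N).
    by rewrite -big_mkcond sum1_card cardsU1 !inE eqxx /= add1n ltnS.
  by move=> j _; rewrite !inE [i == j]eq_sym; case: eqP.
have b0 i : 0 <= b i by exact: form_ge0.
(* Symmetry of the interaction matrix replaces the mean of [b i] and [b j] by [b i], so that only
   row sums remain. *)
have -> : \sum_i \sum_j k i j * ((b i + b j) / 2) = \sum_i \sum_j k i j * b i.
  transitivity ((\sum_i \sum_j k i j * b i + \sum_i \sum_j k i j * b j) / 2).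
    rewrite -big_split /= mulr_suml; apply: eq_bigr => i _.
    by rewrite -big_split /= mulr_suml; apply: eq_bigr => j _; field.
  rewrite [X in _ + X]exchange_big /=.
  under [X in _ + X]eq_bigr do under eq_bigr do rewrite kS.
  by field.
rewrite /S mulr_sumr; apply: ler_sum => i _.
by rewrite -mulr_suml ler_wpM2r.
Qed.

(** Lions' lemma: [a u u] is the sum of the products of the projections with the components of the
    splitting. The arithmetic-geometric inequality with parameter [k] applies, and [k = lam] lets
    the splitting bound absorb half of the left side. *)
Lemma schwarz_lower u : a u u <= lam * a (T u) u.
Proof.
have A0 := form_ge0 u.
have [u0 [ul [w0 wl eu hu]]] := split u.
rewrite schwarz_energy; set S := _ + \sum_i _.
have S0 : 0 <= S by rewrite addr_ge0 ?form_ge0 // sumr_ge0 // => i _; exact: form_ge0.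
set D := _ + \sum_i _ in hu.
have eA : a u u = a (T0 u) u0 + \sum_i a (Tl i u) (ul i).
  rewrite {2}eu formDr form_sumr; congr (_ + _); first by rewrite (h0 u).2.
  by apply: eq_bigr => i _; rewrite (hl i u).2.
have am (k : R) : 2 * k * a u u <= k ^+ 2 * S + D.
  rewrite eA mulrDr mulr_sumr /S /D mulrDr mulr_sumr addrACA -big_split /=.
  have one x y : 2 * k * a x y <= k ^+ 2 * a x x + a y y.
    have := form_amgm (k *: x) y; rewrite !formZl [a x (k *: x)]aS formZl; lra.
  by apply: lerD; [exact: one|apply: ler_sum => i _; exact: one].
have h1 := am lam; suff : lam * a u u <= lam * (lam * S) by rewrite ler_pM2l.
move: h1 hu {am}; rewrite expr2 -!mulrA.
move: (lam * a u u) (lam * (lam * S)) D => A1 S1 D1; lra.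
Qed.

Lemma schwarz_condition (Lm : R) : (exists v : V, v != 0) ->
  (M%:R + 2) * lam <= Lm -> exists2 kappa, condition_number T kappa & kappa <= Lm.
Proof.
move=> vn hL; have l0 := lam0; have [lmin [lmax [hmin hmax hall]]] := extreme_eigenvalues aL aS aP vn schwarz_selfadjoint.
have bd mu : passmx.leigenvalue T mu -> 0 < mu /\ lam^-1 <= mu <= M%:R + 2.
  move=> /leigenvalueP[v v0 hv]; have Av := aP v0.
  have := schwarz_upper v; have := schwarz_lower v; rewrite hv formZl => h1 h2.
  have l1 : lam^-1 <= mu by rewrite -[X in X <= _]mul1r ler_pdivrMr // mulrC; nra.
  split; first by apply: lt_le_trans l1; rewrite invr_gt0.
  by rewrite l1 /=; move: h2; rewrite ler_pM2r.
have [pmin /andP[bmin _]] := bd _ hmin; have [_ /andP[_ bmax]] := bd _ hmax.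
exists (lmax / lmin); first by exists lmin, lmax.
apply: le_trans hL; rewrite ler_pdivrMr //.
apply: le_trans bmax _; rewrite -mulrA ler_peMr //.
by rewrite -(mulfV (lt0r_neq0 l0)) ler_pM2l.
Qed.

End Schwarz.

(** * The stable decomposition *)

Section Assembly.
Variables (R : realType) (Om : set (plane R)) (Th TH : mesh R).
Hypotheses (ndh : Defs.nondegenerate Th) (cfh : conforming Th)
  (covh : closure Om = \bigcup_K elt (m := Th) K).
Hypotheses (ndH : Defs.nondegenerate TH) (cfH : conforming TH)
  (covH : closure Om = \bigcup_K elt (m := TH) K).
Hypothesis hsub : forall t : 'I_(nelt Th), exists K : 'I_(nelt TH), elt t `<=` elt K.
Variables (sigma : R) (c : 'I_(nelt Th) -> plane R) (cH : 'I_(nelt TH) -> plane R).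
Hypothesis sig0 : 0 < sigma.
Hypothesis hc : forall t, [set x | enorm (x - c t) <= mesh_size Th / sigma] `<=` elt t.
Hypothesis hcH : forall K, [set x | enorm (x - cH K) <= mesh_size TH / sigma] `<=` elt K.
Implicit Types (t : 'I_(nelt Th)) (K : 'I_(nelt TH)) (x y z : plane R).
Implicit Types (u : dgspace R Th) (q : 'I_(nelt Th) -> R) (S : {set 'I_(nelt Th)}).

Local Notation h := (mesh_size Th).
Local Notation H := (mesh_size TH).
Variables (al : 'I_(nelt Th) -> R) (alpha0 eta0 eta k0 : R).
Hypotheses (a00 : 0 < alpha0) (al_ge : forall t, alpha0 <= al t).
Hypotheses (e00 : 0 < eta0) (eta_gt : eta0 < eta) (k00 : 0 < k0).
Hypothesis hcoer : coercive al eta k0.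

Let al0 t : 0 < al t. Proof. exact: lt_le_trans (al_ge t). Qed.
Let eta_pos : 0 < eta. Proof. exact: lt_trans eta_gt. Qed.
Local Notation E := (energy al).
Local Notation J u := (jump_form al u u).
Local Notation cF := (c_flux sigma).

Let E0 u : 0 <= E u. Proof. exact: energy_ge0. Qed.
Let J0 u : 0 <= J u. Proof. exact: jump_form_ge0. Qed.

Lemma flux_diag_le u : `|flux_form al u u| <= cF * (E u + J u).
Proof. exact: flux_form_le. Qed.

Lemma c_flux_gt0 : 0 < cF.
Proof. by rewrite /c_flux ltr_wpDl // mulr_ge0 // sqr_ge0. Qed.

(** The lower bound [eta0] of the penalty lets [eta * J] absorb the jump part of the flux bound. *)
Definition c_upper : R := 1 + 2 * cF + 2 * cF / eta0.

Lemma a_h_upper u : a_h al eta u u <= c_upper * (E u + eta * J u).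
Proof.
have := flux_diag_le u; rewrite ler_norml => /andP[h1 h2].
have F0 := c_flux_gt0; have q0 : 0 < cF / eta0 by rewrite divr_gt0.
have -> : a_h al eta u u = E u - 2 * flux_form al u u + eta * J u by rewrite /a_h -/(energy al u); ring.
have h3 : cF * J u <= cF / eta0 * (eta * J u).
  rewrite -mulrA ler_pM2l // mulrA ler_peMl // -?ler_pdivrMl ?invr_gt0 ?invrK //.
  by rewrite mulr1 ltW.
have h4 : 0 <= cF / eta0 * E u by rewrite mulr_ge0 // ltW.
have h5 : 0 <= cF * (eta * J u) by rewrite !mulr_ge0 // ltW.
rewrite /c_upper; lra.
Qed.

Lemma EJ_le u : E u + J u <= k0^-1 * a_h al eta u u.
Proof. by rewrite mulrC ler_pdivlMr // mulrC; exact: hcoer. Qed.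

Definition c_lower : R := 1 + (2 * cF + 1) / k0.

Lemma a_h_ge0 u : 0 <= a_h al eta u u.
Proof. by apply: le_trans (hcoer u); apply: mulr_ge0 (ltW k00) _; exact: addr_ge0 (E0 u) (J0 u). Qed.

(** Coercivity bounds only [E + J]. The penalised jumps stand in the form itself with coefficient 1,
    next to a flux term bounded by [E + J], so the constant is independent of [eta]. *)
Lemma a_h_lower u : E u + eta * J u <= c_lower * a_h al eta u u.
Proof.
have := flux_diag_le u; rewrite ler_norml => /andP[h1 h2].
have := EJ_le u; have F0 := c_flux_gt0 => hEJ.
have e : a_h al eta u u = E u - 2 * flux_form al u u + eta * J u by rewrite /a_h -/(energy al u); ring.
have h3 : (2 * cF + 1) * (E u + J u) <= (2 * cF + 1) * (k0^-1 * a_h al eta u u).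
  by rewrite ler_wpM2l //; lra.
have := E0 u; have := J0 u.
have -> : c_lower * a_h al eta u u = a_h al eta u u + (2 * cF + 1) * (k0^-1 * a_h al eta u u).
  by rewrite /c_lower; ring.
lra.
Qed.

Lemma a_h_pos u : u != 0 -> 0 < a_h al eta u u.
Proof.
move=> un; rewrite lt_neqAle a_h_ge0 andbT; apply/eqP => h0.
move/eqP: un; apply; apply: (dgnorm2_eq0 ndh cfh al0 sig0 hc).
by have := EJ_le u; rewrite -h0 mulr0.
Qed.

Lemma jumpsq_nb u (s s' : side Th) : nb s = Some s' -> jumpsq u s' = jumpsq u s.
Proof.
move=> hn; rewrite /jumpsq !(jmp_nb ndh cfh _ _ hn) !sqrrN.
have [_ hs] := (nbP ndh cfh _ _).1 hn.
by case: (same_side_ab hs) => -[-> ->] //; rewrite addrC.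
Qed.

Definition c_mass : R := (sigma ^+ 2 + 12) / alpha0.

(** The passage from unweighted to weighted quantities, where [alpha0] enters: it bounds the
    harmonic edge weights from below as well as the coefficient. *)
Lemma sum_local_mass u : \sum_t local_mass u t <= c_mass * (E u + J u).
Proof.
rewrite /local_mass big_split /=.
have b1 : \sum_t h ^+ 2 * dot (grad u t) (grad u t) <= sigma ^+ 2 / alpha0 * E u.
  rewrite (energyE ndh) mulr_sumr; apply: ler_sum => t _.
  have hA := sqr_size_le_area ndh sig0 hc t; have gg := dot_ge0 (grad u t).
  have A0 := area_gt0 ndh sig0 hc t.
  apply: (@le_trans _ _ (sigma ^+ 2 * area t * dot (grad u t) (grad u t))).
    by rewrite ler_wpM2r.
  have -> : sigma ^+ 2 / alpha0 * (al t * dot (grad u t) (grad u t) * area t) =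
    (al t / alpha0) * (sigma ^+ 2 * area t * dot (grad u t) (grad u t)).
    by field; exact: lt0r_neq0.
  rewrite ler_peMl ?ler_pdivlMr ?mul1r // mulr_ge0 // mulr_ge0 ?sqr_ge0 // ltW //.
have b2 : \sum_t \sum_k jumpsq u (t, k) <= 12 / alpha0 * J u.
  rewrite (pair_bigA _ (fun t k => jumpsq u (t, k))) /=.
  rewrite (eq_bigr (fun s => jumpsq u s)); last by case.
  rewrite (sum_side ndh cfh) (jump_form_diag ndh cfh) mulr_sumr; apply: ler_sum => e he.
  have W := edge_weight_ge al0 e (ltW a00) al_ge.
  have q := jq_ge u e.1; rewrite -/(jumpsq u e.1) in q.
  have q0 := jq_ge0 u e.1; have j0 := jumpsq_ge0 u e.1.
  apply: (@le_trans _ _ (2 * jumpsq u e.1)).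
    move: he; rewrite (is_edgeE ndh cfh) => /andP[/eqP hn _].
    by case: e.2 hn => [s'|] hn; rewrite ?(jumpsq_nb u hn); lra.
  have -> : 12 / alpha0 * (edge_weight al e * (jq u e.1 / 3)) = edge_weight al e / alpha0 * (4 * jq u e.1).
    by field; exact: lt0r_neq0.
  apply: (@le_trans _ _ (4 * jq u e.1)); first lra.
  by rewrite ler_peMl ?ler_pdivlMr ?mul1r // mulr_ge0.
have h1 : 0 <= sigma ^+ 2 / alpha0 * J u by apply: mulr_ge0 (J0 u); apply: divr_ge0 (sqr_ge0 _) (ltW a00).
have h2 : 0 <= 12 / alpha0 * E u by apply: mulr_ge0 (E0 u); apply: divr_ge0 (ltW a00).
by rewrite /c_mass; lra.
Qed.

Section Decomposition.
Variables (psi : 'I_(nelt TH) -> 'I_3 -> plane R -> R) (phi : 'I_(nelt TH) -> 'I_3 -> dgspace R Th).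
Hypotheses (hpsi : forall K, boundary_data Th K (psi K)) (hphi : multiscale_basis al psi phi).
Variables (N : nat) (chK : 'I_(nelt TH) -> 'I_N) (Kof : 'I_(nelt Th) -> 'I_(nelt TH)).
Hypothesis hKof : forall t, inK (Kof t) t.
Variables (u : dgspace R Th) (cf : 'I_(nelt TH) -> R).
Hypothesis cf0 : forall K (s : side Th), inK K s.1 -> nb s = None -> cf K = 0.
Hypothesis cf_trace : forall K, \sum_(s | on_boundary K s)
     ((ev u s.1 (side_a s) - cf K) ^+ 2 + (ev u s.1 (side_b s) - cf K) ^+ 2)
   <= c_trace sigma * ((H / h) * mass K (local_mass u)).

Lemma inK_Kof K t : inK K t = (K == Kof t).
Proof.
apply/idP/eqP => [tK|->//]; exact: (inK_uniq ndh ndH cfH tK (hKof t)).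
Qed.

Definition u0 : dgspace R Th := \matrix_(t, i) (if i == 0 then cf (Kof t) else 0).
Definition ul (i : 'I_N) : dgspace R Th :=
  \matrix_(t, k) (if chK (Kof t) == i then (u - u0) t k else 0).

Lemma u0_V0 : u0 \in V0 phi.
Proof.
have part := basis_partition ndh cfh covh ndH cfH covH hsub sig0 hc hcH al0 hpsi hphi.
have -> : u0 = \sum_K cf K *: \sum_p phi K p.
  under eq_bigr do rewrite part.
  apply/matrixP => t i; rewrite !mxE summxE (bigD1 (Kof t)) //= big1 ?addr0.
    by rewrite !mxE hKof /=; case: eqP => _; rewrite ?mulr1 ?mulr0.
  by move=> K /negPf nK; rewrite !mxE inK_Kof nK mulr0.
apply: memv_suml => K _; apply: memvZ; apply: memv_suml => p _; apply: memv_span.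
by apply/mapP; exists (K, p) => //; exact: mem_enum.
Qed.

Lemma decomposition : u = u0 + \sum_i ul i.
Proof.
apply/matrixP => t k; rewrite mxE summxE (bigD1 (chK (Kof t))) //= big1 ?addr0.
  by rewrite !mxE eqxx; ring.
by move=> i /negPf ni; rewrite !mxE eq_sym ni.
Qed.

Lemma ev_u0 t x : ev u0 t x = cf (Kof t).
Proof. by rewrite /ev !mxE /= !mul0r !addr0. Qed.

Lemma ev_ul i t x : ev (ul i) t x = if chK (Kof t) == i then ev u t x - cf (Kof t) else 0.
Proof.
by rewrite /ev !mxE; case: eqP => _ /=; ring.
Qed.

Lemma energy_u0 : E u0 = 0.
Proof.
rewrite (energyE ndh) big1 // => t _; rewrite (_ : dot _ _ = 0) ?mulr0 ?mul0r //.
by rewrite /dot /grad !mxE /= mulr0 addr0.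
Qed.

Lemma energy_ul : \sum_i E (ul i) = E u.
Proof.
under eq_bigr do rewrite (energyE ndh).
rewrite exchange_big (energyE ndh) /=; apply: eq_bigr => t _.
rewrite (bigD1 (chK (Kof t))) //= big1 ?addr0.
  congr (_ * _ * _); rewrite /dot /grad !mxE /= eqxx; ring.
move=> i /negPf ni; rewrite (_ : dot _ _ = 0) ?mulr0 ?mul0r //.
by rewrite /dot /grad !mxE /= eq_sym ni mulr0 addr0.
Qed.

(** Coarse elements are compared rather than subdomains, since [u0] jumps also across coarse edges
    inside a subdomain. *)
Definition crossing (s : side Th) : bool := if nb s is Some s' then Kof s.1 != Kof s'.1 else false.

Definition wsq (s : side Th) : R :=
  (ev u s.1 (side_a s) - cf (Kof s.1)) ^+ 2 + (ev u s.1 (side_b s) - cf (Kof s.1)) ^+ 2.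

Lemma wsq_ge0 s : 0 <= wsq s. Proof. by rewrite addr_ge0 ?sqr_ge0. Qed.

(** A crossing side lies on the boundary of its coarse element, so the trace bounds of all coarse
    elements can be added. *)
Lemma sum_wsq : \sum_(s | crossing s) wsq s <=
  c_trace sigma * c_mass * ((H / h) * (E u + J u)).
Proof.
have tr0 := c_trace_gt0 sig0.
apply: (@le_trans _ _ (\sum_K \sum_(s | on_boundary K s)
     ((ev u s.1 (side_a s) - cf K) ^+ 2 + (ev u s.1 (side_b s) - cf K) ^+ 2))).
  rewrite (exchange_big_dep xpredT) //= big_mkcond; apply: ler_sum => s _.
  have nn K : 0 <= (ev u s.1 (side_a s) - cf K) ^+ 2 + (ev u s.1 (side_b s) - cf K) ^+ 2.
    by rewrite addr_ge0 ?sqr_ge0.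
  case: ifPn => [cs|_]; last by apply: sumr_ge0 => K _; exact: nn.
  rewrite (bigD1 (Kof s.1)) /=; first by rewrite lerDl; apply: sumr_ge0 => K _; exact: nn.
  rewrite /on_boundary hKof /=; apply/existsP.
  have [|k hk] := coarse_side ndh cfh covh ndH cfH covH hsub (hKof s.1).
    move=> s' hn; move: cs; rewrite /crossing hn => ne.
    by rewrite inK_Kof (negPf ne).
  by exists k; apply/asboolP.
apply: (@le_trans _ _ (\sum_(K : 'I_(nelt TH)) c_trace sigma * ((H / h) * mass K (local_mass u)))).
  by apply: ler_sum => K _; exact: cf_trace.
rewrite -!mulr_sumr -[leRHS]mulrA ler_pM2l // [leRHS]mulrCA ler_wpM2l //.
  by rewrite divr_ge0 ?mesh_size_ge0.
apply: le_trans (sum_mass ndh ndH cfH hsub (local_mass_ge0 u)) _.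
exact: sum_local_mass.
Qed.

Lemma crossing_weight e s' : is_edge e -> e.2 = Some s' -> Kof e.1.1 != Kof s'.1 ->
  edge_weight al e <= max_coarse_weight TH al.
Proof.
move=> he e2 ne; have : nb e.1 = e.2 by move: he; rewrite (is_edgeE ndh cfh) => /andP[/eqP].
rewrite e2 => hn.
have [k [k' [hs s1 s2]]] := coarse_interface ndh cfh covh ndH cfH covH hsub hn (hKof _) (hKof _) ne.
have fin (S : side TH * side TH) : is_edge (S.1, Some S.2) -> side_set e.1 `<=` side_set S.1 ->
    edge_weight al e <= max_coarse_weight TH al.
  move=> hS sub.
  apply: (@le_trans _ _ (\big[Num.max/0]_(e | fine_edge_of (S.1, Some S.2) e) edge_weight al e)).
    apply: (@le_bigmax_cond _ _ _ 0 e (fine_edge_of (S.1, Some S.2)) (edge_weight al)).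
    by rewrite /fine_edge_of he; apply/asboolP.
  rewrite /max_coarse_weight (bigD1 S) //=.
  by rewrite le_max lexx.
(* Edges list the element of smaller index first, and the order of the two coarse elements is
   unrelated to that of the fine ones. *)
case: (ltngtP (Kof e.1.1) (Kof s'.1)) => hlt.
- by apply: (fin ((Kof e.1.1, k), (Kof s'.1, k'))) => //; rewrite /is_edge /= hlt.
- apply: (fin ((Kof s'.1, k'), (Kof e.1.1, k))) => //.
  by rewrite /is_edge /= hlt same_side_sym.
- by move/val_inj: hlt ne => ->; rewrite eqxx.
Qed.

Definition crossing_part (e : edge Th) : R :=
  if e.2 is Some s' then (if crossing e.1 then wsq e.1 else 0) + (if crossing s' then wsq s' else 0)
  else if crossing e.1 then wsq e.1 else 0.

(** The bound serves both for edges between two subdomains and for coarse edges inside one. *)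
Lemma sum_indicator2 (i1 i2 : 'I_N) (A B : R) :
  \sum_i ((if i1 == i then A else 0) - (if i2 == i then B else 0)) ^+ 2 <= 2 * (A ^+ 2 + B ^+ 2).
Proof.
apply: (@le_trans _ _ (\sum_i ((if i1 == i then 2 * A ^+ 2 else 0) + (if i2 == i then 2 * B ^+ 2 else 0)))).
  apply: ler_sum => i _; have := sqr_ge0 (A + B); have := sqr_ge0 A; have := sqr_ge0 B.
  by case: eqP => _; case: eqP => _; rewrite ?subr0 ?sub0r ?sqrrN ?expr0n /= ?addr0 ?add0r; lra.
have pick (j : 'I_N) (x : R) : \sum_i (if j == i then x else 0) = x.
  by rewrite -big_mkcond (big_pred1 j) // => i; rewrite eq_sym.
by rewrite big_split /= !pick; lra.
Qed.

Lemma sum_indicator1 (i1 : 'I_N) (A B : R) :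
  \sum_i ((if i1 == i then A else 0) - (if i1 == i then B else 0)) ^+ 2 = (A - B) ^+ 2.
Proof.
rewrite (bigD1 i1) //= eqxx big1 ?addr0 // => i /negPf ni.
by rewrite eq_sym ni subrr expr0n.
Qed.

(** Three kinds of edges: on the domain boundary the constant is 0; inside a coarse element [u0] has
    no jump and that of [u] goes to a single subdomain; between coarse elements the traces of
    [u - u0] are charged with the maximal weight. *)
Lemma edge_split_le e : is_edge e ->
  edge_weight al e * (\sum_i jumpsq (ul i) e.1 + jumpsq u0 e.1) <=
  3 * (edge_weight al e * jumpsq u e.1) + 5 * (max_coarse_weight TH al * crossing_part e).
Proof.
move=> he; have W0 := edge_weight_gt0 al0 e.
have hn : nb e.1 = e.2 by move: he; rewrite (is_edgeE ndh cfh) => /andP[/eqP].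
have M0 : 0 <= max_coarse_weight TH al by exact: bigmax_ge_id.
have J1 := jumpsq_ge0 u e.1.
have js (v : dgspace R Th) x : jmp v e.1 x = ev v e.1.1 x - (if e.2 is Some s' then ev v s'.1 x else 0).
  by rewrite /jmp hn.
rewrite {1}/jumpsq big_split /= /jumpsq !js.
under eq_bigr do rewrite js ev_ul.
under [X in _ + X + _]eq_bigr do rewrite js ev_ul.
rewrite !ev_u0; case e2 : e.2 hn => [s'|] hn; last first.
  have c0 : cf (Kof e.1.1) = 0 by apply: (cf0 (hKof e.1.1)).
  have C0 : 0 <= crossing_part e.
    by rewrite /crossing_part e2; case: ifP => // _; exact: wsq_ge0.
  have s1 x : \sum_(i < N) ((if chK (Kof e.1.1) == i then ev u e.1.1 x - cf (Kof e.1.1) else 0) - 0) ^+ 2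
      = ev u e.1.1 x ^+ 2.
    rewrite (bigD1 (chK (Kof e.1.1))) //= eqxx big1 ?addr0 ?c0 ?subr0 //.
    by move=> i /negPf ni; rewrite eq_sym ni subr0 expr0n.
  rewrite !s1 c0 !subr0 expr0n /= !addr0.
  have := mulr_ge0 M0 C0.
  have : 0 <= edge_weight al e * (ev u e.1.1 (side_a e.1) ^+ 2 + ev u e.1.1 (side_b e.1) ^+ 2).
    by rewrite mulr_ge0 ?(ltW W0) // addr_ge0 ?sqr_ge0.
  lra.
under eq_bigr do rewrite ev_ul.
under [X in _ + X + _]eq_bigr do rewrite ev_ul.
case: (eqVneq (Kof e.1.1) (Kof s'.1)) => [eK|nK].
  have C0 : 0 <= crossing_part e.
    by rewrite /crossing_part e2 addr_ge0 //; case: ifP => // _; exact: wsq_ge0.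
  rewrite !ev_u0 eK !sum_indicator1 !subrr expr0n /= !addr0.
  have e1 x : (ev u e.1.1 x - cf (Kof s'.1) - (ev u s'.1 x - cf (Kof s'.1))) = ev u e.1.1 x - ev u s'.1 x.
    by ring.
  rewrite !e1; have := mulr_ge0 M0 C0.
  have : 0 <= edge_weight al e * ((ev u e.1.1 (side_a e.1) - ev u s'.1 (side_a e.1)) ^+ 2 +
     (ev u e.1.1 (side_b e.1) - ev u s'.1 (side_b e.1)) ^+ 2).
    by rewrite mulr_ge0 ?(ltW W0) // addr_ge0 ?sqr_ge0.
  lra.
have WM := crossing_weight he e2 nK.
have [_ hs] := (nbP ndh cfh _ _).1 hn.
have cp : crossing_part e = wsq e.1 + ((ev u s'.1 (side_a e.1) - cf (Kof s'.1)) ^+ 2 +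
   (ev u s'.1 (side_b e.1) - cf (Kof s'.1)) ^+ 2).
  rewrite /crossing_part e2 /crossing hn (nb_sym ndh cfh hn) nK eq_sym nK; congr (_ + _).
  by rewrite /wsq; case: (same_side_ab hs) => -[-> ->] //; rewrite addrC.
rewrite cp /wsq !ev_u0.
set A := ev u e.1.1 (side_a e.1); set B := ev u e.1.1 (side_b e.1).
set A' := ev u s'.1 (side_a e.1); set B' := ev u s'.1 (side_b e.1).
set p := cf (Kof e.1.1); set p' := cf (Kof s'.1).
(* [p - p'] is [(X - Y) - (X - p) + (Y - p')], whose square costs 3 of each square; the local
   components add 2 for the traces, whence 3 and 5. *)
have one X Y : \sum_(i < N) ((if chK (Kof e.1.1) == i then X - p else 0) -
   (if chK (Kof s'.1) == i then Y - p' else 0)) ^+ 2 + (p - p') ^+ 2 <=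
   3 * (X - Y) ^+ 2 + 5 * ((X - p) ^+ 2 + (Y - p') ^+ 2).
  have := sum_indicator2 (chK (Kof e.1.1)) (chK (Kof s'.1)) (X - p) (Y - p').
  have := sqr_ge0 ((X - Y) + (X - p)); have := sqr_ge0 ((X - Y) - (Y - p')).
  have := sqr_ge0 ((X - p) + (Y - p')); nra.
have oA := one A A'; have oB := one B B'.
set SA := \sum_i _ in oA *; set SB := \sum_i _ in oB *.
apply: (@le_trans _ _ (edge_weight al e * (3 * ((A - A') ^+ 2 + (B - B') ^+ 2) +
   5 * ((A - p) ^+ 2 + (B - p) ^+ 2 + ((A' - p') ^+ 2 + (B' - p') ^+ 2))))).
  by rewrite ler_pM2l //; lra.
rewrite mulrDr [X in _ + X <= _]mulrCA [X in X + _ <= _]mulrCA lerD2l ler_pM2l // ler_wpM2r //.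
by rewrite !addr_ge0 ?sqr_ge0.
Qed.

Lemma jump_le_jumpsq v : J v <= (\sum_(e | is_edge e) edge_weight al e * jumpsq v e.1) / 2.
Proof.
rewrite (jump_form_diag ndh cfh) mulr_suml; apply: ler_sum => e _.
by rewrite -mulrA ler_pM2l ?(edge_weight_gt0 al0) //; have := jq_le v e.1; rewrite -/(jumpsq v e.1); lra.
Qed.

Lemma jumpsq_le_jump v : \sum_(e | is_edge e) edge_weight al e * jumpsq v e.1 <= 6 * J v.
Proof.
rewrite (jump_form_diag ndh cfh) mulr_sumr; apply: ler_sum => e _.
rewrite mulrCA ler_pM2l ?(edge_weight_gt0 al0) //; have := jq_ge v e.1; rewrite -/(jumpsq v e.1); lra.
Qed.

Lemma sum_jumps : \sum_i J (ul i) + J u0 <= 9 * J u +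
  5 / 2 * (max_coarse_weight TH al * (c_trace sigma * c_mass * ((H / h) * (E u + J u)))).
Proof.
have M0 : 0 <= max_coarse_weight TH al by exact: bigmax_ge_id.
apply: (@le_trans _ _ ((\sum_(e | is_edge e)
    edge_weight al e * (\sum_i jumpsq (ul i) e.1 + jumpsq u0 e.1)) / 2)).
  have -> : \sum_(e | is_edge e) edge_weight al e * (\sum_i jumpsq (ul i) e.1 + jumpsq u0 e.1) =
    \sum_i (\sum_(e | is_edge e) edge_weight al e * jumpsq (ul i) e.1) +
    \sum_(e | is_edge e) edge_weight al e * jumpsq u0 e.1.
    rewrite exchange_big -big_split /=; apply: eq_bigr => e _.
    by rewrite mulrDr mulr_sumr.
  rewrite [leRHS]mulrDl; apply: lerD; last exact: jump_le_jumpsq.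
  rewrite mulr_suml.
  by apply: ler_sum => i _; exact: jump_le_jumpsq.
have s1 : \sum_(e | is_edge e) edge_weight al e * (\sum_i jumpsq (ul i) e.1 + jumpsq u0 e.1) <=
   3 * (6 * J u) + 5 * (max_coarse_weight TH al * \sum_(s | crossing s) wsq s).
  apply: (@le_trans _ _ (\sum_(e | is_edge e) (3 * (edge_weight al e * jumpsq u e.1) +
     5 * (max_coarse_weight TH al * crossing_part e)))).
    by apply: ler_sum => e; exact: edge_split_le.
  rewrite big_split /= -!mulr_sumr; apply: lerD.
    by rewrite ler_pM2l //; exact: jumpsq_le_jump.
  by rewrite ler_pM2l // ler_wpM2l // [leRHS]big_mkcond (sum_side ndh cfh) le_eqVlt eqxx.
have s2 := ler_wpM2l M0 sum_wsq.
lra.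
Qed.

Lemma decomposition_stable : a_h al eta u0 u0 + \sum_i a_h al eta (ul i) (ul i) <=
  c_upper * (9 * c_lower + 5 / 2 * (c_trace sigma * c_mass) * (eta * max_coarse_weight TH al * (H / h)) / k0)
   * a_h al eta u u.
Proof.
have M0 : 0 <= max_coarse_weight TH al by exact: bigmax_ge_id.
have cu0 : 0 < c_upper.
  by rewrite /c_upper; have := c_flux_gt0 => F0; rewrite !addr_gt0 ?mulr_gt0 ?invr_gt0.
apply: (@le_trans _ _ (c_upper * (E u + eta * (\sum_i J (ul i) + J u0)))).
  apply: (@le_trans _ _ (c_upper * (E u0 + eta * J u0) + \sum_i c_upper * (E (ul i) + eta * J (ul i)))).
    by apply: lerD; [exact: a_h_upper|apply: ler_sum => i _; exact: a_h_upper].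
  rewrite -mulr_sumr big_split /= -mulr_sumr energy_ul energy_u0 add0r.
  by rewrite le_eqVlt; apply/orP; left; apply/eqP; ring.
rewrite -mulrA ler_pM2l //.
have sj := sum_jumps; set X := c_trace sigma * c_mass in sj *.
have X0 : 0 <= X.
  rewrite /X mulr_ge0 ?(ltW (c_trace_gt0 sig0)) // /c_mass divr_ge0 ?(ltW a00) //.
  by rewrite addr_ge0 // sqr_ge0.
have n0 : 0 <= H / h by rewrite divr_ge0 ?mesh_size_ge0.
have h1 : eta * (\sum_i J (ul i) + J u0) <= 9 * (eta * J u) +
   5 / 2 * X * (eta * max_coarse_weight TH al * (H / h)) * (E u + J u).
  have := ler_wpM2l (ltW eta_pos) sj; lra.
have h2 : 5 / 2 * X * (eta * max_coarse_weight TH al * (H / h)) * (E u + J u) <=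
  5 / 2 * X * (eta * max_coarse_weight TH al * (H / h)) * (k0^-1 * a_h al eta u u).
  have X1 : 0 <= 5 / 2 * X by rewrite mulr_ge0.
  have e1 : 0 <= eta * max_coarse_weight TH al by rewrite mulr_ge0 // ltW.
  by rewrite ler_wpM2l ?EJ_le // mulr_ge0 // mulr_ge0.
have h3 := a_h_lower u; have := E0 u; lra.
Qed.

End Decomposition.
End Assembly.

(** * Subdomain spaces and the orthogonality of nonadjacent ones *)

Lemma aligned_sub (R : realType) (m : mesh R) (D : set (plane R)) (K : 'I_(nelt m)) x :
  Defs.nondegenerate m -> conforming m -> aligned_with m D ->
  ipt K x -> closure D x -> elt K `<=` closure D.
Proof.
move=> nd cf hD hx; rewrite {1}hD => -[K' hK' xK'].
by rewrite (ipt_uniq nd cf hx xK').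
Qed.

Lemma disjoint_open_closure (T : topologicalType) (A B : set T) x :
  open A -> A `&` B = set0 -> A x -> ~ closure B x.
Proof.
move=> oA AB Ax /(_ A (open_nbhs_nbhs (conj oA Ax))) [y [By Ay]].
by have : set0 y by rewrite -AB.
Qed.

Lemma gamma_ge_min (R : realType) (Th TH : mesh R) (al : 'I_(nelt Th) -> R) alpha0
    (phi : 'I_(nelt TH) -> 'I_3 -> dgspace R Th) :
  Defs.nondegenerate Th -> (forall t : 'I_(nelt Th), 0 < area t) ->
  0 < alpha0 -> (forall t, alpha0 <= al t) ->
  alpha0 * Defs.gamma (fun=> 1) phi <= Defs.gamma al phi.
Proof.
move=> nd A0 a0 hal; rewrite mulrC -ler_pdivlMr // /Defs.gamma.
have g0 : 0 <= Defs.gamma al phi / alpha0 by rewrite divr_ge0 ?(ltW a0) // bigmax_ge_id.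
apply: bigmax_le => // K _; apply: bigmax_le => // p _.
rewrite ler_pdivlMr //; apply: (@le_trans _ _ (energy_on (elt K) al (phi K p) (phi K p))).
  rewrite /energy_on mulr_suml; apply: ler_sum => t _; rewrite !elt_energyE // mul1r.
  have : 0 <= dot (grad (phi K p) t) (grad (phi K p) t) * area t.
    by rewrite mulr_ge0 ?dot_ge0 // ltW.
  by move=> q0; rewrite mulrC -mulrA ler_wpM2r.
apply: le_trans (le_bigmax _ (fun K => \big[Num.max/0]_(p < 3) _) K).
exact: (le_bigmax _ (fun p => energy_on (elt K) al (phi K p) (phi K p)) p).
Qed.

Section Subdomains.
Variables (R : realType) (Omega : set (plane R)) (Th : mesh R).
Hypotheses (ndh : Defs.nondegenerate Th) (cfh : conforming Th).
Hypotheses (intO : interior (closure Omega) = Omega).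
Variables (sigma : R) (c : 'I_(nelt Th) -> plane R).
Hypothesis sig0 : 0 < sigma.
Hypothesis hc : forall t, [set x | enorm (x - c t) <= mesh_size Th / sigma] `<=` elt t.

(** [Vloc] constrains point values only. The open set [D'] meets a small ball around the centre of
    [t], hence contains a small square inside [t]; the affine function [v] vanishes there, so its
    coefficients are zero. *)
Lemma vloc_eq0 (D D' : set (plane R)) (v : dgspace R Th) t :
  open D' -> D' `<=` closure Omega -> D' `&` D = set0 -> elt t `<=` closure D' ->
  Vloc Omega D v -> forall k : 'I_3, v t k = 0.
Proof.
move=> oD' sub dis tD' hv.
have h0 : 0 < mesh_size Th / (8 * sigma) by rewrite divr_gt0 ?mulr_gt0 ?(mesh_size_gt0 ndh t).
set r := mesh_size Th / _ in h0.
(* Room to spare: points of the square are within [2 * r] of the centre in each coordinate. *)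
have h8 : mesh_size Th / sigma = 8 * r by rewrite /r; field; exact: lt0r_neq0.
have inD x : D' x -> (Omega `\` closure D) x.
  move=> D'x; split; last exact: disjoint_open_closure dis D'x.
  rewrite -intO; apply: filterS sub _; exact: open_nbhs_nbhs.
have ct : elt t (c t).
  by apply: hc => /=; rewrite subrr /enorm /dot /= mulr0 addr0 sqrtr0 h8 mulr_ge0 // ltW.
have [x [D'x /= xc]] : D' `&` ball (c t) r !=set0 by apply: tD' ct _ _; exact: nbhsx_ballx.
have [e e0 he] : exists2 e, 0 < e & ball x e `<=` D'.
  by have /nbhs_ballP [e] := open_nbhs_nbhs (conj oD' D'x); exists e.
pose dl := Num.min (e / 2) r.
have dl0 : 0 < dl by rewrite lt_min h0 divr_gt0.
have dle : dl < e by rewrite gt_min; apply/orP; left; lra.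
have dlr : dl <= r by rewrite ge_min lexx orbT.
have zero y : `|x.1 - y.1| <= dl -> `|x.2 - y.2| <= dl -> ev v t y = 0.
  move=> y1 y2; apply: hv.
    apply: hc => /=; rewrite h8.
    case: xc => xc1 xc2; move: xc1 xc2; rewrite /ball /= => xc1 xc2.
    have z1 : `|(y - c t).1| <= 2 * r.
      by move: y1 xc1; rewrite ler_norml ltr_norml ler_norml /= => /andP[a1 a2] /andP[a3 a4]; apply/andP; split; lra.
    have z2 : `|(y - c t).2| <= 2 * r.
      by move: y2 xc2; rewrite ler_norml ltr_norml ler_norml /= => /andP[a1 a2] /andP[a3 a4]; apply/andP; split; lra.
    rewrite enorm_le; last lra.
    rewrite /dot -!expr2 -(real_normK (num_real (y - c t).1)) -(real_normK (num_real (y - c t).2)).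
    have := normr_ge0 (y - c t).1; have := normr_ge0 (y - c t).2; nra.
  apply: inD; apply: he; split; rewrite /ball /=; exact: le_lt_trans dle.
have z0 := zero x; have z1 := zero (x.1 + dl, x.2); have z2 := zero (x.1, x.2 + dl).
rewrite /ev /= !subrr !normr0 in z0 z1 z2.
rewrite (ltW dl0) in z0 z1 z2.
have E x1 : x1 - (x1 + dl) = - dl by ring.
rewrite !E normrN gtr0_norm // lexx in z1 z2.
have {}z0 := z0 isT isT; have {}z1 := z1 isT isT; have {}z2 := z2 isT isT.
have q1 : v t 1 * dl = 0 by lra.
have q2 : v t 2 * dl = 0 by lra.
have w1 : v t 1 = 0 by move/eqP: q1; rewrite mulf_eq0 (gt_eqF dl0) orbF => /eqP.
have w2 : v t 2 = 0 by move/eqP: q2; rewrite mulf_eq0 (gt_eqF dl0) orbF => /eqP.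
have w0 : v t 0 = 0 by move: z0; rewrite w1 w2; lra.
by move=> k; case: (ord3P k) => ->.
Qed.

Definition dead (w : dgspace R Th) (e : edge Th) :=
  (forall k : 'I_3, w e.1.1 k = 0) /\ (forall s', e.2 = Some s' -> forall k : 'I_3, w s'.1 k = 0).

Lemma dead_jmp w e x : is_edge e -> dead w e -> jmp w e.1 x = 0.
Proof.
rewrite (is_edgeE ndh cfh) => /andP[/eqP hn _] [w1 w2]; rewrite /jmp hn /ev.
by case: e.2 w2 => [s'|] w2; rewrite !w1 ?(w2 _ erefl); ring.
Qed.

Lemma dead_flux al w e : dead w e -> dot (avg_flux al w e) (normal e.1) = 0.
Proof.
move=> [w1 w2]; rewrite /avg_flux.
by case: e.2 w2 => [s'|] w2; rewrite /grad !w1 ?(w2 _ erefl) // /dot /scalep /=; ring.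
Qed.

Lemma a_h_dead al eta (u v : dgspace R Th) :
  (forall t, (forall k : 'I_3, u t k = 0) \/ (forall k : 'I_3, v t k = 0)) ->
  (forall e, is_edge e -> dead u e \/ dead v e) -> a_h al eta u v = 0.
Proof.
move=> ht he; rewrite /a_h big1; last first.
  move=> t _; rewrite elt_energyE // /dot /grad /=.
  by case: (ht t) => z; rewrite !z; ring.
rewrite !(flux_formE ndh cfh) (jump_formE ndh cfh) !big1; first ring.
- move=> e ie; case: (he e ie) => de; rewrite !(dead_jmp _ ie de); ring.
- move=> e ie; case: (he e ie) => de; first by rewrite !(dead_jmp _ ie de); ring.
  by rewrite (dead_flux _ de); ring.
- move=> e ie; case: (he e ie) => de; last by rewrite !(dead_jmp _ ie de); ring.
  by rewrite (dead_flux _ de); ring.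
Qed.

Variables (N : nat) (Dm : 'I_N -> set (plane R)) (chT : 'I_(nelt Th) -> 'I_N).
Hypotheses (openD : forall i, open (Dm i)) (disD : forall i j, i != j -> Dm i `&` Dm j = set0).
Hypotheses (subD : forall i, Dm i `<=` closure Omega) (hchT : forall t, elt t `<=` closure (Dm (chT t))).

Lemma vloc_chT i (v : dgspace R Th) t : Vloc Omega (Dm i) v -> chT t != i -> forall k : 'I_3, v t k = 0.
Proof. move=> hv ti; exact: (vloc_eq0 (@openD (chT t)) (@subD _) (disD ti) (@hchT t) hv). Qed.

(** Edge terms couple neighbouring elements, so disjoint supports alone do not suffice. An edge on
    which neither function vanishes on all adjacent elements would join an element of [Dm i] to one
    of [Dm j]. *)
Lemma a_h_nonadjacent al eta i j (u v : dgspace R Th) : i != j -> ~ Defs.adjacent Th (Dm i) (Dm j) ->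
  Vloc Omega (Dm i) u -> Vloc Omega (Dm j) v -> a_h al eta u v = 0.
Proof.
move=> ij nadj hu hv; apply: a_h_dead => [t|[s o] ie].
  case: (eqVneq (chT t) i) => [ti|ti]; last by left; exact: vloc_chT hu ti.
  by right; apply: vloc_chT hv _; rewrite ti.
have disj t : (forall k : 'I_3, u t k = 0) \/ (forall k : 'I_3, v t k = 0).
  case: (eqVneq (chT t) i) => [ti|ti]; last by left; exact: vloc_chT hu ti.
  by right; apply: vloc_chT hv _; rewrite ti.
case: o ie => [s'|] ie; last first.
  by case: (disj s.1) => z; [left|right]; split.
case: (eqVneq (chT s.1) i) (eqVneq (chT s'.1) i) => [ti|ti] [ti'|ti'].
- right; split=> /= [|_ [<-]]; apply: vloc_chT hv _; first by rewrite ti.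
  by rewrite ti'.
- right; split=> /= [|_ [<-]]; apply: vloc_chT hv _; first by rewrite ti.
  apply/eqP => tj; apply: nadj; exists s, s'; split=> //; left.
  by rewrite -ti -tj; split; exact: hchT.
- right; split=> /= [|_ [<-]]; apply: vloc_chT hv _; last by rewrite ti'.
  apply/eqP => tj; apply: nadj; exists s, s'; split=> //; right.
  by rewrite -ti' -tj; split; exact: hchT.
- by left; split=> /= [|_ [<-]]; apply: vloc_chT hu _.
Qed.

End Subdomains.

Lemma adjacent_sym (R : realType) (Th : mesh R) (D D' : set (plane R)) :
  Defs.adjacent Th D D' -> Defs.adjacent Th D' D.
Proof. by move=> [s [s' [hs [h|h]]]]; exists s, s'; split=> //; [right|left]. Qed.

(** * The final constant and its comparison with [lambda] *)

Section Constant.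
Variables (R : realType) (sigma alpha0 eta0 c : R).
Hypotheses (s0 : 0 < sigma) (a0 : 0 < alpha0) (e0 : 0 < eta0) (c0 : 0 < c).

Definition c_split : R :=
  c_upper sigma eta0 * (9 * c_lower sigma c * (c_gamma sigma / alpha0) +
    5 / 2 * (c_trace sigma * c_mass sigma alpha0) / c * c_gamma sigma).

Let G0 : 0 < c_gamma sigma.
Proof. by apply: mulr_gt0 (exprn_gt0 _ s0); rewrite mulr_gt0 ?c_ref_gt0. Qed.

Let L0 : 0 < c_lower sigma c.
Proof.
by rewrite /c_lower addr_gt0 // divr_gt0 // addr_gt0 // mulr_gt0 ?c_flux_gt0.
Qed.

Let K0 : 0 < 5 / 2 * (c_trace sigma * c_mass sigma alpha0) / c.
Proof.
apply: divr_gt0 c0; apply: mulr_gt0; first exact: divr_gt0.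
by rewrite mulr_gt0 ?c_trace_gt0 // divr_gt0 // ltr_wpDl ?sqr_ge0.
Qed.

Let U0 : 0 < c_upper sigma eta0.
Proof.
by rewrite /c_upper addr_gt0 ?divr_gt0 // ?addr_gt0 // mulr_gt0 ?c_flux_gt0.
Qed.

Lemma c_split_gt0 : 0 < c_split.
Proof.
apply: mulr_gt0 U0 _; apply: addr_gt0; last exact: mulr_gt0.
by rewrite mulr_gt0 ?divr_gt0 // mulr_gt0.
Qed.

(** The lower bound on [g], which stands for [gamma 1], brings [w] below [c_gamma * (w * g)] and the
    constant summand below a multiple of [ga], that is, of [gamma] for the coefficient. *)
Lemma split_factor_le (w g ga b : R) :
  0 <= w -> 0 <= g -> 1 <= c_gamma sigma * g -> alpha0 * g <= ga ->
  c_upper sigma eta0 * (9 * c_lower sigma c +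
    5 / 2 * (c_trace sigma * c_mass sigma alpha0) * w / c) <=
  c_split * (w * g + Num.max ga b).
Proof.
move=> w0 g0 Gg ag; set m := Num.max ga b.
have m0 : alpha0 * g <= m by apply: le_trans ag _; rewrite le_max lexx.
have ag0 : 0 <= alpha0 * g by rewrite mulr_ge0 // ltW.
have wg0 : 0 <= w * g by rewrite mulr_ge0.
rewrite /c_split -[leRHS]mulrA ler_pM2l // [leRHS]mulrDl; apply: lerD.
  rewrite -[leLHS]mulr1 -[leRHS]mulrA ler_pM2l ?mulr_gt0 //.
  apply: le_trans Gg _; rewrite -mulrA ler_pM2l // mulrC ler_pdivlMr //; lra.
rewrite mulrAC -[leRHS]mulrA ler_pM2l //.
apply: (@le_trans _ _ (c_gamma sigma * (w * g))); last by rewrite ler_pM2l //; lra.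
by rewrite mulrCA ler_peMr.
Qed.

End Constant.

Theorem theorem3p1 (R : realType) (sigma alpha0 eta0 c : R) (M : nat)
  (hsigma : 0 < sigma) (halpha0 : 0 < alpha0) (heta0 : 0 < eta0) (hc : 0 < c) :
  exists2 C : R, 0 < C &
  forall (Omega : set (plane R)) (Th TH : mesh R) (N : nat)
    (Om : 'I_N -> set (plane R)) (al : 'I_(nelt Th) -> R)
    (psi : 'I_(nelt TH) -> 'I_3 -> plane R -> R)
    (phi : 'I_(nelt TH) -> 'I_3 -> dgspace R Th)
    (Ceta : R -> R) (eta : R),
  polygonal_domain Omega ->
  triangulation Th Omega -> triangulation TH Omega -> refines Th TH ->
  quasi_uniform Th sigma -> quasi_uniform TH sigma ->
  subdomain_partition Th TH Omega Om -> bounded_adjacency Th Om M ->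
  (forall tau, alpha0 <= al tau) ->
  (forall K, boundary_data Th K (psi K)) ->
  multiscale_basis al psi phi ->
  (forall t, eta0 < t -> 0 < Ceta t /\ coercive al t (Ceta t)) ->
  eta0 < eta -> c <= Ceta eta ->
  (forall u : dgspace R Th,
     exists (u0 : dgspace R Th) (ul : 'I_N -> dgspace R Th),
     [/\ u0 \in V0 phi, forall i, Vloc Omega (Om i) (ul i),
         u = u0 + \sum_i ul i
       & a_h al eta u0 u0 + \sum_i a_h al eta (ul i) (ul i)
         <= C * lambda al eta phi * a_h al eta u u]) /\
  (forall (T0 : 'End(dgspace R Th)) (Tl : 'I_N -> 'End(dgspace R Th)),
     galerkin_projection (a_h al eta) (fun v => v \in V0 phi) T0 ->
     (forall i, galerkin_projection (a_h al eta) (Vloc Omega (Om i)) (Tl i)) ->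
     exists2 kappa : R, condition_number (T0 + \sum_i Tl i) kappa
       & kappa <= C * lambda al eta phi).
Proof.
pose C1 := c_split sigma alpha0 eta0 c.
have C10 : 0 < C1 by exact: c_split_gt0.
have M20 : 0 < M%:R + 2 :> R by rewrite ltr_wpDl.
(* [C1] suffices for the splitting; the factor [M + 2], a bound for the largest eigenvalue, is paid
   for the condition number. *)
exists ((M%:R + 2) * C1); first exact: mulr_gt0.
move=> Omega Th TH N Om al psi phi Ceta eta [_ _ [xO Ox] intO _] [ndh cfh covh] [ndH cfH covH]
  [hsub _] qh qH [openD disD covD alignD] hM hal hpsi hphi hCeta heta hcC.
have [cT hcT] := choice qh; have [cH hcH] := choice qH.
have al0 t : 0 < al t by exact: lt_le_trans (hal t).
have [_ hcoC] := hCeta eta heta.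
have E0 u : 0 <= energy al u by exact: energy_ge0.
have J0 u : 0 <= jump_form al u u by exact: jump_form_ge0.
(* Replacing [Ceta eta] by its lower bound [c] keeps the constants independent of [eta]. *)
have hco : coercive al eta c.
  move=> u; apply: le_trans (hcoC u); rewrite ler_wpM2r // dgnorm2E.
  exact: addr_ge0 (E0 u) (J0 u).
have subD i : Om i `<=` closure Omega.
  by move=> x /subset_closure Dx; rewrite covD; exists i.
(* An interior point of [K] selects the subdomain, and alignment puts all of [K] in its closure. *)
have exK (K : 'I_(nelt TH)) : exists i, elt K `<=` closure (Om i).
  have [x hx] := ipt_exists ndH K.
  have : closure Omega x by rewrite covH; exists K => //; exact: ipt_elt hx.
  rewrite covD => -[i _ Dx]; exists i.
  exact: aligned_sub ndH cfH (alignD i).2 hx Dx.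
have [chK hchK] := choice exK; have [Kof hKof] := choice hsub.
have hin t : inK (Kof t) t by apply/asboolP; exact: hKof.
pose chT t := chK (Kof t).
have hchT t : elt t `<=` closure (Om (chT t)) by move=> x /hKof; exact: hchK.
(* The domain is nonempty, so there is an element: this yields the lower bound on [gamma 1] and a
   nonzero function for the eigenvalues. *)
have [t0 _ _] : exists2 t : 'I_(nelt Th), setT t & elt t xO.
  by have := subset_closure Ox; rewrite covh => -[t]; exists t.
pose K0 := Kof t0.
have g1 := gamma1_ge ndh cfh covh ndH cfH covH hsub hsigma hcT hcH al0 hpsi hphi K0.
have ga := gamma_ge_min phi ndh (area_gt0 ndh hsigma hcT) halpha0 hal.
have g0 : 0 <= Defs.gamma (fun=> 1) phi :> R by exact: bigmax_ge_id.
have W0 : 0 <= max_coarse_weight TH al by exact: bigmax_ge_id.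
have n0 : 0 <= mesh_size TH / mesh_size Th by rewrite divr_ge0 ?mesh_size_ge0.
have w0 : 0 <= eta * max_coarse_weight TH al * (mesh_size TH / mesh_size Th).
  by rewrite mulr_ge0 // mulr_ge0 // ltW // (lt_trans heta0).
have fac := split_factor_le hsigma halpha0 heta0 hc (eta * beta al phi) w0 g0 g1 ga.
have lamE : lambda al eta phi =
    eta * max_coarse_weight TH al * (mesh_size TH / mesh_size Th) * Defs.gamma (fun=> 1) phi +
    Num.max (Defs.gamma al phi) (eta * beta al phi) by rewrite /lambda; congr (_ + _); ring.
rewrite -lamE -/C1 in fac.
have lam0 : 0 < lambda al eta phi.
  have gg : 0 < Defs.gamma (fun=> 1) phi :> R.
    rewrite lt_neqAle g0 andbT; apply/eqP => z; move: g1; rewrite -z mulr0; lra.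
  rewrite lamE; apply: ltr_wpDl (mulr_ge0 w0 g0) _; rewrite lt_max; apply/orP; left.
  by apply: lt_le_trans ga; rewrite mulr_gt0.
have ah0 u : 0 <= a_h al eta u u by exact: (a_h_ge0 ndh cfh halpha0 hal hc hco).
have split u : exists (u0 : dgspace R Th) (ul : 'I_N -> dgspace R Th),
    [/\ u0 \in V0 phi, forall i, Vloc Omega (Om i) (ul i), u = u0 + \sum_i ul i
      & a_h al eta u0 u0 + \sum_i a_h al eta (ul i) (ul i) <= C1 * lambda al eta phi * a_h al eta u u].
  have [cf hcf] := choice (fun K => coarse_constant ndh cfh covh ndH cfH covH hsub hsigma hcT hcH K u).
  exists (u0 Kof cf), (ul chK Kof u cf); split.
  - exact: (u0_V0 ndh cfh covh ndH cfH covH hsub hsigma hcT hcH halpha0 hal hpsi hphi hin).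
  - move=> i t x tx [_ nx]; rewrite ev_ul; case: eqP => // ti; case: nx.
    by rewrite -ti; exact: hchT.
  - exact: decomposition.
  - apply: le_trans (ler_wpM2r (ah0 u) fac).
    exact: (decomposition_stable ndh cfh covh ndH cfH covH hsub hsigma hcT halpha0 hal heta0
      heta hc hco chK hin (fun K => (hcf K).1) (fun K => (hcf K).2)).
have CM : C1 <= (M%:R + 2) * C1.
  by rewrite ler_peMl ?(ltW C10) //; have : 0 <= M%:R :> R by []; lra.
split=> [u|T0 Tl hT0 hTl].
  have [u0 [ul [h1 h2 h3 h4]]] := split u; exists u0, ul; split=> //.
  by apply: le_trans h4 _; rewrite ler_wpM2r // ler_wpM2r // ltW.
have orth i j u v : Vloc Omega (Om i) u -> Vloc Omega (Om j) v ->
    ~~ `[< Defs.adjacent Th (Om i) (Om j) >] -> i != j -> a_h al eta u v = 0.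
  move=> hu hv /asboolPn nadj ij.
  exact: (a_h_nonadjacent ndh cfh intO hsigma hcT (fun i => (openD i).1) disD subD hchT al eta ij nadj hu hv).
apply: (schwarz_condition (a_h_linear ndh cfh al eta) (a_h_sym ndh cfh al eta) _ hT0 hTl orth _ hM
  _ split).
- by move=> u; exact: (a_h_pos ndh cfh hsigma hcT halpha0 hal hc hco).
- by move=> i j; apply/asboolP/asboolP; exact: adjacent_sym.
- exact: mulr_gt0.
- exists (\matrix_(t, k) 1); apply/eqP => /matrixP /(_ t0 0); rewrite !mxE.
  by apply/eqP; exact: oner_neq0.
- by rewrite mulrA.
Qed.
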